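(* Assume that $a,b$ are $C_{\mathrm{Lip}}$-Lipschitz in $x$ uniformly in time ($|a(s,x)-a(s,y)|\le C_{\mathrm{Lip}}|x-y|$, $\|b(s,x)-b(s,y)\|_{\mathrm F}\le C_{\mathrm{Lip}}|x-y|$), satisfy $|a(s,x)|^2+\|b(s,x)\|_{\mathrm F}^2\le C_{\mathrm{lgb}}(1+|x|^2)$, and that the initial datum is $\mathcal F_0$-measurable and square integrable. If the SDE is non-autonomous, assume in addition that there exist $\alpha>0$, $C_{\mathrm{na}}>0$ such that $$|a(t,x)-a(s,x)|+|b(t,x)-b(s,x)|\le C_{\mathrm{na}}(1+|x|)|t-s|^\alpha\quad\text{for all } t,s\in[0,T],\ x\in\mathbb R^d$$ (in the autonomous case this holds trivially for every $\alpha$, and $\min\{\tfrac12,\alpha\}$ below is read as $\tfrac12$). Let $X(t)=U(t)^\top Y(t)$, $t\in[0,T]$, be the rank-$k$ DO solution, let $t_n=n\Delta t$, $n=0,\dots,N$, be a uniform partition of $[0,T]$ with step $\Delta t=T/N$, and let $\{X_n\}_{0\le n\le N}$, $X_n=U_n^\top Y_n$, be the DLR Euler--Maruyama solution on this partition with the same initial data $(U_0,Y_0)$. Suppose there is $\gamma>0$ such that $|C_{Y(s)}^{-1}|\le \frac1\gamma$ and $|C_{Y_{n_s}}^{-1}|\le\frac1\gamma$ for all $s\in[0,T]$, where $n_s=\max\{n\in\{0,\dots,N\}:t_n\le s\}$, and that for all $n=0,\dots,N-1$ $$\Delta t\le \frac{\sqrt{\sigma_n^k}}{\sqrt{C_{\mathrm{lgb}}}\,\sqrt{5(1+\mathbb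 E[|X_0|^2])\exp\left(C_{\mathrm{lgb}}(2T^2+8T)\right)}},$$ with $\sigma_n^k$ the smallest eigenvalue of $C_{Y_n}$. Then the DLR Euler--Maruyama method has strong order of convergence $\min\{\frac12,\alpha\}$: there exists a constant $C=C(\gamma,k,T)$ (depending also on the fixed problem data), independent of $\Delta t$, such that $$\sqrt{\mathbb E\Big[\max_{0\le n\le N}|X_n-X(t_n)|^2\Big]}\le C\,(\Delta t)^{\min\{\frac12,\alpha\}}.$$
   Context: Setting. $(\Omega,\mathcal F,\mathbb P,(\mathcal F_t)_{t\ge 0})$ is a filtered complete probability space with the usual conditions, $W$ an $m$-dimensional $(\mathcal F_t)$-Brownian motion, $T>0$, $1\le k\le d$. The maps $a:[0,\infty)\times\mathbb R^d\to\mathbb R^d$ and $b:[0,\infty)\times\mathbb R^d\to\mathbb R^{d\times m}$ are Borel measurable; the SDE to be approximated is $\mathrm dX^{\mathrm{true}}=a(t,X^{\mathrm{true}})\mathrm dt+b(t,X^{\mathrm{true}})\mathrm dW_t$, $X^{\mathrm{true}}(0)=X^{\mathrm{true}}_0$. Notation. $|v|$ Euclidean norm of a vector, $|A|$ spectral norm and $\|A\|_{\mathrm F}$ Frobenius norm of a matrix. For $Y\in L^2(\Omega;\mathbb R^k)$, $C_Y:=\mathbb E[YY^\top]$. For $U\in\mathbb R^{k\times d}$ with orthonormal rows, $P_U:=U^\top U$. DO solution. Given $U_0\in\mathbb R^{k\times d}$ with $U_0U_0^\top=I_{k\times k}$ and $\mathcal F_0$-measurable $Y_0\in L^2(\Omega;\mathbb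 R^k)$ with linearly independent components ($U_0^\top Y_0$ being a rank-$k$ approximation of $X_0^{\mathrm{true}}$), the rank-$k$ DO solution is $X(t)=U(t)^\top Y(t)$ where $U:[0,T]\to\mathbb R^{k\times d}$ is deterministic, absolutely continuous, with $U(t)U(t)^\top=I_{k\times k}$, $U(t)\dot U(t)^\top=0$, $U(0)=U_0$, and $Y$ is an adapted process with a.s. continuous paths in $\mathbb R^k$, square integrable, with components linearly independent in $L^2(\Omega)$ at each time, such that $$C_{Y(t)}\dot U(t)=\mathbb E[Y(t)a(t,U(t)^\top Y(t))^\top](I_{d\times d}-P_{U(t)}),$$ $$Y(t)=Y_0+\int_0^tU(s)a(s,U(s)^\top Y(s))\mathrm ds+\int_0^tU(s)b(s,U(s)^\top Y(s))\mathrm dW_s.$$ It is assumed to exist on $[0,T]$. DLR Euler--Maruyama scheme. With $\Delta W_n=W(t_{n+1})-W(t_n)$ and initial data $(U_0,Y_0)$, for $n=0,\dots,N-1$ set $$\tilde Y_{n+1}=Y_n+U_na(t_n,U_n^\top Y_n)\Delta t+U_nb(t_n,U_n^\top Y_n)\Delta W_n,$$ $$C_{Y_n}\tilde U_{n+1}=C_{Y_n}U_n+\mathbb E[Y_na(t_n,U_n^\top Y_n)^\top](I_{d\times d}-P_{U_n})\Delta t,$$ compute the reduced QR decomposition $\tilde U_{n+1}^\top=U_{n+1}^\top R_{n+1}$, with $U_{n+1}U_{n+1}^\top=I_{k\times k}$ and $R_{n+1}\in\mathbb R^{k\times k}$ upper triangular (QR by Cholesky factorization or Gram--Schmidt, i.e.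 positive diagonal), and set $Y_{n+1}=R_{n+1}\tilde Y_{n+1}$. Then $X_n=U_n^\top Y_n$. *)

(* Defs.v *)
From HB Require Import structures.
From mathcomp Require Export all_boot all_order all_algebra.
From mathcomp Require Export all_classical all_reals all_analysis.
Export Order.TTheory GRing.Theory Num.Theory.
Export numFieldNormedType.Exports.

#[export] Set Implicit Arguments.
#[export] Unset Strict Implicit.
#[export] Unset Printing Implicit Defensive.

Local Open Scope classical_set_scope.
Local Open Scope ring_scope.

(* The norm `|_| that MathComp-Analysis puts on matrices is the sup norm of the
   entries, hence the explicit norms below. *)
Section Norms.
Variable R : realType.

Definition enorm n (v : 'cV[R]_n) : R := Num.sqrt (\sum_i v i 0 ^+ 2).

Definition fnorm p q (A : 'M[R]_(p, q)) : R :=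
  Num.sqrt (\sum_i \sum_j A i j ^+ 2).

Definition specnorm p q (A : 'M[R]_(p, q)) : R :=
  sup [set enorm (A *m v) | v in [set v : 'cV[R]_q | enorm v <= 1]].

(* [invmx C] is [C] itself when [C] is singular, so invertibility is explicit. *)
Definition inv_norm_le n (C : 'M[R]_n) (r : R) : Prop :=
  C \in unitmx /\ specnorm (invmx C) <= r.

Definition smallest_eigenvalue n (C : 'M[R]_n) (s : R) : Prop :=
  eigenvalue C s /\ forall x, eigenvalue C x -> s <= x.

End Norms.

Definition borel_on (S V : topologicalType) (D : set S) (f : S -> V) : Prop :=
  forall B : set V, open B -> <<s open >> (D `&` f @^-1` B).

Section Coefficients.
Variables (R : realType) (d m : nat).
Variables (a : R -> 'cV[R]_d -> 'cV[R]_d) (b : R -> 'cV[R]_d -> 'M[R]_(d, m)).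

Definition borel_coefficients : Prop :=
  let D := [set z : R * 'cV[R]_d | 0 <= z.1] in
  borel_on D (fun z : R * 'cV[R]_d => a z.1 z.2) /\
  borel_on D (fun z : R * 'cV[R]_d => b z.1 z.2).

Definition lipschitz_in_space (CLip : R) : Prop :=
  forall (s : R) x y, 0 <= s ->
    enorm (a s x - a s y) <= CLip * enorm (x - y) /\
    fnorm (b s x - b s y) <= CLip * enorm (x - y).

Definition linear_growth (Clgb : R) : Prop :=
  forall (s : R) x, 0 <= s ->
    enorm (a s x) ^+ 2 + fnorm (b s x) ^+ 2 <= Clgb * (1 + enorm x ^+ 2).

Definition autonomous : Prop :=
  forall (t s : R) x, 0 <= t -> 0 <= s -> a t x = a s x /\ b t x = b s x.

Definition holder_in_time (T alpha Cna : R) : Prop :=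
  forall (t s : R) x, 0 <= t <= T -> 0 <= s <= T ->
    enorm (a t x - a s x) + specnorm (b t x - b s x)
      <= Cna * (1 + enorm x) * `|t - s| `^ alpha.

(* [rate] plays the role of min(1/2, alpha), read as 1/2 if a, b are
   autonomous. *)
Definition time_regularity (T rate : R) : Prop :=
  (autonomous /\ rate = 2^-1) \/
  exists alpha Cna : R, [/\ 0 < alpha, 0 < Cna, holder_in_time T alpha Cna
    & rate = Num.min 2^-1 alpha].

End Coefficients.

Section Probability.
Variables (R : realType) (dO : measure_display) (Omega : measurableType dO).
Variable P : probability Omega R.

Record usual_conditions (F : R -> set (set Omega)) : Prop := {
  uc_complete : measure_is_complete P;
  uc_sigma_algebra : forall t : R, 0 <= t -> sigma_algebra setT (F t);
  uc_measurable : forall t : R, 0 <= t -> F t `<=` measurable;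
  uc_nondecreasing : forall s t : R, 0 <= s -> s <= t -> F s `<=` F t;
  uc_right_continuous :
    forall t : R, 0 <= t -> F t = \bigcap_(s in [set s | t < s]) F s;
  uc_null_sets : P.-negligible `<=` F 0 }.

Definition rv_measurable (G : set (set Omega)) p q
    (X : Omega -> 'M[R]_(p, q)) : Prop :=
  forall i j (B : set R), measurable B -> G ((fun w => X w i j) @^-1` B).

Definition Emx p q (Z : Omega -> 'M[R]_(p, q)) : 'M[R]_(p, q) :=
  \matrix_(i, j) fine ('E_P[fun w => Z w i j])%E.

Definition second_moment k (Y : Omega -> 'cV[R]_k) : 'M[R]_k :=
  Emx (fun w => Y w *m (Y w)^T).

Definition square_integrable k (Y : Omega -> 'cV[R]_k) : Prop :=
  ('E_P[fun w => (enorm (Y w) ^+ 2)%R] < +oo)%E.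

Definition linearly_independent k (Y : Omega -> 'cV[R]_k) : Prop :=
  forall c : 'cV[R]_k,
    {ae P, forall w, \sum_i c i 0 * Y w i 0 = 0} -> c = 0.

Record brownian_motion (F : R -> set (set Omega)) m
    (W : R -> Omega -> 'cV[R]_m) : Prop := {
  bm_adapted : forall t : R, 0 <= t -> rv_measurable (F t) (W t);
  bm_zero : {ae P, forall w, W 0 w = 0};
  bm_continuous :
    {ae P, forall w, {within [set t | 0 <= t], continuous (fun t => W t w)}};
  bm_independent : forall s t : R, 0 <= s -> s < t ->
    forall (A : set Omega) (B : set 'cV[R]_m), F s A -> <<s open >> B ->
    let E := [set w | B (W t w - W s w)] in
    (P (A `&` E) = P A * P E)%E;
  bm_gaussian : forall s t : R, 0 <= s -> s < t ->
    forall B : 'I_m -> set R, (forall i, measurable (B i)) ->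
    P [set w | forall i, B i ((W t w - W s w) i 0)]
      = (\big[mule/1]_(i < m) normal_prob 0 (Num.sqrt (t - s)) (B i))%E }.

(* The L^2 Ito integral on [0, T]: limit in mean square of the elementary
   integrals of simple processes approximating the integrand in
   L^2(Omega x [0, T]). *)
Record simple_process p m := SimpleProcess {
  sp_size : nat;
  sp_time : nat -> R;
  sp_coef : nat -> Omega -> 'M[R]_(p, m) }.

Record simple_process_wf (F : R -> set (set Omega)) (T : R) p m
    (S : simple_process p m) : Prop := {
  sp_start : sp_time S 0%N = 0;
  sp_end : sp_time S (sp_size S) = T;
  sp_increasing :
    forall j, (j < sp_size S)%N -> sp_time S j < sp_time S j.+1;
  sp_adapted : forall j, (j < sp_size S)%N ->
    rv_measurable (F (sp_time S j)) (sp_coef S j);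
  sp_bounded : exists K : R, forall j w, (j < sp_size S)%N ->
    fnorm (sp_coef S j w) <= K }.

Definition sp_eval p m (S : simple_process p m) (t : R) (w : Omega)
    : 'M[R]_(p, m) :=
  \sum_(j < sp_size S)
    (sp_time S j < t <= sp_time S j.+1)%R%:R *: sp_coef S j w.

Definition sp_integral p m (S : simple_process p m)
    (W : R -> Omega -> 'cV[R]_m) (t : R) (w : Omega) : 'cV[R]_p :=
  \sum_(j < sp_size S) sp_coef S j w *m
    (W (Num.min (sp_time S j.+1) t) w - W (Num.min (sp_time S j) t) w).

(* [M] is the continuous version of t |-> \int_0^t H dW on [0, T].  Since the
   processes at hand have nice paths only almost surely, joint measurability of
   [H] is required off a null set. *)
Record ito_integral (F : R -> set (set Omega)) (T : R) p m
    (W : R -> Omega -> 'cV[R]_m) (H : R -> Omega -> 'M[R]_(p, m))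
    (M : R -> Omega -> 'cV[R]_p) : Prop := {
  ito_integrand_adapted :
    forall t : R, 0 <= t <= T -> rv_measurable (F t) (H t);
  ito_integrand_measurable : exists2 N : set Omega, measurable N /\ P N = 0%E &
    forall i j, measurable_fun (`[0, T] `*` ~` N)
      (fun z : R * Omega => H z.1 z.2 i j);
  ito_adapted : forall t : R, 0 <= t <= T -> rv_measurable (F t) (M t);
  ito_continuous :
    {ae P, forall w, {within `[0, T], continuous (fun t => M t w)}};
  ito_limit : exists S : nat -> simple_process p m,
    [/\ forall n, simple_process_wf F T (S n),
        (fun n : nat => \int[P]_w \int[lebesgue_measure]_(t in `[0%R, T])
           ((fnorm (H t w - sp_eval (S n) t w) ^+ 2)%R)%:E)%E @ \oo --> 0%E
      & forall t : R, 0 <= t <= T ->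
        (fun n => 'E_P[fun w =>
            (enorm (M t w - sp_integral (S n) W t w) ^+ 2)%R])%E
          @ \oo --> 0%E] }.

End Probability.

Definition absolutely_continuous_on (R : realType) (x y : R) (f : R -> R)
    : Prop :=
  forall e, 0 < e -> exists2 delta, 0 < delta &
    forall (n : nat) (u v : nat -> R),
      (forall i, (i < n)%N -> [/\ x <= u i, u i <= v i & v i <= y]) ->
      (forall i, (i.+1 < n)%N -> v i <= u i.+1) ->
      \sum_(i < n) (v i - u i) < delta ->
      \sum_(i < n) `|f (v i) - f (u i)| < e.

Section Schemes.
Variables (R : realType) (dO : measure_display) (Omega : measurableType dO).
Variable P : probability Omega R.
Variables (d m k : nat).
Variables (a : R -> 'cV[R]_d -> 'cV[R]_d) (b : R -> 'cV[R]_d -> 'M[R]_(d, m)).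
Variable W : R -> Omega -> 'cV[R]_m.
Variables (U0 : 'M[R]_(k, d)) (Y0 : Omega -> 'cV[R]_k).

(* I - P_U *)
Definition coproj (U : 'M[R]_(k, d)) : 'M[R]_d := 1%:M - U^T *m U.

Definition drift_moment (t : R) (U : 'M[R]_(k, d)) (Y : Omega -> 'cV[R]_k)
    : 'M[R]_(k, d) :=
  Emx P (fun w => Y w *m (a t (U^T *m Y w))^T).

Record do_solution (F : R -> set (set Omega)) (T : R)
    (U : R -> 'M[R]_(k, d)) (Y : R -> Omega -> 'cV[R]_k) : Prop := {
  do_init : U 0 = U0;
  do_abs_continuous :
    forall i j, absolutely_continuous_on 0 T (fun t => U t i j);
  do_orthonormal : forall t : R, 0 <= t <= T -> U t *m (U t)^T = 1%:M;
  do_U_equation : {ae lebesgue_measure, forall t : R, 0 <= t <= T ->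
    [/\ derivable U t 1,
        U t *m ('D_1 U t)^T = 0
      & second_moment P (Y t) *m 'D_1 U t
          = drift_moment t (U t) (Y t) *m coproj (U t)]};
  do_adapted : forall t : R, 0 <= t <= T -> rv_measurable (F t) (Y t);
  do_continuous :
    {ae P, forall w, {within `[0, T], continuous (fun t => Y t w)}};
  do_square_integrable :
    forall t : R, 0 <= t <= T -> square_integrable P (Y t);
  do_linearly_independent :
    forall t : R, 0 <= t <= T -> linearly_independent P (Y t);
  do_Y_equation : exists2 M : R -> Omega -> 'cV[R]_k,
    ito_integral P F T W (fun s w => U s *m b s ((U s)^T *m Y s w)) M &
    {ae P, forall w, forall t : R, 0 <= t <= T ->
      Y t w = Y0 w
        + \col_i (\int[lebesgue_measure]_(s in `[0, t])
                    (U s *m a s ((U s)^T *m Y s w)) i 0)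
        + M t w} }.

Definition reduced_qr (A Q : 'M[R]_(k, d)) (R' : 'M[R]_k) : Prop :=
  [/\ A^T = Q^T *m R', Q *m Q^T = 1%:M,
      forall i j : 'I_k, (j < i)%N -> R' i j = 0
    & forall i, 0 < R' i i].

Record dlr_euler_maruyama (dt : R) (N : nat)
    (U : nat -> 'M[R]_(k, d)) (Y : nat -> Omega -> 'cV[R]_k) : Prop := {
  em_init_U : U 0%N = U0;
  em_init_Y : Y 0%N = Y0;
  em_step : forall n, (n < N)%N ->
    let t := n%:R * dt in
    let t' := n.+1%:R * dt in
    exists (U' : 'M[R]_(k, d)) (R' : 'M[R]_k),
    [/\ second_moment P (Y n) *m U'
          = second_moment P (Y n) *m U n
            + dt *: (drift_moment t (U n) (Y n) *m coproj (U n)),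
        reduced_qr U' (U n.+1) R'
      & forall w, Y n.+1 w = R' *m
          (Y n w + dt *: (U n *m a t ((U n)^T *m Y n w))
             + U n *m b t ((U n)^T *m Y n w) *m (W t' w - W t w))] }.

End Schemes.

(* Main.v *)
(* The pair [(U_n, Y_n)] is compared directly with [(U(t_n), Y(t_n))].  Put
   [G(t, U, Y) = C_Y^-1 E[Y a(t, U^T Y)^T] (I - P_U)], so that [U' = G] for the DO
   solution.  Since [U G^T = 0], the QR factor of a step satisfies
   [R^T R = I + dt^2 G_n G_n^T], and positivity of its diagonal gives
   [R = I + O(dt^2)]: up to [O(dt^2)] the scheme is the explicit Euler-Maruyama
   scheme for the coupled system [U' = G(t, U, Y)], [dY = U a dt + U b dW].
   As long as [E|Y|^2] and [C_Y^-1] are bounded, the coefficients of this system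
   are Lipschitz for the distance [|U - U'| + (E|Y - Y'|^2)^(1/2)].  The error of
   [Y] splits into a drift part and a discrete martingale; orthogonality of the
   martingale increments gives a discrete Gronwall inequality, and Doob's maximal
   inequality moves the maximum over [n] inside the expectation. *)
From HB Require Import structures.
Require Import Defs.
From mathcomp Require Import ring lra measurable_realfun.

Local Open Scope classical_set_scope.
Local Open Scope ring_scope.

(* Two moment bounds must precede the Gronwall argument, and both must be uniform, since the
   constant is fixed before the solution, the partition and the scheme. In the scheme,
   multiplication by [R] inflates the second moment by up to [1 + dt^2 |G|^2], and the bound on
   [|G|] itself grows like the second moment, so the moments obey a cubic recursion instead of a
   linear one. For the DO solution, [E|Y(t)|^2] is finite for each [t] but not given as bounded in
   [t]; a pathwise Gronwall bound on short intervals, whose length depends on the coefficients only,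
   replaces the usual argument on expectations. Regularity is scarce too: drift integrals are
   reached through Riemann sums, [U] is differentiable only almost everywhere, and the Ito integral
   is given only as a limit of simple integrals. Vanishing conditional expectations are expressed as
   orthogonality to square-integrable variables of the past, and norms as predicates [L2 X r]
   asserting a bound [r]. The lifted error is at most [|U_n - U(t_n)| |Y(t_n)| + |Y_n - Y(t_n)|]; as
   the first factor is deterministic, only the maxima of [|Y(t_n)|] and of the error of [Y] need
   Doob's inequality. *)
#[local] Hint Extern 0 (sigma_algebra _ _) => exact: sigma_algebra_measurable : core.

(** * Matrix norms and the Cholesky factor *)

Section FrobeniusNorm.
Variable R : realType.

(** Lagrange's identity: twice the defect is the double sum of the squares
    [(x_i y_j - x_j y_i)^2]. *)
Lemma sum_cauchy_schwarz (I : finType) (x y : I -> R) :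
  (\sum_i x i * y i) ^+ 2 <= (\sum_i x i ^+ 2) * (\sum_i y i ^+ 2).
Proof.
rewrite -subr_ge0.
have : 0 <= \sum_i \sum_j (x i * y j - x j * y i) ^+ 2.
  by apply: sumr_ge0 => i _; apply: sumr_ge0 => j _; exact: sqr_ge0.
suff -> : \sum_i \sum_j (x i * y j - x j * y i) ^+ 2 =
   2 * ((\sum_i x i ^+ 2) * (\sum_i y i ^+ 2) - (\sum_i x i * y i) ^+ 2).
  by rewrite pmulr_rge0.
have e1 : \sum_i \sum_j x i ^+ 2 * y j ^+ 2 = (\sum_i x i ^+ 2) * (\sum_i y i ^+ 2).
  by rewrite mulr_suml; apply: eq_bigr => i _; rewrite mulr_sumr.
have e2 : \sum_i \sum_j x j ^+ 2 * y i ^+ 2 = (\sum_i x i ^+ 2) * (\sum_i y i ^+ 2).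
  by rewrite exchange_big.
have e3 : \sum_i \sum_j (x i * y i) * (x j * y j) = (\sum_i x i * y i) ^+ 2.
  by rewrite expr2 mulr_suml; apply: eq_bigr => i _; rewrite mulr_sumr.
rewrite mulrBr mulr2n !mulrDl !mul1r -{1}e1 -e2 -e3 -!big_split /=.
rewrite -sumrB; apply: eq_bigr => i _.
rewrite -!big_split /= -sumrB; apply: eq_bigr => j _; ring.
Qed.

Lemma fnorm_ge0 p q (A : 'M[R]_(p, q)) : 0 <= fnorm A.
Proof. exact: sqrtr_ge0. Qed.

Lemma fnorm_sqr p q (A : 'M[R]_(p, q)) : fnorm A ^+ 2 = \sum_i \sum_j A i j ^+ 2.
Proof.
rewrite sqr_sqrtr //; apply: sumr_ge0 => i _; apply: sumr_ge0 => j _.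
exact: sqr_ge0.
Qed.

Lemma fnorm_sqr_pair p q (A : 'M[R]_(p, q)) :
  fnorm A ^+ 2 = \sum_(z : 'I_p * 'I_q) A z.1 z.2 ^+ 2.
Proof. by rewrite fnorm_sqr pair_big. Qed.

Lemma enormE n (v : 'cV[R]_n) : enorm v = fnorm v.
Proof. by rewrite /enorm /fnorm; congr Num.sqrt; apply: eq_bigr => i _; rewrite big_ord1. Qed.

Lemma le_fnorm p q p' q' (A : 'M[R]_(p, q)) (B : 'M[R]_(p', q')) :
  (fnorm A ^+ 2 <= fnorm B ^+ 2) = (fnorm A <= fnorm B).
Proof. by rewrite ler_pXn2r ?nnegrE ?fnorm_ge0. Qed.

Lemma fnorm0 p q : fnorm (0 : 'M[R]_(p, q)) = 0.
Proof.
by rewrite /fnorm big1 ?sqrtr0// => i _; rewrite big1// => j _; rewrite mxE expr0n.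
Qed.

Lemma fnormN p q (A : 'M[R]_(p, q)) : fnorm (- A) = fnorm A.
Proof.
rewrite /fnorm; congr Num.sqrt; apply: eq_bigr => i _; apply: eq_bigr => j _.
by rewrite mxE sqrrN.
Qed.

Lemma fnormBC p q (A B : 'M[R]_(p, q)) : fnorm (A - B) = fnorm (B - A).
Proof. by rewrite -fnormN opprB. Qed.

Lemma fnorm_tr p q (A : 'M[R]_(p, q)) : fnorm A^T = fnorm A.
Proof.
rewrite /fnorm exchange_big /=; congr Num.sqrt.
by apply: eq_bigr => i _; apply: eq_bigr => j _; rewrite mxE.
Qed.

Lemma fnormZ p q c (A : 'M[R]_(p, q)) : fnorm (c *: A) = `|c| * fnorm A.
Proof.
rewrite /fnorm -sqrtr_sqr -sqrtrM ?sqr_ge0//; congr Num.sqrt.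
rewrite mulr_sumr; apply: eq_bigr => i _; rewrite mulr_sumr.
by apply: eq_bigr => j _; rewrite mxE exprMn.
Qed.

Lemma fnorm_dot p q (A B : 'M[R]_(p, q)) :
  \sum_(z : 'I_p * 'I_q) A z.1 z.2 * B z.1 z.2 <= fnorm A * fnorm B.
Proof.
rewrite (le_trans (ler_norm _))// -[leRHS]ger0_norm ?mulr_ge0 ?fnorm_ge0//.
rewrite -ler_sqr ?nnegrE// !real_normK ?num_real// exprMn !fnorm_sqr_pair.
exact: sum_cauchy_schwarz.
Qed.

Lemma fnormD p q (A B : 'M[R]_(p, q)) : fnorm (A + B) <= fnorm A + fnorm B.
Proof.
rewrite -ler_sqr ?nnegrE ?addr_ge0 ?fnorm_ge0// fnorm_sqr_pair.
have -> : \sum_(z : 'I_p * 'I_q) (A + B) z.1 z.2 ^+ 2 = fnorm A ^+ 2 +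
   2 * (\sum_(z : 'I_p * 'I_q) A z.1 z.2 * B z.1 z.2) + fnorm B ^+ 2.
  rewrite !fnorm_sqr_pair mulr_sumr -!big_split /=.
  by apply: eq_bigr => z _; rewrite !mxE; ring.
rewrite sqrrD lerD2r lerD2l -[leRHS]mulr_natl ler_pM2l//.
exact: fnorm_dot.
Qed.

Lemma fnormB p q (A B : 'M[R]_(p, q)) : fnorm (A - B) <= fnorm A + fnorm B.
Proof. by rewrite (le_trans (fnormD _ _))// fnormN. Qed.

Lemma fnorm_sum (I : Type) (r : seq I) (S : pred I) p q (A : I -> 'M[R]_(p, q)) :
  fnorm (\sum_(i <- r | S i) A i) <= \sum_(i <- r | S i) fnorm (A i).
Proof.
elim/big_ind2 : _ => //; first by rewrite fnorm0.
by move=> X x Y y Xx Yy; rewrite (le_trans (fnormD _ _))// lerD.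
Qed.

Lemma fnormM p q r (A : 'M[R]_(p, q)) (B : 'M[R]_(q, r)) :
  fnorm (A *m B) <= fnorm A * fnorm B.
Proof.
rewrite -ler_sqr ?nnegrE ?mulr_ge0 ?fnorm_ge0// exprMn -(fnorm_tr B) !fnorm_sqr.
rewrite mulr_suml; apply: ler_sum => i _; rewrite mulr_sumr; apply: ler_sum => j _.
rewrite mxE (le_trans (sum_cauchy_schwarz _ _))// ler_wpM2l//.
  by apply: sumr_ge0 => ? _; exact: sqr_ge0.
by apply: ler_sum => l _; rewrite mxE.
Qed.

Lemma coord_le_fnorm p q (A : 'M[R]_(p, q)) i j : `|A i j| <= fnorm A.
Proof.
rewrite -ler_sqr ?nnegrE ?fnorm_ge0// real_normK ?num_real// fnorm_sqr_pair.
rewrite (bigD1 (i, j))//= lerDl; apply: sumr_ge0 => ? _; exact: sqr_ge0.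
Qed.

Lemma fnorm_delta p q (i : 'I_p) (j : 'I_q) : fnorm (delta_mx i j : 'M[R]_(p, q)) = 1.
Proof.
rewrite -[RHS](@sqrtr1 R) /fnorm; congr Num.sqrt.
rewrite pair_big (bigD1 (i, j))//= mxE !eqxx expr1n big1 ?addr0// => -[i' j'] /=.
by rewrite mxE xpair_eqE => /negPf->; rewrite expr0n.
Qed.

Lemma fnorm_le_sum p q (A : 'M[R]_(p, q)) : fnorm A <= \sum_i \sum_j `|A i j|.
Proof.
rewrite {1}[A]matrix_sum_delta (le_trans (fnorm_sum _ _ _))// ler_sum// => i _.
rewrite (le_trans (fnorm_sum _ _ _))// ler_sum// => j _.
by rewrite fnormZ fnorm_delta mulr1.
Qed.

Lemma fnorm_le_coord p q (A : 'M[R]_(p, q)) (c : R) :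
  (forall i j, `|A i j| <= c) -> fnorm A <= (p * q)%:R * c.
Proof.
move=> Ac; rewrite (le_trans (fnorm_le_sum A))//.
have -> : (p * q)%:R * c = \sum_(i < p) \sum_(j < q) c.
  by rewrite !sumr_const !card_ord -mulrnA -[RHS]mulr_natl mulnC.
by apply: ler_sum => i _; apply: ler_sum.
Qed.

(** Each entry is a coordinate of the image of a unit vector. The dimensional factor is crude but
    harmless, since the final constant may depend on the dimensions; from here on everything is
    measured in the Frobenius norm. *)
Lemma fnorm_le_specnorm p q (A : 'M[R]_(p, q)) :
  fnorm A <= (p * q)%:R * specnorm A.
Proof.
apply: fnorm_le_coord => i j.
have -> : A i j = (A *m (delta_mx j 0 : 'cV_q)) i 0.
  by rewrite -colE mxE.
rewrite (le_trans (coord_le_fnorm _ _ _))// -enormE.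
apply: ub_le_sup; last first.
  by exists (delta_mx j 0) => //=; rewrite enormE fnorm_delta.
exists (fnorm A) => _ [v /= v1 <-]; rewrite enormE (le_trans (fnormM _ _))//.
by rewrite ler_piMr ?fnorm_ge0// -enormE.
Qed.

Lemma inv_norm_fnorm n (C : 'M[R]_n) r : inv_norm_le C r ->
  fnorm (invmx C) <= (n * n)%:R * r.
Proof.
by case=> _ Cr; rewrite (le_trans (fnorm_le_specnorm _))// ler_wpM2l.
Qed.

Lemma mxtrace_fnorm p q (A : 'M[R]_(p, q)) : \tr (A^T *m A) = fnorm A ^+ 2.
Proof.
rewrite -(fnorm_tr A) fnorm_sqr; apply: eq_bigr => i _; rewrite mxE.
by apply: eq_bigr => j _; rewrite !mxE expr2.
Qed.

Lemma fnorm_orthonormal p q (U : 'M[R]_(p, q)) : U *m U^T = 1%:M ->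
  fnorm U ^+ 2 = p%:R.
Proof.
by move=> UU; rewrite -fnorm_tr -mxtrace_fnorm trmxK UU mxtrace_scalar.
Qed.

(** The exact value is [sqrt p]; the weaker bound [p] keeps square roots of dimensions out of the
    constants. *)
Lemma fnorm_orthonormal_le p q (U : 'M[R]_(p, q)) : U *m U^T = 1%:M ->
  fnorm U <= p%:R.
Proof.
move=> UU; rewrite -ler_sqr ?nnegrE ?fnorm_ge0// fnorm_orthonormal//.
by case: p U UU => [|p] *; rewrite ?expr0n// expr2 ler_peMl// ler1n.
Qed.

Lemma fnorm_isometry p q (U : 'M[R]_(p, q)) (y : 'cV[R]_p) : U *m U^T = 1%:M ->
  fnorm (U^T *m y) = fnorm y.
Proof.
move=> UU; apply/eqP; rewrite -(@eqrXn2 _ 2) ?fnorm_ge0//; apply/eqP.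
by rewrite -!mxtrace_fnorm trmx_mul trmxK mulmxA -(mulmxA y^T) UU mulmx1.
Qed.

End FrobeniusNorm.

(** * Perturbation of the Cholesky factor of [1 + G G^T] *)

Section CholeskyPerturbation.
Variables (R : realType) (k q : nat) (S : 'M[R]_k) (G : 'M[R]_(k, q)).
Hypothesis S_upper : forall i j : 'I_k, (j < i)%N -> S i j = 0.
Hypothesis S_pos : forall i, 0 < S i i.
Hypothesis S_gram : S^T *m S = 1%:M + G *m G^T.

Lemma cholesky_unit : S \in unitmx.
Proof.
rewrite -unitmx_tr unitmxE det_trig.
  by rewrite unitfE prodf_seq_neq0; apply/allP => i _ /=; rewrite mxE gt_eqF.
by apply/is_trig_mxP => i j ij; rewrite mxE S_upper.
Qed.

Local Notation V := (invmx S).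

(** Strong induction on the column: in the entry [(i, j)] of [V S = 1], the terms left of [j] vanish
    by induction and those right of [j] because [S] is upper triangular, which leaves
    [V i j * S j j = 0]. *)
Lemma cholesky_inv_upper (i j : 'I_k) : (j < i)%N -> V i j = 0.
Proof.
move=> ji; have [n] := ubnP (j : nat); elim: n => // n IH in j ji *.
rewrite ltnS => jn.
have : (V *m S) i j = 0.
  by rewrite mulVmx ?cholesky_unit// mxE; case: eqP ji => // ->; rewrite ltnn.
rewrite mxE (bigD1 j)//= big1 ?addr0 => [/eqP|l lj].
  by rewrite mulf_eq0 (gt_eqF (S_pos j)) orbF => /eqP.
have [lltj|jl|/val_inj/eqP] := ltngtP l j; last by rewrite (negPf lj).
  by rewrite (IH l) ?mul0r//; [exact: ltn_trans lltj ji | exact: leq_trans lltj jn].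
by rewrite S_upper ?mulr0.
Qed.

Lemma cholesky_inv_diag i : V i i = (S i i)^-1.
Proof.
have : (V *m S) i i = 1 by rewrite mulVmx ?cholesky_unit// mxE eqxx.
rewrite mxE (bigD1 i)//= big1 ?addr0 => [VS|l li].
  by rewrite -[LHS](@mulfK _ (S i i)) ?VS ?mul1r// gt_eqF.
have [lti|il|/val_inj/eqP] := ltngtP l i; last by rewrite (negPf li).
  by rewrite cholesky_inv_upper ?mul0r.
by rewrite S_upper ?mulr0.
Qed.

(** Conjugating the Gram identity by [V] and taking traces gives [|V|^2 + |G^T V|^2 = k], hence a
    bound that does not depend on [G]. *)
Lemma cholesky_inv_norm : fnorm V <= k%:R.
Proof.
have /(congr1 mxtrace) : V^T *m (S^T *m S) *m V = 1%:M.
  rewrite mulmxA -trmx_mul mulmxV ?cholesky_unit// trmx1 mul1mx.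
  by rewrite mulmxV ?cholesky_unit.
rewrite S_gram mulmxDr mulmx1 mulmxDl mxtraceD mxtrace_scalar => VV.
have : fnorm V ^+ 2 <= k%:R.
  rewrite -mxtrace_fnorm -VV lerDl.
  have -> : V^T *m (G *m G^T) *m V = (G^T *m V)^T *m (G^T *m V).
    by rewrite trmx_mul trmxK !mulmxA.
  by rewrite mxtrace_fnorm sqr_ge0.
move=> /le_trans H; rewrite -ler_sqr ?nnegrE ?fnorm_ge0//; apply: H.
by case: (k) => [|p]; rewrite ?expr0n// expr2 ler_peMl// ler1n.
Qed.

(* [S - S^-T = S^-T G G^T]; the triangular shapes of [S] and [S^-T] make each
   entry of [S - 1] dominated by the corresponding entry of [S - S^-T]. *)
Lemma cholesky_perturbation : fnorm (S - 1%:M) <= k%:R * fnorm G ^+ 2.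
Proof.
have E : S - V^T = V^T *m (G *m G^T).
  have -> : G *m G^T = S^T *m S - 1%:M by rewrite S_gram addrC addKr.
  rewrite mulmxBr mulmx1 mulmxA -trmx_mul mulmxV ?cholesky_unit//.
  by rewrite trmx1 mul1mx.
have : fnorm (S - V^T) <= k%:R * fnorm G ^+ 2.
  rewrite E (le_trans (fnormM _ _))// ler_pM ?fnorm_ge0//.
    by rewrite fnorm_tr cholesky_inv_norm.
  by rewrite (le_trans (fnormM _ _))// fnorm_tr expr2.
apply: le_trans; rewrite -le_fnorm !fnorm_sqr.
apply: ler_sum => i _; apply: ler_sum => j _; rewrite !mxE.
have [ij|ji|/val_inj ->] := ltngtP i j.
- rewrite cholesky_inv_upper//; case: eqP ij => [->|_ _]; first by rewrite ltnn.
  by rewrite mulr0n.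
- by rewrite S_upper//; case: eqP ji => [->|_ _]; rewrite ?ltnn// subr0 expr0n sqr_ge0.
- rewrite eqxx cholesky_inv_diag mulr1n; have := S_pos j.
  set x := S j j => x0.
  have -> : x - x^-1 = (x - 1) * ((x + 1) / x) by field; rewrite gt_eqF.
  rewrite exprMn ler_peMr ?sqr_ge0// expr_ge1//.
    by rewrite ler_pdivlMr// mul1r lerDl.
  by rewrite divr_ge0 ?addr_ge0// ltW.
Qed.

(** Only the Gram matrix of [S] matters for [|S y|]: it is exactly [|y|^2 + |G^T y|^2]. With [G] of
    order [dt] the growth is thus of second order in the step. *)
Lemma cholesky_apply (y : 'cV[R]_k) :
  fnorm (S *m y) ^+ 2 <= (1 + fnorm G ^+ 2) * fnorm y ^+ 2.
Proof.
have -> : fnorm (S *m y) ^+ 2 = fnorm y ^+ 2 + fnorm (G^T *m y) ^+ 2.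
  rewrite -!mxtrace_fnorm !trmx_mul trmxK !mulmxA -(mulmxA y^T) S_gram mulmxDr.
  by rewrite mulmx1 mulmxDl mxtraceD !mulmxA.
rewrite mulrDl mul1r lerD2l -exprMn ler_pXn2r ?nnegrE ?mulr_ge0 ?fnorm_ge0//.
by rewrite (le_trans (fnormM _ _))// fnorm_tr.
Qed.

End CholeskyPerturbation.

(** * Measurability and second moments *)

Section MeasurabilityWrtSigmaAlgebra.
Variables (R : realType) (dO : measure_display) (Omega : measurableType dO).
Implicit Types (G : set (set Omega)) (f g : Omega -> R).

(** Measurability relative to a bare family of sets, because the filtration is given as such
    families and not as measurable types; [rmeasP] translates it into measurability for the
    generated sigma-algebra. *)
Definition rmeas G f := forall B : set R, measurable B -> G (f @^-1` B).

Lemma rmeasP G f : sigma_algebra setT G ->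
  rmeas G f <-> measurable_fun [set: g_sigma_algebraType G] f.
Proof.
move=> sG; have mE := measurable_g_measurableTypeE sG; split=> [mf _ B mB|mf B mB].
  by rewrite setTI mE; exact: mf.
by rewrite -mE; have := mf measurableT B mB; rewrite setTI.
Qed.

Lemma rmeas_measurable f : rmeas measurable f <-> measurable_fun [set: Omega] f.
Proof.
split=> [mf _ B mB|mf B mB]; first by rewrite setTI; exact: mf.
by have := mf measurableT B mB; rewrite setTI.
Qed.

Lemma rmeas_sub G G' f : G `<=` G' -> rmeas G f -> rmeas G' f.
Proof. by move=> GG' mf B mB; exact/GG'/mf. Qed.

Lemma rmeas_ext G f g : f =1 g -> rmeas G f -> rmeas G g.
Proof. by move=> /funext ->. Qed.

Section Closure.
Variable G : set (set Omega).
Hypothesis sG : sigma_algebra setT G.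

Lemma rmeas_cst (c : R) : rmeas G (fun=> c).
Proof. by apply/(rmeasP _ sG); exact: measurable_cst. Qed.

Lemma rmeasD f g : rmeas G f -> rmeas G g -> rmeas G (fun w => f w + g w).
Proof.
by move=> /(rmeasP _ sG) mf /(rmeasP _ sG) mg; apply/(rmeasP _ sG); exact: measurable_funD.
Qed.

Lemma rmeasN f : rmeas G f -> rmeas G (fun w => - f w).
Proof. by move=> /(rmeasP _ sG) mf; apply/(rmeasP _ sG); exact: measurable_funN. Qed.

Lemma rmeasM f g : rmeas G f -> rmeas G g -> rmeas G (fun w => f w * g w).
Proof.
by move=> /(rmeasP _ sG) mf /(rmeasP _ sG) mg; apply/(rmeasP _ sG); exact: measurable_funM.
Qed.

Lemma rmeasX f n : rmeas G f -> rmeas G (fun w => f w ^+ n).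
Proof. by move=> /(rmeasP _ sG) mf; apply/(rmeasP _ sG); exact: measurable_funX. Qed.

Lemma rmeas_max f g : rmeas G f -> rmeas G g -> rmeas G (fun w => Num.max (f w) (g w)).
Proof.
by move=> /(rmeasP _ sG) mf /(rmeasP _ sG) mg; apply/(rmeasP _ sG); exact: measurable_maxr.
Qed.

Lemma rmeas_norm f : rmeas G f -> rmeas G (fun w => `|f w|).
Proof.
by move=> /(rmeasP _ sG) mf; apply/(rmeasP _ sG); exact: measurableT_comp.
Qed.

Lemma rmeas_sqrt f : rmeas G f -> rmeas G (fun w => Num.sqrt (f w)).
Proof.
move=> /(rmeasP _ sG) mf; apply/(rmeasP _ sG).
apply: (@measurableT_comp _ _ _ _ _ _ (@Num.sqrt R)) => //.
by apply: continuous_measurable_fun; exact: sqrt_continuous.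
Qed.

Lemma rmeas_sum (I : Type) (r : seq I) (f : I -> Omega -> R) :
  (forall i, rmeas G (f i)) -> rmeas G (fun w => \sum_(i <- r) f i w).
Proof.
move=> mf; elim: r => [|i r IH].
  by apply: rmeas_ext (rmeas_cst 0) => w; rewrite big_nil.
by apply: rmeas_ext (rmeasD (mf i) IH) => w; rewrite big_cons.
Qed.

Lemma rmeas_lt (f : Omega -> R) : (forall c, G [set w | f w < c]) -> rmeas G f.
Proof.
move=> fc; apply/(rmeasP _ sG); apply: (measurability _ (RGenInftyO.measurableE R)) => _ [_ [y ->] <-].
rewrite setTI (measurable_g_measurableTypeE sG).
rewrite (_ : _ @^-1` _ = [set w | f w < y]); first exact: fc.
by apply/seteqP; split => w /=; rewrite in_itv.
Qed.

Lemma rv_ext p q (X Y : Omega -> 'M[R]_(p, q)) : X =1 Y -> rv_measurable G X ->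
  rv_measurable G Y.
Proof. by move=> /funext ->. Qed.

Lemma rv_cst p q (A : 'M[R]_(p, q)) : rv_measurable G (fun=> A).
Proof. by move=> i j; exact: rmeas_cst. Qed.

Lemma rvD p q (X Y : Omega -> 'M[R]_(p, q)) :
  rv_measurable G X -> rv_measurable G Y -> rv_measurable G (fun w => X w + Y w).
Proof.
move=> mX mY i j; apply: rmeas_ext (rmeasD (mX i j) (mY i j)) => w.
by rewrite mxE.
Qed.

Lemma rvN p q (X : Omega -> 'M[R]_(p, q)) :
  rv_measurable G X -> rv_measurable G (fun w => - X w).
Proof.
by move=> mX i j; apply: rmeas_ext (rmeasN (mX i j)) => w; rewrite mxE.
Qed.

Lemma rvB p q (X Y : Omega -> 'M[R]_(p, q)) :
  rv_measurable G X -> rv_measurable G Y -> rv_measurable G (fun w => X w - Y w).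
Proof. by move=> mX mY; apply: rvD => //; exact: rvN. Qed.

Lemma rvM p q r (X : Omega -> 'M[R]_(p, q)) (Y : Omega -> 'M[R]_(q, r)) :
  rv_measurable G X -> rv_measurable G Y -> rv_measurable G (fun w => X w *m Y w).
Proof.
move=> mX mY i j.
apply: rmeas_ext (rmeas_sum (index_enum _) (fun l => rmeasM (mX i l) (mY l j))) => w.
by rewrite mxE.
Qed.

Lemma rvZ p q (c : Omega -> R) (X : Omega -> 'M[R]_(p, q)) :
  rmeas G c -> rv_measurable G X -> rv_measurable G (fun w => c w *: X w).
Proof.
by move=> mc mX i j; apply: rmeas_ext (rmeasM mc (mX i j)) => w; rewrite mxE.
Qed.

Lemma rv_sum (I : Type) (r : seq I) p q (X : I -> Omega -> 'M[R]_(p, q)) :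
  (forall i, rv_measurable G (X i)) -> rv_measurable G (fun w => \sum_(i <- r) X i w).
Proof.
move=> mX i j.
by apply: rmeas_ext (rmeas_sum r (fun l => mX l i j)) => w; rewrite summxE.
Qed.

Lemma rmeas_fnorm p q (X : Omega -> 'M[R]_(p, q)) :
  rv_measurable G X -> rmeas G (fun w => fnorm (X w)).
Proof.
move=> mX; apply: rmeas_sqrt; apply: rmeas_sum => i; apply: rmeas_sum => j.
exact/rmeasX/mX.
Qed.

Lemma rat_vector_dense n (x : 'cV[R]_n) (e : R) : 0 < e ->
  exists q : 'cV[rat]_n, fnorm (x - map_mx ratr q) < e.
Proof.
move=> e0; pose c := e / (n * 1).+1%:R.
have c0 : 0 < c by rewrite divr_gt0.
have H i : exists q : rat, `|x i 0 - ratr q| <= c.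
  have /rat_in_itvoo[q] : x i 0 - c < x i 0 + c by lra.
  rewrite in_itv /= => /andP[q1 q2]; exists q; rewrite ler_norml; lra.
exists (\col_i sval (cid (H i))).
apply: (@le_lt_trans _ _ ((n * 1)%:R * c)).
  apply: fnorm_le_coord => i j; rewrite !mxE (ord1 j).
  exact: (svalP (cid (H i))).
rewrite /c mulrCA gtr_pMr// ltr_pdivrMr// mul1r ltr_nat//.
Qed.

(* McShane: [f x = inf_q (f q + L |x - q|)] over rational [q]. *)
Lemma rmeas_lipschitz n (f : 'cV[R]_n -> R) L (X : Omega -> 'cV[R]_n) :
  (forall x y, `|f x - f y| <= L * fnorm (x - y)) ->
  rv_measurable G X -> rmeas G (fun w => f (X w)).
Proof.
move=> fL mX; apply: rmeas_lt => c.
pose r (q : 'cV[rat]_n) : 'cV[R]_n := map_mx ratr q.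
have -> : [set w | f (X w) < c] =
    \bigcup_(q in [set: 'cV[rat]_n]) [set w | f (r q) + L * fnorm (X w - r q) < c].
  apply/seteqP; split=> [w /= fc|w [q _ /=]]; last first.
    apply: le_lt_trans; rewrite -lerBlDl.
    by rewrite (le_trans _ (fL _ _))// ler_norm.
  (* The Lipschitz bound is spent twice, on [f q - f (X w)] and on the penalty [L |X w - q|]; the
     summand 1 keeps the denominator positive. *)
  have d0 : 0 < (c - f (X w)) / (2 * `|L| + 1).
    by rewrite divr_gt0 ?subr_gt0// ltr_wpDl.
  have [q Xq] := rat_vector_dense (X w) d0; exists q => //=.
  have := fL (r q) (X w); rewrite fnormBC; set N := fnorm _ in Xq * => fN.
  have N0 : 0 <= N by exact: fnorm_ge0.
  have LN : L * N <= `|L| * N by rewrite ler_wpM2r// ler_norm.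
  have B0 : 0 < 2 * `|L| + 1 by rewrite ltr_wpDl// mulr_ge0.
  move: Xq; rewrite ltr_pdivlMr// => Xq.
  have fN' := le_trans (ler_norm _) fN.
  have : f (r q) - f (X w) <= `|L| * N by apply: le_trans fN' _.
  nra.
have mq q : G [set w | f (r q) + L * fnorm (X w - r q) < c].
  have /(_ `]-oo, c[%classic) : rmeas G (fun w => f (r q) + L * fnorm (X w - r q)).
    apply: rmeasD; first exact: rmeas_cst.
    apply: rmeasM; first exact: rmeas_cst.
    by apply: rmeas_fnorm; apply: rvB => //; exact: rv_cst.
  rewrite (_ : _ @^-1` _ = [set w | f (r q) + L * fnorm (X w - r q) < c]).
    by apply; exact: measurable_itv.
  by apply/seteqP; split => w /=; rewrite in_itv.
rewrite -(measurable_g_measurableTypeE sG).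
apply: countable_bigcupT_measurable; first exact: countableP.
by move=> q; rewrite (measurable_g_measurableTypeE sG).
Qed.

End Closure.
End MeasurabilityWrtSigmaAlgebra.

(** * Calculus of second-moment bounds *)

Section L2Bounds.
Variables (R : realType) (dO : measure_display) (Omega : measurableType dO).
Variable P : probability Omega R.
Implicit Types (f g : Omega -> R) (r s : R).

Local Notation mO := (@measurable dO Omega).

(** [r] is an upper bound and not the norm itself, so that estimates compose without square roots of
    integrals. The integral lives in the extended reals, hence the bound also asserts integrability
    of the square. *)
Definition l2 f r :=
  [/\ rmeas mO f, 0 <= r & (\int[P]_w (f w ^+ 2)%:E <= (r ^+ 2)%:E)%E].

Definition L2 p q (X : Omega -> 'M[R]_(p, q)) r :=
  rv_measurable mO X /\ l2 (fun w => fnorm (X w)) r.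

(** The real-valued integral, whose value is the default 0 when the extended integral is infinite;
    this is why the rules below carry [integ] hypotheses. *)
Definition Ex f := \int[P]_w f w.

Definition integ f := P.-integrable setT (EFin \o f).

Lemma l2_ge0 f r : l2 f r -> 0 <= r. Proof. by case. Qed.
Lemma l2_meas f r : l2 f r -> rmeas mO f. Proof. by case. Qed.
Lemma L2_ge0 p q (X : Omega -> 'M[R]_(p, q)) r : L2 X r -> 0 <= r.
Proof. by case=> _ []. Qed.

Lemma le_integ f g : rmeas mO f -> (forall w, `|f w| <= g w) -> integ g -> integ f.
Proof.
move=> /rmeas_measurable mf fg; apply: le_integrable => //.
  exact/measurable_EFinP.
move=> w _ /=; rewrite lee_fin; exact: le_trans (fg w) (ler_norm _).
Qed.

Lemma integD f g : integ f -> integ g -> integ (fun w => f w + g w).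
Proof. by move=> If Ig; exact: integrableD If Ig. Qed.

Lemma integZ (c : R) f : integ f -> integ (fun w => c * f w).
Proof. by move=> If; exact: integrableZl If. Qed.

Lemma integN f : integ f -> integ (fun w => - f w).
Proof. by move=> If; exact: integrableN If. Qed.

Lemma integB f g : integ f -> integ g -> integ (fun w => f w - g w).
Proof. by move=> If Ig; apply: integD => //; exact: integN. Qed.

Lemma integ_sum (I : Type) (t : seq I) (f : I -> Omega -> R) :
  (forall i, integ (f i)) -> integ (fun w => \sum_(i <- t) f i w).
Proof.
move=> If; elim: t => [|i t IH].
  by under [X in integ X]eq_fun do rewrite big_nil; exact: integrable0.
by under [X in integ X]eq_fun do rewrite big_cons; exact: integD.
Qed.

Lemma ExD f g : integ f -> integ g -> Ex (fun w => f w + g w) = Ex f + Ex g.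
Proof. by move=> If Ig; exact: RintegralD. Qed.

Lemma ExZ (c : R) f : integ f -> Ex (fun w => c * f w) = c * Ex f.
Proof. by move=> If; exact: RintegralZl. Qed.

Lemma ExN f : integ f -> Ex (fun w => - f w) = - Ex f.
Proof.
move=> If; rewrite -[RHS]mulN1r -ExZ//.
by congr Ex; apply/funext => w; rewrite mulN1r.
Qed.

Lemma ExB f g : integ f -> integ g -> Ex (fun w => f w - g w) = Ex f - Ex g.
Proof. by move=> If Ig; exact: RintegralB. Qed.

Lemma Ex_sum (I : Type) (t : seq I) (f : I -> Omega -> R) :
  (forall i, integ (f i)) -> Ex (fun w => \sum_(i <- t) f i w) = \sum_(i <- t) Ex (f i).
Proof.
move=> If; elim: t => [|i t IH].
  rewrite big_nil /Ex; under eq_Rintegral do rewrite big_nil.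
  by rewrite Rintegral_cst// mul0r.
rewrite big_cons -IH -ExD//; last exact: integ_sum.
by congr Ex; apply/funext => w; rewrite big_cons.
Qed.

Lemma le_Ex f g : integ f -> integ g -> (forall w, f w <= g w) -> Ex f <= Ex g.
Proof. by move=> If Ig fg; apply: le_Rintegral. Qed.

Lemma Ex_ge0 f : (forall w, 0 <= f w) -> 0 <= Ex f.
Proof. by move=> f0; apply: Rintegral_ge0. Qed.

Lemma EFin_Ex f : integ f -> (Ex f)%:E = (\int[P]_w (f w)%:E)%E.
Proof. by move=> If; rewrite /Ex /Rintegral fineK//; exact: integrable_fin_num. Qed.

Lemma l2P f r : l2 f r <->
  [/\ rmeas mO f, 0 <= r, integ (fun w => f w ^+ 2) & Ex (fun w => f w ^+ 2) <= r ^+ 2].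
Proof.
split=> [[mf r0 fr]|[mf r0 If fr]]; last first.
  by split=> //; rewrite -EFin_Ex// lee_fin.
have If : integ (fun w => f w ^+ 2).
  apply/integrableP; split.
    by apply/measurable_EFinP; apply/rmeas_measurable; exact: rmeasX.
  under eq_integral do rewrite /= ger0_norm ?sqr_ge0//.
  by rewrite (le_lt_trans fr)// ltry.
by split=> //; rewrite -lee_fin EFin_Ex.
Qed.

Lemma l2_integM f g r s : l2 f r -> l2 g s -> integ (fun w => f w * g w).
Proof.
move=> /l2P[mf _ If _] /l2P[mg _ Ig _].
apply: (le_integ (g := fun w => f w ^+ 2 + g w ^+ 2)); last exact: integD.
  exact: rmeasM.
by move=> w; rewrite ler_norml; nra.
Qed.

(** With [c = E[f g]], the quadratic [r^2 + 2 t c + t^2 s^2] bounds [E[(f + t g)^2]] and so is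
    nonnegative for every [t]; its value at [t = - c / s^2] gives the claim. For [s = 0] it is
    affine, and [t = - (r^2 + 1) / (2 c)] makes it negative unless [c = 0]. *)
Lemma l2_cauchy_schwarz f g r s : l2 f r -> l2 g s ->
  `|Ex (fun w => f w * g w)| <= r * s.
Proof.
move=> lf lg; have Ifg := l2_integM lf lg.
move: (lf) (lg) => /l2P[mf r0 If fr] /l2P[mg s0 Ig gs].
set c := Ex _.
have H t : 0 <= r ^+ 2 + 2 * t * c + t ^+ 2 * s ^+ 2.
  have : 0 <= Ex (fun w => f w ^+ 2 + (2 * t * (f w * g w) + t ^+ 2 * g w ^+ 2)).
    by apply: Ex_ge0 => w; have := sqr_ge0 (f w + t * g w); nra.
  rewrite ExD//; last by apply: integD; exact: integZ.
  rewrite ExD ?ExZ//; [|exact: integZ|exact: integZ].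
  by rewrite -/c; have := sqr_ge0 t; nra.
have [s00|s_neq0] := eqVneq s 0.
  have [->|c0] := eqVneq c 0; first by rewrite normr0 mulr_ge0.
  have := H (- (r ^+ 2 + 1) / (2 * c)).
  have -> : 2 * (- (r ^+ 2 + 1) / (2 * c)) * c = - (r ^+ 2 + 1) by field.
  rewrite s00 expr0n/= mulr0; lra.
rewrite -ler_sqr ?nnegrE ?mulr_ge0// real_normK ?num_real// exprMn.
have := H (- c / s ^+ 2).
have -> : r ^+ 2 + 2 * (- c / s ^+ 2) * c + (- c / s ^+ 2) ^+ 2 * s ^+ 2 =
  r ^+ 2 - c ^+ 2 / s ^+ 2 by field.
by rewrite subr_ge0 ler_pdivrMr// exprn_gt0// lt0r s_neq0.
Qed.

Lemma l2_le f r r' : r <= r' -> l2 f r -> l2 f r'.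
Proof.
move=> rr' [mf r0 fr]; split=> //; first exact: le_trans rr'.
by apply: le_trans fr _; rewrite lee_fin ler_pXn2r// nnegrE// (le_trans r0).
Qed.

Lemma l2_dom f g r : rmeas mO g -> {ae P, forall w, `|g w| <= `|f w|} ->
  l2 f r -> l2 g r.
Proof.
move=> mg gf [mf r0 fr]; split=> //; apply: le_trans fr.
have m2 h : rmeas mO h -> measurable_fun setT (fun w => (h w ^+ 2)%:E).
  by move=> mh; apply/measurable_EFinP/rmeas_measurable; exact: rmeasX.
apply: ae_ge0_le_integral => //; try exact: m2; try by move=> w _; rewrite lee_fin sqr_ge0.
apply: filterS gf => w gfw _; rewrite lee_fin.
by rewrite -[X in X <= _]real_normK ?num_real// -[leRHS]real_normK ?num_real// ler_pXn2r// nnegrE.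
Qed.

Lemma l2_ext f g r : f =1 g -> l2 f r -> l2 g r.
Proof. by move=> /funext ->. Qed.

Lemma l2D f g r s : l2 f r -> l2 g s -> l2 (fun w => f w + g w) (r + s).
Proof.
move=> lf lg; have Ifg := l2_integM lf lg.
have := l2_cauchy_schwarz lf lg => /(le_trans (ler_norm _)) CS.
move: (lf) (lg) => /l2P[mf r0 If fr] /l2P[mg s0 Ig gs].
have E w : (f w + g w) ^+ 2 = f w ^+ 2 + (2 * (f w * g w) + g w ^+ 2) by ring.
have I2 : integ (fun w => 2 * (f w * g w) + g w ^+ 2).
  by apply: integD => //; exact: integZ.
apply/l2P; split; rewrite ?addr_ge0//; first exact: rmeasD.
  by under [X in integ X]eq_fun do rewrite E; exact: integD.
under [X in Ex X]eq_fun do rewrite E.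
rewrite !ExD ?ExZ//; first by nra.
exact: integZ.
Qed.

Lemma l2Z (c : R) f r : l2 f r -> l2 (fun w => c * f w) (`|c| * r).
Proof.
move=> /l2P[mf r0 If fr]; apply/l2P; split; rewrite ?mulr_ge0//.
- by apply: rmeasM => //; exact: rmeas_cst.
- by under [X in integ X]eq_fun do rewrite exprMn; exact: integZ.
- under [X in Ex X]eq_fun do rewrite exprMn.
  by rewrite ExZ// exprMn real_normK ?num_real// ler_wpM2l// sqr_ge0.
Qed.

Lemma l2N f r : l2 f r -> l2 (fun w => - f w) r.
Proof.
move=> lf; apply: l2_dom (lf); first by apply: rmeasN => //; case: lf.
by apply: aeW => w; rewrite normrN.
Qed.

Lemma integ_cst (c : R) : integ (fun=> c).
Proof. by apply: finite_measure_integrable_cst. Qed.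

Lemma Ex_cst (c : R) : Ex (fun=> c) = c.
Proof. by rewrite /Ex Rintegral_cst//= probability_setT/= mulr1. Qed.

Lemma l2_cst (c : R) : l2 (fun=> c) `|c|.
Proof.
apply/l2P; split => //; first exact: rmeas_cst.
  exact: integ_cst.
by rewrite Ex_cst real_normK ?num_real.
Qed.

Lemma l2_integ f r : l2 f r -> integ f.
Proof.
move=> lf; have := l2_integM lf (l2_cst 1).
by under [X in integ X -> _]eq_fun do rewrite mulr1.
Qed.

Lemma l2_norm f r : l2 f r -> l2 (fun w => `|f w|) r.
Proof.
move=> lf; apply: l2_dom (lf); first by apply: rmeas_norm => //; case: lf.
by apply: aeW => w; rewrite normr_id.
Qed.

Lemma l2_sum (I : Type) (t : seq I) (f : I -> Omega -> R) (r : I -> R) :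
  (forall i, l2 (f i) (r i)) -> l2 (fun w => \sum_(i <- t) f i w) (\sum_(i <- t) r i).
Proof.
move=> lf; elim: t => [|i t IH].
  rewrite big_nil; apply: l2_ext (l2_le _ (l2_cst 0)); last by rewrite normr0.
  by move=> w; rewrite big_nil.
rewrite big_cons; apply: l2_ext (l2D (lf i) IH) => w.
by rewrite big_cons.
Qed.

Section Matrices.
Variables p q : nat.
Implicit Types X Y : Omega -> 'M[R]_(p, q).

Lemma L2_le X r r' : r <= r' -> L2 X r -> L2 X r'.
Proof. by move=> rr' [mX lX]; split=> //; exact: l2_le lX. Qed.

Lemma L2_ext X Y r : X =1 Y -> L2 X r -> L2 Y r.
Proof. by move=> /funext ->. Qed.

Lemma L2_dom X f r : rv_measurable mO X -> {ae P, forall w, fnorm (X w) <= `|f w|} ->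
  l2 f r -> L2 X r.
Proof.
move=> mX Xf lf; split=> //; apply: l2_dom lf; first exact: rmeas_fnorm.
by apply: filterS Xf => w; rewrite (ger0_norm (fnorm_ge0 _)).
Qed.

Lemma L2_dom_mx p' q' X (Y : Omega -> 'M[R]_(p', q')) r : rv_measurable mO X ->
  {ae P, forall w, fnorm (X w) <= fnorm (Y w)} -> L2 Y r -> L2 X r.
Proof.
move=> mX XY [mY lY]; apply: L2_dom lY => //.
by apply: filterS XY => w; rewrite (ger0_norm (fnorm_ge0 _)).
Qed.

Lemma L2_affine p' q' X (Y : Omega -> 'M[R]_(p', q')) r (u v : R) :
  0 <= u -> 0 <= v ->
  rv_measurable mO X -> {ae P, forall w, fnorm (X w) <= u + v * fnorm (Y w)} ->
  L2 Y r -> L2 X (u + v * r).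
Proof.
move=> u0 v0 mX XY [mY lY].
have := l2D (l2_cst u) (l2Z v lY); rewrite !ger0_norm// => lu.
apply: L2_dom lu => //; apply: filterS XY => w XYw.
by rewrite ger0_norm ?addr_ge0 ?mulr_ge0 ?fnorm_ge0.
Qed.

Lemma L2D X Y r s : L2 X r -> L2 Y s -> L2 (fun w => X w + Y w) (r + s).
Proof.
move=> [mX lX] [mY lY]; apply: L2_dom (l2D lX lY); first exact: rvD.
by apply: aeW => w; rewrite ger0_norm ?addr_ge0 ?fnorm_ge0// fnormD.
Qed.

Lemma L2N X r : L2 X r -> L2 (fun w => - X w) r.
Proof.
move=> lX; apply: L2_dom_mx (lX); first by apply: rvN => //; case: lX.
by apply: aeW => w; rewrite fnormN.
Qed.

Lemma L2B X Y r s : L2 X r -> L2 Y s -> L2 (fun w => X w - Y w) (r + s).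
Proof. by move=> lX lY; apply: L2D => //; exact: L2N. Qed.

Lemma L2_cst (A : 'M[R]_(p, q)) : L2 (fun=> A) (fnorm A).
Proof.
apply: L2_dom (l2_le _ (l2_cst (fnorm A))); first exact: rv_cst.
  by apply: aeW => w; rewrite ger0_norm ?fnorm_ge0.
by rewrite ger0_norm ?fnorm_ge0.
Qed.

Lemma L2Z (c : R) X r : L2 X r -> L2 (fun w => c *: X w) (`|c| * r).
Proof.
move=> [mX lX]; apply: L2_dom (l2Z c lX).
  by apply: rvZ => //; exact: rmeas_cst.
by apply: aeW => w; rewrite fnormZ normrM (ger0_norm (fnorm_ge0 _)).
Qed.

Lemma L2_sum (I : Type) (t : seq I) (X : I -> Omega -> 'M[R]_(p, q)) (r : I -> R) :
  (forall i, L2 (X i) (r i)) -> L2 (fun w => \sum_(i <- t) X i w) (\sum_(i <- t) r i).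
Proof.
move=> lX; elim: t => [|i t IH].
  rewrite big_nil; apply: L2_ext (L2_le _ (L2_cst 0)); last by rewrite fnorm0.
  by move=> w; rewrite big_nil.
rewrite big_cons; apply: L2_ext (L2D (lX i) IH) => w.
by rewrite big_cons.
Qed.

Lemma L2_coord X r i j : L2 X r -> l2 (fun w => X w i j) r.
Proof.
move=> [mX lX]; apply: l2_dom lX; first exact: mX.
by apply: aeW => w; rewrite (ger0_norm (fnorm_ge0 _)) coord_le_fnorm.
Qed.

Lemma L2_of_coord X r : (forall i j, l2 (fun w => X w i j) r) ->
  L2 X ((p * q)%:R * r).
Proof.
move=> lX; have lS := l2_sum (index_enum _) (fun i =>
  l2_sum (index_enum _) (fun j => l2_norm (lX i j))).
have -> : (p * q)%:R * r = \sum_(i < p) \sum_(j < q) r.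
  by rewrite !sumr_const !card_ord -mulrnA -[RHS]mulr_natl mulnC.
apply: L2_dom lS; first by move=> i j; case: (lX i j).
apply: aeW => w; apply: le_trans (fnorm_le_sum _) (ler_norm _).
Qed.

End Matrices.

Lemma L2Ml p q n (A : 'M[R]_(p, q)) (X : Omega -> 'M[R]_(q, n)) c :
  L2 X c -> L2 (fun w => A *m X w) (fnorm A * c).
Proof.
move=> lX; rewrite -[_ * c]add0r.
apply: (L2_affine (r := c) (Y := X) _ (fnorm_ge0 A)) => //.
  by apply: rvM => //; [exact: rv_cst|case: lX].
by apply: aeW => w; rewrite add0r fnormM.
Qed.

Lemma Emx_coord p q (Z : Omega -> 'M[R]_(p, q)) i j :
  Emx P Z i j = Ex (fun w => Z w i j).
Proof. by rewrite mxE unlock. Qed.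

Lemma EmxD p q (X Y : Omega -> 'M[R]_(p, q)) :
  (forall i j, integ (fun w => X w i j)) -> (forall i j, integ (fun w => Y w i j)) ->
  Emx P (fun w => X w + Y w) = Emx P X + Emx P Y.
Proof.
move=> IX IY; apply/matrixP => i j; rewrite [RHS]mxE !Emx_coord -ExD//.
by congr Ex; apply/funext => w; rewrite mxE.
Qed.

Lemma L2_integ_outer p q (X : Omega -> 'cV[R]_p) (Y : Omega -> 'cV[R]_q) r s i j :
  L2 X r -> L2 Y s -> integ (fun w => (X w *m (Y w)^T) i j).
Proof.
move=> lX lY; under [X in integ X]eq_fun do rewrite mxE big_ord1 mxE.
exact: l2_integM (L2_coord _ _ lX) (L2_coord _ _ lY).
Qed.

Lemma fnorm_Emx p q (X : Omega -> 'cV[R]_p) (Y : Omega -> 'cV[R]_q) r s :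
  L2 X r -> L2 Y s ->
  fnorm (Emx P (fun w => X w *m (Y w)^T)) <= (p * q)%:R * (r * s).
Proof.
move=> lX lY; apply: fnorm_le_coord => i j; rewrite Emx_coord.
under [X in Ex X]eq_fun do rewrite mxE big_ord1 mxE.
exact: l2_cauchy_schwarz (L2_coord _ _ lX) (L2_coord _ _ lY).
Qed.

(** Bilinear splitting [X Y^T - X' Y'^T = (X - X') Y^T + X' (Y - Y')^T]. This is what makes the
    second moment and the drift moment Lipschitz in [Y] once moments are bounded. *)
Lemma fnorm_EmxB p q (X X' : Omega -> 'cV[R]_p) (Y Y' : Omega -> 'cV[R]_q) r s e e' :
  L2 X' r -> L2 Y s -> L2 (fun w => X w - X' w) e -> L2 (fun w => Y w - Y' w) e' ->
  fnorm (Emx P (fun w => X w *m (Y w)^T) - Emx P (fun w => X' w *m (Y' w)^T)) <=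
  (p * q)%:R * (e * s + r * e').
Proof.
move=> lX' lY lXX lYY.
have lY' : L2 Y' (s + e').
  by apply: L2_ext (L2B lY lYY) => w; rewrite subKr.
have -> : Emx P (fun w => X w *m (Y w)^T) = Emx P (fun w => (X w - X' w) *m (Y w)^T) +
   (Emx P (fun w => X' w *m (Y w - Y' w)^T) + Emx P (fun w => X' w *m (Y' w)^T)).
  rewrite -!EmxD; try by move=> i j; apply: L2_integ_outer; eassumption.
    congr Emx; apply/funext => w.
    by rewrite linearB /= mulmxBl mulmxBr !subrK.
  move=> i j; have -> : (fun w => (X' w *m (Y w - Y' w)^T + X' w *m (Y' w)^T) i j) =
     (fun w => (X' w *m (Y w)^T) i j).
    by apply/funext => w; rewrite linearB /= mulmxBr subrK.
  by apply: L2_integ_outer; eassumption.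
rewrite addrA addrK (le_trans (fnormD _ _))// mulrDr lerD//.
  exact: fnorm_Emx lXX lY.
exact: fnorm_Emx lX' lYY.
Qed.

Lemma square_integrableP k (Y : Omega -> 'cV[R]_k) : rv_measurable mO Y ->
  square_integrable P Y -> exists r, L2 Y r.
Proof.
rewrite /square_integrable unlock => mY Yoo.
have I0 : (0 <= \int[P]_w ((enorm (Y w) ^+ 2)%:E))%E.
  by apply: integral_ge0 => w _; rewrite lee_fin sqr_ge0.
exists (Num.sqrt (fine (\int[P]_w ((enorm (Y w) ^+ 2)%:E)))); split => //; split.
- exact: rmeas_fnorm.
- exact: sqrtr_ge0.
- rewrite sqr_sqrtr ?fine_ge0// fineK ?ge0_fin_numE//.
  by under eq_integral do rewrite -enormE.
Qed.

End L2Bounds.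

(** * Gaussian increments and orthogonality *)

Section CenteredNormal.
Variable R : realType.
Notation mu := (@lebesgue_measure R).

(** The Radon-Nikodym derivative of the normal law agrees with [normal_pdf] almost everywhere,
    because both have the same integral over every measurable set. *)
Lemma ge0_integral_normal_prob (s : R) (f : R -> \bar R) :
  measurable_fun setT f -> (forall x, 0 <= f x)%E ->
  (\int[normal_prob 0 s]_x f x = \int[mu]_x (f x * (normal_pdf 0 s x)%:E))%E.
Proof.
move=> mf f0; have dom := @normal_prob_dominates R 0 s.
rewrite -(Radon_Nikodym_SigmaFinite.change_of_variables dom)//.
set g := Radon_Nikodym_SigmaFinite.f _ _.
have g0 x : (0 <= g x)%E by exact: Radon_Nikodym_SigmaFinite.f_ge0.
have Ig : mu.-integrable setT g by exact: Radon_Nikodym_SigmaFinite.f_integrable.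
have mp : measurable_fun setT (fun x => (normal_pdf 0 s x)%:E).
  by apply/measurable_EFinP; exact: measurable_normal_pdf.
have gp : ae_eq mu setT g (fun x => (normal_pdf 0 s x)%:E).
  apply: integral_ae_eq => // E _ mE.
  by rewrite -(Radon_Nikodym_SigmaFinite.f_integral dom).
apply: ge0_ae_eq_integral => //.
- by apply: emeasurable_funM => //; exact: measurable_int Ig.
- exact: emeasurable_funM.
- by move=> x _; rewrite mule_ge0.
- by move=> x _; rewrite mule_ge0// lee_fin normal_pdf_ge0.
- exact: ae_eqe_mul2l.
Qed.

(* With [u = x^2 / (4 s^2)] this is [u * exp (- 2 u) <= exp (- u)]. *)
Lemma sqr_normal_pdf_le (s x : R) : 0 < s ->
  x ^+ 2 * normal_pdf 0 s x <= 9 * s ^+ 2 * normal_pdf 0 (Num.sqrt 2 * s) x.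
Proof.
move=> s0; have r2 : 0 < Num.sqrt 2 :> R by rewrite sqrtr_gt0.
have s2 : 0 < Num.sqrt 2 * s by rewrite mulr_gt0.
rewrite !normal_pdfE ?gt_eqF// /normal_peak /normal_fun subr0.
rewrite exprMn sqr_sqrtr//.
have pi0 : 0 < pi :> R by exact: pi_gt0.
have A0 : 0 < s ^+ 2 * pi *+ 2 by rewrite pmulrn_lgt0// mulr_gt0// exprn_gt0.
have -> : 2 * s ^+ 2 * pi *+ 2 = 2 * (s ^+ 2 * pi *+ 2) by rewrite -!mulrnAr !mulrA.
rewrite sqrtrM// invfM.
set A := Num.sqrt (s ^+ 2 * pi *+ 2).
have AA : 0 < A by rewrite sqrtr_gt0.
have s20 : 0 < s ^+ 2 by rewrite exprn_gt0.
have sn0 : s != 0 by rewrite gt_eqF.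
set u := x ^+ 2 / (2 * s ^+ 2 *+ 2).
have u0 : 0 <= u by rewrite divr_ge0 ?sqr_ge0// mulrn_wge0// mulr_ge0// ltW.
have -> : - x ^+ 2 / (2 * s ^+ 2 *+ 2) = - u by rewrite mulNr.
have -> : - x ^+ 2 / (s ^+ 2 *+ 2) = - u + - u.
  rewrite /u !mulr2n; field.
  by rewrite !gt_eqF// ?addr_gt0// mulr_gt0.
have -> : x ^+ 2 = 4 * s ^+ 2 * u.
  by rewrite /u !mulr2n; field; rewrite gt_eqF// ?addr_gt0// mulr_gt0.
rewrite expRD.
have ue : u * expR (- u) <= 1.
  rewrite expRN ler_pdivrMr ?expR_gt0// mul1r.
  by apply: le_trans (expR_ge1Dx u); rewrite lerDr.
have e0 := expR_gt0 (- u); set e := expR _ in ue e0 *.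
have r2le : Num.sqrt 2 * 4 <= 9 :> R.
  rewrite -ler_sqr ?nnegrE ?mulr_ge0 ?sqrtr_ge0// exprMn sqr_sqrtr//; lra.
have -> : 4 * s ^+ 2 * u * (A^-1 * (e * e)) = (4 * (u * e)) * (s ^+ 2 * A^-1 * e) by ring.
have -> : 9 * s ^+ 2 * ((Num.sqrt 2)^-1 / A * e) = (9 / Num.sqrt 2) * (s ^+ 2 * A^-1 * e) by ring.
apply: ler_wpM2r; first by rewrite !mulr_ge0 ?invr_ge0 ?ltW.
apply: (@le_trans _ _ 4); first by rewrite ler_piMr.
by rewrite ler_pdivlMr// mulrC.
Qed.

(** Not the sharp value [s^2]: the integrand is dominated by [9 s^2] times the density of a wider
    Gaussian, whose total mass is 1, so that the moment need not be computed. The 9 is a perfect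
    square above the [4 sqrt 2] that the comparison produces. *)
Lemma normal_prob_second_moment (s : R) : 0 < s ->
  (\int[normal_prob 0 s]_x (x ^+ 2)%:E <= ((3 * s) ^+ 2)%:E)%E.
Proof.
move=> s0; have r2 : 0 < Num.sqrt 2 :> R by rewrite sqrtr_gt0.
rewrite ge0_integral_normal_prob//; last 2 first.
  by apply/measurable_EFinP; exact: measurable_funX.
  by move=> x; rewrite lee_fin sqr_ge0.
apply: (@le_trans _ _ (\int[mu]_x ((9 * s ^+ 2)%:E * (normal_pdf 0 (Num.sqrt 2 * s) x)%:E))%E).
  have mp (v : R) : measurable_fun setT (fun x => (normal_pdf 0 v x)%:E).
    by apply/measurable_EFinP; exact: measurable_normal_pdf.
  apply: ge0_le_integral => //.
  - by move=> x _; rewrite -EFinM lee_fin mulr_ge0 ?sqr_ge0 ?normal_pdf_ge0.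
  - apply: emeasurable_funM => //.
      by apply/measurable_EFinP; apply: (measurable_funX (f := id)).
    exact: mp.
  - by apply: emeasurable_funM => //; exact: mp.
  - by move=> x _; rewrite -!EFinM lee_fin sqr_normal_pdf_le.
rewrite ge0_integralZl//; last 3 first.
  by apply/measurable_EFinP; exact: measurable_normal_pdf.
  by move=> x _; rewrite lee_fin normal_pdf_ge0.
  by rewrite lee_fin mulr_ge0// sqr_ge0.
by rewrite integral_normal_pdf mule1 lee_fin exprMn; lra.
Qed.

(** Centering in a form that involves only nonnegative integrals: the substitution [x -> - x]
    exchanges the two half-lines and the density is even. *)
Lemma normal_prob_pos_neg (s : R) : s != 0 ->
  (\int[normal_prob 0 s]_x (Num.max x 0)%:E =
   \int[normal_prob 0 s]_x (Num.max (- x) 0)%:E)%E.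
Proof.
move=> s0.
rewrite !ge0_integral_normal_prob//; last 4 first.
- by apply/measurable_EFinP; apply: measurable_maxr.
- by move=> x; rewrite lee_fin le_max lexx orbT.
- by apply/measurable_EFinP; apply: measurable_maxr.
- by move=> x; rewrite lee_fin le_max lexx orbT.
pose G x : R := Num.max (- x) 0 * normal_pdf 0 s x.
have Np x : normal_pdf 0 s (- x) = normal_pdf 0 s x.
  by rewrite !normal_pdfE// /normal_fun !subr0 sqrrN.
have G0 x : 0 <= G x by rewrite mulr_ge0 ?normal_pdf_ge0// le_max lexx orbT.
have cG : continuous G.
  move=> x; apply: cvgM; last exact: continuous_normal_pdf.
  apply: (@continuous_max _ _ (fun x : R => - x) (cst 0)).
    exact: opp_continuous.
  exact: cst_continuous.
have := @ge0_integration_by_substitutionNy R G 0.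
rewrite oppr0 => /(_ (continuous_subspaceT cG) (fun x _ => G0 x)) E.
transitivity (\int[mu]_(x in `[0%R, +oo[) ((G \o -%R) x)%:E)%E.
  rewrite [RHS]integral_mkcond; apply: eq_integral => x _.
  rewrite patchE mem_setE in_itv/= andbT /G/= opprK Np EFinM.
  case: ifPn => //; rewrite -ltNge => x0.
  by rewrite max_r ?mul0e// ltW.
rewrite -E [LHS]integral_mkcond; apply: eq_integral => x _.
rewrite patchE mem_setE in_itv/= /G EFinM.
case: ifPn => //; rewrite -ltNge => x0.
by rewrite max_r ?mul0e// oppr_le0 ltW.
Qed.

End CenteredNormal.

(** * Independence and expectations of products *)

Section Independence.
Variables (R : realType) (dO : measure_display) (Omega : measurableType dO).
Variable P : probability Omega R.
Implicit Types f g : Omega -> R.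

Definition indep f g := forall A B : set R, measurable A -> measurable B ->
  P (f @^-1` A `&` g @^-1` B) = (P (f @^-1` A) * P (g @^-1` B))%E.

Section TwoVariables.
Variables (f g : Omega -> R).
Hypotheses (mf : measurable_fun [set: Omega] f) (mg : measurable_fun [set: Omega] g).
Hypothesis fg : indep f g.

Let X : {mfun Omega >-> R} := HB.pack f (isMeasurableFun.Build _ _ _ _ _ mf).
Let Y : {mfun Omega >-> R} := HB.pack g (isMeasurableFun.Build _ _ _ _ _ mg).

Let mXY : measurable_fun [set: Omega] (fun w => (f w, g w)).
Proof. exact: measurable_fun_pair. Qed.

Let XY : {mfun Omega >-> (R * R)%type} :=
  HB.pack (fun w => (f w, g w)) (isMeasurableFun.Build _ _ _ _ _ mXY).

(** Independence is the agreement of the joint law with the product law on rectangles, and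
    rectangles determine a product measure. *)
Let law (A : set (R * R)) : measurable A ->
  (distribution P X \x distribution P Y)%E A = distribution P XY A.
Proof.
by move=> mA; apply: product_measure_unique.
Qed.

Lemma indep_ge0_integralM : (forall w, 0 <= f w) -> (forall w, 0 <= g w) ->
  (\int[P]_w (f w * g w)%:E = (\int[P]_w (f w)%:E) * (\int[P]_w (g w)%:E))%E.
Proof.
move=> f0 g0.
(* Absolute values make the integrand nonnegative on the whole plane, as Tonelli's theorem requires;
   they disappear because [f] and [g] are nonnegative. *)
pose h (z : R * R) := (`|z.1| * `|z.2|)%:E.
have mh : measurable_fun setT h.
  apply/measurable_EFinP; apply: measurable_funM.
    by apply: measurableT_comp => //; exact: measurable_fst.
  by apply: measurableT_comp => //; exact: measurable_snd.
have h0 z : (0 <= h z)%E by rewrite lee_fin mulr_ge0.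
transitivity (\int[distribution P XY]_z h z)%E.
  rewrite ge0_integral_distribution//; apply: eq_integral => w _ /=.
  by rewrite /h/= !ger0_norm.
rewrite -(eq_measure_integral _ (fun A mA _ => law mA)).
rewrite fubini_tonelli1// /fubini_F/=.
have mn : measurable_fun setT (fun y : R => (`|y|)%:E).
  by apply/measurable_EFinP; exact: normr_measurable.
under eq_integral => x _.
  under eq_integral do rewrite /h/= EFinM.
  rewrite ge0_integralZl//.
  over.
rewrite ge0_integralZr//; last by apply: integral_ge0.
rewrite !ge0_integral_distribution//; congr (_ * _)%E; apply: eq_integral => w _ /=;
  by rewrite ger0_norm.
Qed.

Lemma indep_ExM : integ P f -> integ P g -> integ P (fun w => f w * g w) ->
  Ex P (fun w => f w * g w) = Ex P f * Ex P g.
Proof.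
move=> If Ig Ifg.
pose h (z : R * R) := (z.1 * z.2)%:E.
have mh : measurable_fun setT h.
  apply/measurable_EFinP; apply: measurable_funM.
    exact: measurable_fst.
  exact: measurable_snd.
have mE : measurable_fun [set: R] (@EFin R) by exact/measurable_EFinP.
have Ih : (distribution P X \x distribution P Y)%E.-integrable setT h.
  apply/integrableP; split=> //.
  rewrite (eq_measure_integral _ (fun A mA _ => law mA)).
  have /integrableP[//] : (distribution P XY).-integrable setT h.
  exact: integrable_pushforward.
apply: EFin_inj; rewrite EFinM !EFin_Ex//.
transitivity (\int[distribution P XY]_z h z)%E.
  by rewrite integral_distribution.
rewrite -(eq_measure_integral _ (fun A mA _ => law mA)).
rewrite -integral12_prod_meas1// /fubini_F/=.
under eq_integral => x _.
  under eq_integral do rewrite /h/= EFinM.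
  rewrite integralZl//; last by apply: integrable_pushforward.
  rewrite integral_distribution// -(EFin_Ex Ig).
  over.
rewrite integralZr//; last by apply: integrable_pushforward.
by rewrite integral_distribution// EFin_Ex.
Qed.

End TwoVariables.
End Independence.

(** * Orthogonality to the past and Doob's maximal inequality *)

Section Orthogonality.
Variables (R : realType) (dO : measure_display) (Omega : measurableType dO).
Variable P : probability Omega R.
Local Notation mO := (@measurable dO Omega).
Local Notation l2 := (l2 P).
Local Notation L2 := (L2 P).
Local Notation Ex := (Ex P).
Local Notation integ := (integ P).

(** Stands for [E[xi | G] = 0]. Test variables are square integrable, so that their products with a
    square-integrable [xi] are integrable. *)
Definition orth (G : set (set Omega)) p (xi : Omega -> 'cV[R]_p) :=
  forall i (Z : Omega -> R) r, rmeas G Z -> l2 Z r ->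
    Ex (fun w => Z w * xi w i 0) = 0.

Lemma orthD G p (xi xi' : Omega -> 'cV[R]_p) r r' : L2 xi r -> L2 xi' r' ->
  orth G xi -> orth G xi' -> orth G (fun w => xi w + xi' w).
Proof.
move=> lx lx' o o' i Z s mZ lZ.
under [X in Ex X]eq_fun do rewrite mxE mulrDr.
rewrite ExD; first by rewrite (o _ _ _ mZ lZ) (o' _ _ _ mZ lZ) addr0.
  exact: l2_integM lZ (L2_coord _ _ lx).
exact: l2_integM lZ (L2_coord _ _ lx').
Qed.

Lemma orthN G p (xi : Omega -> 'cV[R]_p) r : L2 xi r ->
  orth G xi -> orth G (fun w => - xi w).
Proof.
move=> lx o i Z s mZ lZ.
under [X in Ex X]eq_fun do rewrite mxE mulrN.
rewrite ExN; first by rewrite (o _ _ _ mZ lZ) oppr0.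
exact: l2_integM lZ (L2_coord _ _ lx).
Qed.

(** The coordinates of [D] are themselves admissible test variables, so the cross terms vanish.
    Without this gain the errors of size [sqrt dt] would not sum over the [1 / dt] steps. *)
Lemma L2_pythagoras G p (D xi : Omega -> 'cV[R]_p) r s : rv_measurable G D ->
  L2 D r -> L2 xi s -> orth G xi ->
  L2 (fun w => D w + xi w) (Num.sqrt (r ^+ 2 + s ^+ 2)).
Proof.
move=> mD lD lx o; have [mS _] := L2D lD lx; split=> //.
have [_ /l2P[_ _ ID Dr]] := lD; have [_ /l2P[_ _ Ix xs]] := lx.
pose c w := \sum_i D w i 0 * xi w i 0.
have E w : fnorm (D w + xi w) ^+ 2 = fnorm (D w) ^+ 2 + (2 * c w + fnorm (xi w) ^+ 2).
  rewrite !fnorm_sqr mulr_sumr -!big_split; apply: eq_bigr => i _ /=.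
  by rewrite !big_ord1 !mxE; ring.
have Ic i : integ (fun w => D w i 0 * xi w i 0).
  exact: l2_integM (L2_coord _ _ lD) (L2_coord _ _ lx).
have Ic' : integ c by exact: integ_sum.
have I2 : integ (fun w => 2 * c w + fnorm (xi w) ^+ 2) by apply: integD => //; exact: integZ.
apply/l2P; split.
- exact: rmeas_fnorm.
- exact: sqrtr_ge0.
- by under [X in integ X]eq_fun do rewrite E; exact: integD.
under [X in Ex X]eq_fun do rewrite E.
rewrite sqr_sqrtr ?addr_ge0 ?sqr_ge0// !ExD//; last exact: integZ.
rewrite ExZ// Ex_sum// big1 ?mulr0 ?add0r ?lerD// => i _.
exact: o (mD _ _) (L2_coord _ _ lD).
Qed.

(** Running maximum with floor 0. It is not taken of absolute values: the maximal inequality is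
    applied to [x] and to [- x] separately. *)
Fixpoint runmax (x : nat -> R) n :=
  if n is n'.+1 then Num.max (runmax x n') (x n) else Num.max 0 (x 0%N).

Lemma runmax_ge0 x n : 0 <= runmax x n.
Proof. by elim: n => [|n IH] /=; rewrite le_max ?lexx// IH. Qed.

Lemma le_runmax x n i : (i <= n)%N -> x i <= runmax x n.
Proof.
elim: n => [|n IH]; first by rewrite leqn0 => /eqP ->; rewrite /= le_max lexx orbT.
by rewrite leq_eqVlt => /predU1P[->|] /=; rewrite le_max ?lexx ?orbT// => /IH ->.
Qed.

(* Pathwise form of Doob's inequality: taking expectations kills the last sum. *)
Lemma doob_pathwise (x : nat -> R) (n : nat) : x 0%N = 0 ->
  runmax x n ^+ 2 <= 2 * (runmax x n * x n) -
    2 * \sum_(i < n) runmax x i * (x i.+1 - x i).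
Proof.
move=> x0; elim: n => [|n IH].
  by rewrite /= big_ord0 x0 maxxx expr0n/= !mulr0 subr0.
rewrite big_ord_recr/=.
have [snx|xsn] := leP (runmax x n) (x n.+1); last by nra.
by have := sqr_ge0 (runmax x n - x n.+1); nra.
Qed.

Lemma rmeas_runmax G (x : nat -> Omega -> R) n : sigma_algebra setT G ->
  (forall i, (i <= n)%N -> rmeas G (x i)) -> rmeas G (fun w => runmax (x^~ w) n).
Proof.
move=> sG; elim: n => [|n IH] mx /=.
  by apply: rmeas_max => //; [exact: rmeas_cst|exact: mx].
apply: rmeas_max => //; last exact: mx.
by apply: IH => i iN; apply: mx; exact: leqW.
Qed.

Lemma rmeas_bigmax G (I : Type) (t : seq I) (x : I -> Omega -> R) : sigma_algebra setT G ->
  (forall i, rmeas G (x i)) -> rmeas G (fun w => \big[Num.max/0]_(i <- t) x i w).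
Proof.
move=> sG mx; elim: t => [|i t IH].
  by apply: rmeas_ext (rmeas_cst sG 0) => w; rewrite big_nil.
by apply: rmeas_ext (rmeas_max sG (mx i) IH) => w; rewrite big_cons.
Qed.

(** Only qualitative: it makes the products in Doob's argument integrable and its left-hand side
    finite before the sharp constant is known. *)
Lemma l2_runmax (x : nat -> Omega -> R) (r : nat -> R) n :
  (forall i, (i <= n)%N -> l2 (x i) (r i)) -> exists c, l2 (fun w => runmax (x^~ w) n) c.
Proof.
move=> lx; exists (\sum_(i < n.+1) r i).
have lS := l2_sum (index_enum _) (fun i : 'I_n.+1 => l2_norm (lx i (leq_ord i))).
apply: l2_dom lS.
  by apply: rmeas_runmax => // i iN; exact: l2_meas (lx i iN).
apply: aeW => w; rewrite !ger0_norm ?runmax_ge0 ?sumr_ge0//.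
have H i : (i <= n)%N -> `|x i w| <= \sum_(i < n.+1) `|x i w|.
  by move=> iN; rewrite (bigD1 (Ordinal (iN : (i < n.+1)%N)))//= lerDl sumr_ge0.
have : 0 <= \sum_(i < n.+1) `|x i w| by exact: sumr_ge0.
set B := \sum_(i < n.+1) _ in H * => B0.
elim: {-2}n (leqnn n) => [|j IH] jn /=; rewrite ge_max.
  by rewrite B0/= (le_trans (ler_norm _))// H.
by rewrite IH ?(ltnW jn)// (le_trans (ler_norm _))// H.
Qed.

Section DiscreteMartingale.
Variables (p N : nat) (G : nat -> set (set Omega)) (xi : nat -> Omega -> 'cV[R]_p).
Variable r : nat -> R.
Hypothesis sG : forall n, (n <= N)%N -> sigma_algebra setT (G n).
Hypothesis G_mono : forall i j, (i <= j)%N -> (j <= N)%N -> G i `<=` G j.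
Hypothesis G_meas : forall n, (n <= N)%N -> G n `<=` mO.
Hypothesis mxi : forall n, (n < N)%N -> rv_measurable (G n.+1) (xi n).
Hypothesis oxi : forall n, (n < N)%N -> orth (G n) (xi n).
Hypothesis lxi : forall n, (n < N)%N -> L2 (xi n) (r n).

Let S n w := \sum_(i < n) xi i w.

Lemma martingale_sum_measurable n : (n <= N)%N -> rv_measurable (G n) (S n).
Proof.
elim: n => [|n IH] nN.
  by apply: rv_ext (rv_cst (sG nN) 0) => w; rewrite /S big_ord0.
apply: (@rv_ext _ _ _ _ _ _ (fun w => S n w + xi n w)).
  by move=> w; rewrite /S big_ord_recr.
apply: rvD; [exact: sG| |exact: mxi].
by move=> i j B mB; apply: (G_mono (leqnSn n) nN); apply: IH => //; exact: ltnW.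
Qed.

Lemma martingale_sum_L2 n : (n <= N)%N ->
  L2 (S n) (Num.sqrt (\sum_(i < n) r i ^+ 2)).
Proof.
elim: n => [|n IH] nN.
  rewrite big_ord0 sqrtr0; apply: L2_ext (L2_le _ (L2_cst P 0)); rewrite ?fnorm0//.
  by move=> w; rewrite /S big_ord0.
have := L2_pythagoras (martingale_sum_measurable (ltnW nN)) (IH (ltnW nN)) (lxi nN) (oxi nN).
rewrite big_ord_recr/= sqr_sqrtr; last by apply: sumr_ge0 => i _; exact: sqr_ge0.
by apply: L2_ext => w; rewrite /S big_ord_recr.
Qed.

Let c := Num.sqrt (\sum_(i < N) r i ^+ 2).

(** [e] is a sign. The expectation [A] of the squared running maximum satisfies [A <= 2 E[s_N x_N]
    <= 2 sqrt(A) c], and [sqrt A] is cancelled because [A] is already known to be finite. *)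
Lemma martingale_coord_runmax j (e : R) : `|e| = 1 ->
  l2 (fun w => runmax (fun n => e * S n w j 0) N) (2 * c).
Proof.
move=> e1; pose x n w := e * S n w j 0; pose s n w := runmax (x^~ w) n.
have lx n : (n <= N)%N -> l2 (x n) (Num.sqrt (\sum_(i < n) r i ^+ 2)).
  move=> nN; have := l2Z e (L2_coord j 0 (martingale_sum_L2 nN)).
  by rewrite e1 mul1r.
have mx n i : (n <= N)%N -> (i <= n)%N -> rmeas (G n) (x i).
  move=> nN iN; have sGi := sG (leq_trans iN nN).
  have : rmeas (G i) (x i).
    apply: rmeasM => //; first exact: rmeas_cst.
    exact: martingale_sum_measurable (leq_trans iN nN) _ _.
  by apply: rmeas_sub; exact: G_mono.
have ms n : (n <= N)%N -> rmeas (G n) (s n).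
  by move=> nN; apply: rmeas_runmax; [exact: sG|move=> i; exact: mx].
have ls n : (n <= N)%N -> exists q, l2 (s n) q.
  move=> nN; apply: (l2_runmax (r := fun n => Num.sqrt (\sum_(i < n) r i ^+ 2))) => i iN.
  exact: lx (leq_trans iN nN).
have lxN : l2 (x N) c by exact: lx.
have [q lsN] := ls N (leqnn N).
have /l2P[msN _ Is _] := lsN.
have Isx : integ (fun w => s N w * x N w) by exact: l2_integM lsN lxN.
have dx n w : x n.+1 w - x n w = e * xi n w j 0.
  by rewrite /x /S big_ord_recr/= mxE -mulrBr addrAC subrr add0r.
have Isd (i : 'I_N) : integ (fun w => s i w * (x i.+1 w - x i w)).
  have [qi lsi] := ls i (ltnW (ltn_ord i)).
  by apply: l2_integM lsi (l2D (lx _ (ltn_ord i)) (l2N (lx _ (ltnW (ltn_ord i))))).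
(* The running maximum up to [i] depends on the past only, so, multiplied by the sign, it is a test
   variable for [xi i]. *)
have Esd (i : 'I_N) : Ex (fun w => s i w * (x i.+1 w - x i w)) = 0.
  have [qi lsi] := ls i (ltnW (ltn_ord i)).
  have msi := ms i (ltnW (ltn_ord i)).
  have mes : rmeas (G i) (fun w => e * s i w).
    by apply: rmeasM => //; [exact: sG (ltnW (ltn_ord i))|apply: rmeas_cst; exact: sG (ltnW (ltn_ord i))].
  have := oxi (ltn_ord i) j mes (l2Z e lsi).
  by move=> <-; congr Ex; apply/funext => w; rewrite dx; ring.
have Es : Ex (fun w => s N w ^+ 2) <= 2 * Ex (fun w => s N w * x N w).
  have -> : 2 * Ex (fun w => s N w * x N w) = Ex (fun w => 2 * (s N w * x N w)
     - 2 * \sum_(i < N) s i w * (x i.+1 w - x i w)).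
    rewrite ExB; [|exact: integZ|by apply: integZ; exact: integ_sum].
    rewrite !ExZ//; last exact: integ_sum.
    by rewrite Ex_sum// big1 ?mulr0 ?subr0// => i _; exact: Esd.
  apply: le_Ex => //.
    by apply: integB; [exact: integZ|apply: integZ; exact: integ_sum].
  by move=> w; apply: doob_pathwise; rewrite /x /S big_ord0 mxE mulr0.
set A := Ex (fun w => s N w ^+ 2) in Es.
have A0 : 0 <= A by apply: Ex_ge0 => w; exact: sqr_ge0.
have lsA : l2 (s N) (Num.sqrt A).
  by apply/l2P; split; rewrite ?sqrtr_ge0// sqr_sqrtr.
have := le_trans (ler_norm _) (l2_cauchy_schwarz lsA lxN) => CS.
have c0 : 0 <= c by exact: sqrtr_ge0.
have B0 := sqrtr_ge0 A; have BB := sqr_sqrtr A0.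
apply: l2_le lsA; move: Es CS BB B0; rewrite -/A.
set B := Num.sqrt A; set E := Ex _ => Es CS BB B0.
have : B ^+ 2 <= 2 * c * B by lra.
have [->|Bp] := eqVneq B 0; first by move=> _; rewrite mulr_ge0.
by rewrite expr2 ler_pM2r// lt0r Bp.
Qed.

(** For each of the [p] coordinates, the absolute value is at most the sum of the running maxima of
    the two signs, each of norm at most [2 c]. *)
Lemma martingale_max :
  l2 (fun w => \big[Num.max/0]_(n < N.+1) fnorm (S n w)) (p%:R * (4 * c)).
Proof.
have l1 j := l2D (martingale_coord_runmax j (normr1 R))
  (martingale_coord_runmax j (normrN1 R)).
have lS := l2_sum (index_enum _) l1.
have -> : p%:R * (4 * c) = \sum_(j < p) (2 * c + 2 * c).
  by rewrite sumr_const card_ord -[RHS]mulr_natl; congr (_ * _); ring.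
apply: l2_dom lS.
  have H (n : 'I_N.+1) : rmeas mO (fun w => fnorm (S n w)).
    apply: rmeas_fnorm => // i j B mB.
    by apply: (G_meas (leq_ord n)); exact: martingale_sum_measurable (leq_ord n) _ _ _ _.
  exact: rmeas_bigmax.
apply: aeW => w.
have R0 : 0 <= \sum_(j < p) (runmax (fun n => 1 * S n w j 0) N + runmax (fun n => -1 * S n w j 0) N).
  by apply: sumr_ge0 => j _; rewrite addr_ge0 ?runmax_ge0.
rewrite ger0_norm; last by apply: bigmax_ge_id.
rewrite ger0_norm//; apply: bigmax_le => // n _.
apply: le_trans (fnorm_le_sum _) _; apply: ler_sum => j _; rewrite big_ord1.
rewrite ler_norml; apply/andP; split.
  rewrite lerNl -[leLHS]addr0 addrC lerD ?runmax_ge0// -[leLHS]mulN1r.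
  exact: (le_runmax (fun n => -1 * S n w j 0) (leq_ord n)).
rewrite -[leLHS]addr0 lerD ?runmax_ge0// -[leLHS]mul1r.
exact: (le_runmax (fun n => 1 * S n w j 0) (leq_ord n)).
Qed.

End DiscreteMartingale.
End Orthogonality.

(** * Brownian motion and the Ito integral *)

(** Independence of Brownian increments is stated for the sigma-algebra generated by open sets of
    vectors; this brings single coordinates into its scope. *)
Lemma sigma_open_coord (R : realType) m (i : 'I_m) (B : set R) : measurable B ->
  <<s @open 'cV[R]_m >> ((fun v : 'cV[R]_m => v i 0) @^-1` B).
Proof.
move=> mB.
have mc : measurable_fun [set: g_sigma_algebraType (@open 'cV[R]_m)] (fun v : 'cV[R]_m => v i 0).
  apply: (measurability _ (RGenOpens.measurableE R)) => _ [_ [x [y ->]] <-].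
  rewrite setTI; apply: sub_sigma_algebra.
  apply: open_comp; last exact: interval_open.
  by move=> v _; exact: coord_continuous.
by have := mc measurableT B mB; rewrite setTI.
Qed.

Section Brownian.
Variables (R : realType) (dO : measure_display) (Omega : measurableType dO).
Variables (P : probability Omega R) (F : R -> set (set Omega)) (m : nat).
Variable W : R -> Omega -> 'cV[R]_m.
Hypotheses (uc : usual_conditions P F) (bm : brownian_motion P F W).
Local Notation mO := (@measurable dO Omega).
Local Notation l2 := (l2 P).
Local Notation L2 := (L2 P).

Lemma filtration_sigma t : 0 <= t -> sigma_algebra setT (F t).
Proof. exact: uc_sigma_algebra uc t. Qed.

Lemma filtration_meas t : 0 <= t -> F t `<=` mO.
Proof. exact: uc_measurable uc t. Qed.

Lemma filtration_mono s t : 0 <= s -> s <= t -> F s `<=` F t.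
Proof. exact: uc_nondecreasing uc s t. Qed.

Lemma rv_mono s t p q (X : Omega -> 'M[R]_(p, q)) : 0 <= s -> s <= t ->
  rv_measurable (F s) X -> rv_measurable (F t) X.
Proof. by move=> s0 st mX i j B mB; apply: (filtration_mono s0 st); exact: mX. Qed.

Lemma rv_filtration t p q (X : Omega -> 'M[R]_(p, q)) : 0 <= t ->
  rv_measurable (F t) X -> rv_measurable mO X.
Proof. by move=> t0 mX i j B mB; apply: (filtration_meas t0); exact: mX. Qed.

Lemma rmeas_filtration t (f : Omega -> R) : 0 <= t -> rmeas (F t) f -> rmeas mO f.
Proof. by move=> t0 mX B mB; apply: (filtration_meas t0); exact: mX. Qed.

Lemma rv_increment s t : 0 <= s -> s <= t -> rv_measurable (F t) (fun w => W t w - W s w).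
Proof.
move=> s0 st; have t0 := le_trans s0 st.
apply: rvB; [exact: filtration_sigma|exact: bm_adapted bm _ t0|].
by apply: rv_mono st _ => //; exact: bm_adapted bm _ s0.
Qed.

Lemma bm_indep s t (Z : Omega -> R) i : 0 <= s -> s < t -> rmeas (F s) Z ->
  indep P Z (fun w => (W t w - W s w) i 0).
Proof.
move=> s0 st mZ A B mA mB.
exact: (bm_independent bm s0 st (mZ A mA) (sigma_open_coord i mB)).
Qed.

(** The joint Gaussian law is tested on the box that is [B] in direction [i] and the whole line in
    the other directions. *)
Lemma bm_coord_law s t i (B : set R) : 0 <= s -> s < t -> measurable B ->
  P ((fun w => (W t w - W s w) i 0) @^-1` B) = normal_prob 0 (Num.sqrt (t - s)) B.
Proof.
move=> s0 st mB.
have := @bm_gaussian _ _ _ _ _ _ _ bm s t s0 st (fun j => if j == i then B else setT).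
have mB' j : measurable (if j == i then B else setT) by case: ifP.
move=> /(_ mB'); rewrite (bigD1 i)//= eqxx big1 ?mule1 => [<-|j /negPf ->].
  congr (P _); apply/seteqP; split=> w /=.
    by move=> Bw j; case: ifPn => [/eqP ->|].
  by move=> /(_ i); rewrite eqxx.
exact: probability_setT.
Qed.

Lemma bm_coord_integral s t i (h : R -> \bar R) : 0 <= s -> s < t ->
  measurable_fun setT h -> (forall x, 0 <= h x)%E ->
  (\int[P]_w h ((W t w - W s w)%R i 0%R) = \int[normal_prob 0 (Num.sqrt (t - s))]_x h x)%E.
Proof.
move=> s0 st mh h0.
have mX0 : measurable_fun [set: Omega] (fun w => (W t w - W s w) i 0).
  apply/rmeas_measurable; apply: (@rmeas_filtration t); first exact: le_trans (ltW st).
  exact: rv_increment s0 (ltW st) _ _.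
have mX : @measurable_fun _ _ _ (measurableTypeR R) [set: Omega]
  (fun w => (W t w - W s w) i 0) by exact: mX0.
pose X : {mfun Omega >-> measurableTypeR R} := HB.pack (fun w => (W t w - W s w) i 0)
  (isMeasurableFun.Build _ _ _ _ _ mX).
transitivity (\int[distribution P X]_x h x)%E.
  by rewrite ge0_integral_distribution.
apply: eq_measure_integral => A mA _.
exact: (@bm_coord_law s t i A s0 st mA).
Qed.

Lemma bm_coord_l2 s t i : 0 <= s -> s <= t ->
  l2 (fun w => (W t w - W s w) i 0) (3 * Num.sqrt (t - s)).
Proof.
move=> s0; rewrite le_eqVlt => /predU1P[<-|st].
  rewrite subrr sqrtr0 mulr0; apply: l2_ext (l2_le _ (l2_cst P 0)) => [w|].
    by rewrite subrr mxE.
  by rewrite normr0.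
split.
- apply: (@rmeas_filtration t); first exact: le_trans (ltW st).
  exact: rv_increment s0 (ltW st) _ _.
- by rewrite mulr_ge0 ?sqrtr_ge0.
- rewrite (@bm_coord_integral _ _ i (fun x => (x ^+ 2)%:E))//.
  + by apply: normal_prob_second_moment; rewrite sqrtr_gt0 subr_gt0.
  + by apply/measurable_EFinP; apply: (measurable_funX (f := id)).
  + by move=> x; rewrite lee_fin sqr_ge0.
Qed.

Lemma bm_coord_mean s t i : 0 <= s -> s <= t ->
  Ex P (fun w => (W t w - W s w) i 0) = 0.
Proof.
move=> s0; rewrite le_eqVlt => /predU1P[<-|st].
  by under [X in Ex _ X]eq_fun do rewrite subrr mxE; exact: Ex_cst.
have lX0 := bm_coord_l2 i s0 (ltW st).
set X := (fun w => (W t w - W s w) i 0) in lX0 *.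
have lX1 : l2 (fun w => Num.max (X w) 0) (3 * Num.sqrt (t - s)).
  apply: l2_dom (lX0); last first.
    apply: aeW => w; rewrite ger0_norm ?le_max ?lexx ?orbT// ge_max normr_ge0 andbT.
    exact: ler_norm.
  by apply: rmeas_max => //; [exact: l2_meas lX0|exact: rmeas_cst].
have lX2 : l2 (fun w => Num.max (- X w) 0) (3 * Num.sqrt (t - s)).
  apply: l2_dom (lX0); last first.
    apply: aeW => w; rewrite ger0_norm ?le_max ?lexx ?orbT// ge_max normr_ge0 andbT.
    by rewrite -normrN ler_norm.
  apply: rmeas_max => //; last exact: rmeas_cst.
  by apply: rmeasN => //; exact: l2_meas lX0.
have -> : X = fun w => Num.max (X w) 0 - Num.max (- X w) 0.
  by apply/funext => w; case: (leP (X w) 0) => h; case: (leP (- X w) 0) => h'; lra.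
rewrite ExB; [|exact: l2_integ lX1|exact: l2_integ lX2].
apply/eqP; rewrite subr_eq0; apply/eqP; apply: EFin_inj.
rewrite !EFin_Ex; [|exact: l2_integ lX2|exact: l2_integ lX1].
rewrite (@bm_coord_integral _ _ i (fun x => (Num.max x 0)%:E))//; last 2 first.
  by apply/measurable_EFinP; apply: measurable_maxr.
  by move=> x; rewrite lee_fin le_max lexx orbT.
rewrite (@bm_coord_integral _ _ i (fun x => (Num.max (- x) 0)%:E))//; last 2 first.
  by apply/measurable_EFinP; apply: measurable_maxr.
  by move=> x; rewrite lee_fin le_max lexx orbT.
by apply: normal_prob_pos_neg; rewrite gt_eqF// sqrtr_gt0 subr_gt0.
Qed.

(** Independence factorises [E[Z^2 dW^2]], so a square-integrable [Z] suffices, although a product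
    of two square-integrable variables is in general only integrable. *)
Lemma l2_bm_mul s t (Z : Omega -> R) r i : 0 <= s -> s <= t -> rmeas (F s) Z ->
  l2 Z r -> l2 (fun w => Z w * (W t w - W s w) i 0) (r * (3 * Num.sqrt (t - s))).
Proof.
move=> s0 st mZ lZ; have lX := bm_coord_l2 i s0 st.
move: (st); rewrite le_eqVlt => /predU1P[st0|slt].
  rewrite -st0 subrr sqrtr0 !mulr0; apply: l2_ext (l2_le _ (l2_cst P 0)) => [w|].
    by rewrite subrr mxE mulr0.
  by rewrite normr0.
case: (lZ) (lX) => mZ' r0 Zr [mX q0 Xq]; split.
- exact: rmeasM.
- exact: mulr_ge0.
have iZX : indep P (fun w => Z w ^+ 2) (fun w => ((W t w - W s w) i 0) ^+ 2).
  have msq (A : set R) : measurable A -> measurable ((fun x : R => x ^+ 2) @^-1` A).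
    move=> mA; rewrite -[X in measurable X]setTI.
    by apply: (measurable_funX (f := id)).
  move=> A B mA mB.
  exact: (bm_indep i s0 slt mZ (msq A mA) (msq B mB)).
under eq_integral do rewrite exprMn.
rewrite (indep_ge0_integralM _ _ iZX); first last.
- by move=> w; exact: sqr_ge0.
- by move=> w; exact: sqr_ge0.
- by apply/rmeas_measurable; exact: rmeasX.
- by apply/rmeas_measurable; exact: rmeasX.
rewrite exprMn EFinM; apply: lee_pmul => //.
  by apply: integral_ge0 => w _; rewrite lee_fin sqr_ge0.
by apply: integral_ge0 => w _; rewrite lee_fin sqr_ge0.
Qed.

(** Constant of the Ito isometry in the form of an inequality: 3 comes from the Gaussian second
    moment, the dimensions from working entry by entry. *)
Definition c_bm p : R := 3 * ((p * 1)%:R * m%:R).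

Lemma L2_bm_mul s t p (B : Omega -> 'M[R]_(p, m)) r : 0 <= s -> s <= t ->
  rv_measurable (F s) B -> L2 B r ->
  L2 (fun w => B w *m (W t w - W s w)) (c_bm p * Num.sqrt (t - s) * r).
Proof.
move=> s0 st mB lB.
have -> : c_bm p * Num.sqrt (t - s) * r =
  (p * 1)%:R * (\sum_(l < m) r * (3 * Num.sqrt (t - s))).
  by rewrite sumr_const card_ord -(mulr_natl _ m) /c_bm; ring.
apply: L2_of_coord => i j; rewrite (ord1 j).
have := l2_sum (index_enum _) (fun l => l2_bm_mul l s0 st (mB i l) (L2_coord i l lB)).
by apply: l2_ext => w; rewrite mxE.
Qed.

Lemma orth_bm s t p (B : Omega -> 'M[R]_(p, m)) r : 0 <= s -> s <= t ->
  rv_measurable (F s) B -> L2 B r -> orth P (F s) (fun w => B w *m (W t w - W s w)).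
Proof.
move=> s0 st mB lB i Z q mZ lZ.
move: (st); rewrite le_eqVlt => /predU1P[st0|slt].
  under [X in Ex _ X]eq_fun do rewrite -st0 subrr mulmx0 mxE mulr0.
  exact: Ex_cst.
under [X in Ex _ X]eq_fun do rewrite mxE mulr_sumr.
have I l : integ P (fun w => Z w * (B w i l * (W t w - W s w) l 0)).
  exact: l2_integM lZ (l2_bm_mul l s0 st (mB i l) (L2_coord i l lB)).
rewrite Ex_sum// big1// => l _.
have lX := bm_coord_l2 l s0 st.
have mZB : rmeas (F s) (fun w => Z w * B w i l).
  by apply: rmeasM; [exact: filtration_sigma s0|exact: mZ|exact: mB].
under [X in Ex _ X]eq_fun do rewrite mulrA.
rewrite indep_ExM ?bm_coord_mean ?mulr0//.
- by apply/rmeas_measurable; exact: rmeas_filtration mZB.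
- by apply/rmeas_measurable; exact: l2_meas lX.
- exact: bm_indep.
- exact: l2_integM lZ (L2_coord i l lB).
- exact: l2_integ lX.
- by under [X in integ _ X]eq_fun do rewrite -mulrA.
Qed.

End Brownian.

Lemma l2_closed (R : realType) (dO : measure_display) (Omega : measurableType dO)
    (P : probability Omega R) (f : Omega -> R) r : 0 <= r ->
  (forall e, 0 < e -> l2 P f (r + e)) -> l2 P f r.
Proof.
move=> r0 H; have /l2P[mf _ If _] := H 1 ltr01.
apply/l2P; split=> //; apply/ler_addgt0Pr => e e0.
(* For [e' <= 1] one has [(r + e')^2 <= r^2 + e' (2 r + 1)]. *)
pose e' := Num.min 1 (e / (2 * r + 1)).
have d0 : 0 < 2 * r + 1 by lra.
have e'0 : 0 < e' by rewrite lt_min ltr01 divr_gt0.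
have /l2P[_ _ _ fr] := H _ e'0; apply: le_trans fr _.
have e1 : e' <= 1 by rewrite ge_min lexx.
have : e' * (2 * r + 1) <= e by rewrite -ler_pdivlMr// ge_min lexx orbT.
nra.
Qed.

Lemma L2_closed (R : realType) (dO : measure_display) (Omega : measurableType dO)
    (P : probability Omega R) p q (X : Omega -> 'M[R]_(p, q)) r : 0 <= r ->
  (forall e, 0 < e -> L2 P X (r + e)) -> L2 P X r.
Proof.
move=> r0 H; split; first by case: (H 1 ltr01).
by apply: l2_closed => // e e0; case: (H e e0).
Qed.

Lemma cvge0_le (R : realType) (u : nat -> \bar R) (e : R) : 0 < e ->
  u @ \oo --> 0%E -> \forall n \near \oo, (u n <= e%:E)%E.
Proof.
move=> e0 /(_ [set x | (x < e%:E)%E]) H.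
have : nbhs (0 : \bar R)%E [set x | (x < e%:E)%E].
  by apply: open_nbhs_nbhs; split; [exact: open_ereal_lt_ereal|rewrite /= lte_fin].
move=> /H H'; near=> n; apply: ltW; near: n; exact: H'.
Unshelve. all: by end_near. Qed.

Lemma integral_itv_chain (R : realType) (f : R -> \bar R) (x : nat -> R) n :
  measurable_fun setT f -> (forall s, 0 <= f s)%E ->
  (forall j, (j < n)%N -> x j <= x j.+1) ->
  (\int[lebesgue_measure]_(s in `]x 0%N, x n]) f s =
   \sum_(j < n) \int[lebesgue_measure]_(s in `]x j, x j.+1]) f s)%E.
Proof.
move=> mf f0; elim: n => [|n IH] xx.
  by rewrite big_ord0 set_itvoc0 integral_set0.
have x0n : x 0%N <= x n.
  elim: {IH} n xx => // n IH xx; apply: le_trans (xx n _) => //.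
  by apply: IH => j jn; apply: xx; exact: ltnW.
rewrite big_ord_recr/= -IH; last by move=> j jn; apply: xx; exact: ltnW.
rewrite -ge0_integral_setU//=.
- congr (integral _ _ _); apply/seteqP; split=> s /=; rewrite !in_itv/=.
    move=> /andP[s1 s2]; have [sn|ns] := leP s (x n); [left|right].
      by rewrite s1.
    by rewrite s2.
  case=> /andP[s1 s2]; rewrite ?s1 ?s2/= ?andbT.
    by rewrite (le_trans s2)// xx.
  by rewrite (le_lt_trans x0n s1).
- exact: measurable_funTS.
- apply/disj_setPS => s /= []; rewrite !in_itv/= => /andP[_ s1] /andP[s2 _].
  by move: (le_lt_trans s1 s2); rewrite ltxx.
Qed.

(** * Integrals of simple processes between two times *)

Section SimpleProcesses.
Variables (R : realType) (dO : measure_display) (Omega : measurableType dO).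
Variables (P : probability Omega R) (F : R -> set (set Omega)) (m : nat).
Variable W : R -> Omega -> 'cV[R]_m.
Hypotheses (uc : usual_conditions P F) (bm : brownian_motion P F W).
Local Notation mO := (@measurable dO Omega).
Local Notation l2 := (l2 P).
Local Notation L2 := (L2 P).
Variables (T : R) (p : nat).

Section OneSimpleProcess.
Variable S : simple_process R Omega p m.
Hypothesis wf : simple_process_wf F T S.
Local Notation tau := (sp_time S).
Local Notation n := (sp_size S).

Lemma sp_time_mono i j : (i <= j)%N -> (j <= n)%N -> tau i <= tau j.
Proof.
elim: j => [|j IH]; first by rewrite leqn0 => /eqP ->.
rewrite leq_eqVlt => /predU1P[-> //|] ij jn.
exact: le_trans (IH ij (ltnW jn)) (ltW (sp_increasing wf jn)).
Qed.

Lemma sp_time_ge0 i : (i <= n)%N -> 0 <= tau i.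
Proof. by move=> iN; rewrite -(sp_start wf); exact: sp_time_mono. Qed.

Lemma sp_coef_meas j : (j < n)%N -> rv_measurable mO (sp_coef S j).
Proof.
move=> jn; apply: (rv_filtration uc) (sp_adapted wf jn).
exact: sp_time_ge0 (ltnW jn).
Qed.

Lemma sp_coef_L2 : exists K : R, forall j, (j < n)%N -> L2 (sp_coef S j) K.
Proof.
have [K SK] := sp_bounded wf; exists `|K| => j jn.
apply: L2_dom (l2_cst P K); first exact: sp_coef_meas.
by apply: aeW => w; apply: le_trans (SK j w jn) (ler_norm _).
Qed.

Lemma sp_evalE j s w : (j < n)%N -> tau j < s <= tau j.+1 ->
  sp_eval S s w = sp_coef S j w.
Proof.
move=> jn /andP[js sj]; rewrite /sp_eval (bigD1 (Ordinal jn))//= js sj scale1r.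
rewrite big1 ?addr0// => -[i iN] /= ij.
have {ij} : i != j by apply: contraNneq ij => ij; apply/eqP/val_inj.
rewrite neq_ltn => /orP[ij|ji]; case: (boolP (_ && _)) => //; rewrite ?scale0r//.
  by move=> /andP[_ si]; have := le_lt_trans (le_trans si (sp_time_mono ij (ltnW jn))) js; rewrite ltxx.
by move=> /andP[si _]; have := le_lt_trans (le_trans sj (sp_time_mono ji (ltnW iN))) si; rewrite ltxx.
Qed.

Lemma sp_integral0 w : sp_integral S W 0 w = 0.
Proof.
rewrite /sp_integral big1// => -[j jn] _ /=.
by rewrite !min_r ?sp_time_ge0 ?(ltnW jn)// subrr mulmx0.
Qed.

Section Interval.
Variables (t t' : R) (B : Omega -> 'M[R]_(p, m)) (r : R).
Hypotheses (t0 : 0 <= t) (tt' : t <= t') (t'T : t' <= T).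
Hypotheses (mB : rv_measurable (F t) B) (lB : L2 B r).

(** The jump times of [S] clipped to [[t, t']]: they form a partition from [t] to [t'], whether or
    not these are jump times themselves, at the price of repeated points. *)
Let x j := Num.max t (Num.min (tau j) t').

Let x_ge j : t <= x j. Proof. by rewrite le_max lexx. Qed.
Let x_le j : x j <= t'. Proof. by rewrite ge_max tt' ge_min lexx orbT. Qed.
Let x_mono i j : (i <= j)%N -> (j <= n)%N -> x i <= x j.
Proof.
move=> ij jn; rewrite ge_max x_ge/= le_max; apply/orP; right.
by rewrite le_min !ge_min (sp_time_mono ij jn) lexx !orbT.
Qed.
Let x0 : x 0 = t.
Proof. by apply: max_l; rewrite (sp_start wf) ge_min t0. Qed.
Let xn : x n = t'.
Proof. by rewrite /x (sp_end wf) (min_r t'T) max_r. Qed.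

(* Increments of the integral of [S - B] on [t, t'], with zero coefficient on
   the subintervals that the clipping has collapsed. *)
Let c j : Omega -> 'M[R]_(p, m) :=
  if x j < x j.+1 then fun w => sp_coef S j w - B w else fun=> 0.
Let xi j w := c j w *m (W (x j.+1) w - W (x j) w).

Lemma sp_integral_increment w :
  sp_integral S W t' w - sp_integral S W t w - B w *m (W t' w - W t w) =
  \sum_(j < n) xi j w.
Proof.
have -> : W t' w - W t w = \sum_(j < n) (W (x j.+1) w - W (x j) w).
  rewrite -(big_mkord xpredT (fun j => W (x j.+1) w - W (x j) w)) telescope_sumr//.
  by rewrite x0 xn.
rewrite /sp_integral -sumrB mulmx_sumr -sumrB; apply: eq_bigr => -[j jn] _ /=.
(* Stopping at [t'] and at [t] differ precisely by the path of [W] from [t] to the clipped point. *)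
have E i : W (Num.min (tau i) t') w - W (Num.min (tau i) t) w = W (x i) w - W t w.
  rewrite /x; have [it|ti] := leP (tau i) t.
    by rewrite (min_l (le_trans it tt')) (max_l it) !subrr.
  have [it'|t'i] := leP (tau i) t'; first by rewrite max_r ?ltW.
  by rewrite max_r.
rewrite -mulmxBr.
have -> : W (Num.min (tau j.+1) t') w - W (Num.min (tau j) t') w
    - (W (Num.min (tau j.+1) t) w - W (Num.min (tau j) t) w) = W (x j.+1) w - W (x j) w.
  transitivity ((W (Num.min (tau j.+1) t') w - W (Num.min (tau j.+1) t) w) -
     (W (Num.min (tau j) t') w - W (Num.min (tau j) t) w)).
    by apply/matrixP => i l; rewrite !mxE; ring.
  by rewrite !E opprB addrA subrK.
rewrite -mulmxBl /xi /c; case: ifPn => //; rewrite -leNgt => xx.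
have -> : x j.+1 = x j by apply/le_anti; rewrite xx x_mono.
by rewrite subrr !mulmx0.
Qed.

(** On a nondegenerate clipped interval [tau j <= x j], so the coefficient is known at time [x j]:
    otherwise [tau j] would be at least [t'], and both end points would be clipped to [t']. *)
Let mc j : (j < n)%N -> rv_measurable (F (x j)) (c j).
Proof.
move=> jn; have xj0 : 0 <= x j by exact: le_trans (x_ge j).
rewrite /c; case: ifPn => xx; last by apply: rv_cst; exact: (filtration_sigma uc).
apply: rvB; [exact: (filtration_sigma uc)| |exact: (rv_mono uc t0 (x_ge j) mB)].
apply: (rv_mono uc) (sp_adapted wf jn); first exact: sp_time_ge0 (ltnW jn).
rewrite leNgt; apply/negP => H; move: xx; apply/negP; rewrite -leNgt.
have tj : t' <= tau j.
  rewrite leNgt; apply/negP => H'; move: H; apply/negP; rewrite -leNgt.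
  by rewrite le_max le_min lexx (ltW H') orbT.
rewrite /x (min_r tj) (max_r tt') ge_max tt'/=.
by rewrite ge_min lexx orbT.
Qed.

Let lc j : (j < n)%N -> exists s, L2 (c j) s.
Proof.
move=> jn; have [K SK] := sp_coef_L2.
rewrite /c; case: ifP => _; first by exists (K + r); exact: L2B (SK j jn) lB.
by exists (fnorm (0 : 'M[R]_(p, m))); exact: L2_cst.
Qed.

Lemma orth_sp_increment :
  orth P (F t) (fun w => sp_integral S W t' w - sp_integral S W t w - B w *m (W t' w - W t w)).
Proof.
move=> i Z s mZ lZ; under [X in Ex _ X]eq_fun do rewrite sp_integral_increment summxE mulr_sumr.
have o (j : 'I_n) : exists q, L2 (xi j) q.
  have [q lq] := lc (ltn_ord j); eexists.
  apply: (L2_bm_mul uc bm _ _ (mc (ltn_ord j)) lq); first exact: le_trans (x_ge j).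
  exact: x_mono.
rewrite Ex_sum => [|j]; last first.
  by have [q lq] := o j; exact: l2_integM lZ (L2_coord _ _ lq).
rewrite big1// => j _; have [q lq] := lc (ltn_ord j).
have xj0 : 0 <= x j by exact: le_trans (x_ge j).
have oj := orth_bm uc bm xj0 (x_mono (leqnSn j) (ltn_ord j)) (mc (ltn_ord j)) lq.
by apply: oj lZ; apply: rmeas_sub mZ; apply: (filtration_mono uc).
Qed.

(** Ito isometry for a simple process against the coefficient [B] frozen on [[t, t']]: the
    orthogonal increments add in squares, and the sum of interval lengths times [E|c j|^2] is the
    double integral, since the integrand is constant on each clipped interval. *)
Lemma L2_sp_increment q : 0 <= q ->
  (\int[P]_w \int[lebesgue_measure]_(s in `]t, t']) ((fnorm (sp_eval S s w - B w) ^+ 2)%R)%:E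
   <= (q ^+ 2)%:E)%E ->
  L2 (fun w => sp_integral S W t' w - sp_integral S W t w - B w *m (W t' w - W t w)) (c_bm R m p * q).
Proof.
move=> q0 Iq.
have xj0 j : 0 <= x j by exact: le_trans (x_ge j).
(* The exact norm of the coefficient, as a mere upper bound could not be compared with the given
   integral. *)
pose r' j := Num.sqrt (fine (\int[P]_w (fnorm (c j w) ^+ 2)%:E)%E).
have lcr j : (j < n)%N -> L2 (c j) (r' j).
  move=> jn; have [s [ms /l2P[mc' _ Ic _]]] := lc jn; split=> //; apply/l2P; split=> //.
    exact: sqrtr_ge0.
  rewrite sqr_sqrtr; last by apply: fine_ge0; apply: integral_ge0 => w _; rewrite lee_fin sqr_ge0.
  exact: lexx.
have lxi j : (j < n)%N -> L2 (xi j) (c_bm R m p * Num.sqrt (x j.+1 - x j) * r' j).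
  move=> jn; exact: (L2_bm_mul uc bm (xj0 j) (x_mono (leqnSn j) jn) (mc jn) (lcr j jn)).
have oxi j : (j < n)%N -> orth P (F (x j)) (xi j).
  by move=> jn; exact: (orth_bm uc bm (xj0 j) (x_mono (leqnSn j) jn) (mc jn) (lcr j jn)).
have mxi j : (j < n)%N -> rv_measurable (F (x j.+1)) (xi j).
  move=> jn; have xx := x_mono (leqnSn j) jn.
  apply: rvM; [exact: (filtration_sigma uc)|exact: (rv_mono uc (xj0 j) xx (mc jn))|].
  exact: (rv_increment uc bm (xj0 j) xx).
have := martingale_sum_L2 (fun j _ => filtration_sigma uc (xj0 j))
  (fun i j ij jn => filtration_mono uc (xj0 i) (x_mono ij jn)) mxi oxi lxi (leqnn n).
have cW0 : 0 <= c_bm R m p by rewrite /c_bm !mulr_ge0.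
move=> H; apply: L2_ext (L2_le _ H) => [w|]; first by rewrite sp_integral_increment.
have -> : \sum_(i < n) (c_bm R m p * Num.sqrt (x i.+1 - x i) * r' i) ^+ 2 =
    c_bm R m p ^+ 2 * \sum_(i < n) (x i.+1 - x i) * r' i ^+ 2.
  rewrite mulr_sumr; apply: eq_bigr => -[i iN] _ /=.
  have d0 : 0 <= x i.+1 - x i by rewrite subr_ge0 x_mono.
  by rewrite 2!exprMn (sqr_sqrtr d0) mulrA.
rewrite sqrtrM ?sqr_ge0// sqrtr_sqr ger0_norm// ler_wpM2l//.
rewrite -[leRHS]ger0_norm// -sqrtr_sqr; apply: ler_wsqrtr.
rewrite -lee_fin; apply: le_trans Iq.
have mcm j : (j < n)%N -> measurable_fun setT (fun w => (fnorm (c j w) ^+ 2)%:E).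
  by move=> jn; have [_ [mc' _ _]] := lcr j jn; apply/measurable_EFinP/rmeas_measurable; exact: rmeasX.
under eq_integral => w _.
  have mf : measurable_fun [set: measurableTypeR R]
      (fun s => ((fnorm (sp_eval S s w - B w) ^+ 2)%:E)).
    apply/measurable_EFinP/rmeas_measurable; apply: rmeasX => //; apply: rmeas_fnorm => //.
    apply: rvB => //; last exact: rv_cst.
    apply: rv_sum => // j; apply: rvZ => //; last exact: rv_cst.
    apply: (@rmeas_ext _ _ _ _ (\1_(`]tau j, tau j.+1]%classic : set R))).
      by move=> s; rewrite indicE mem_setE in_itv.
    by apply/rmeas_measurable; exact: measurable_indic.
  rewrite -{1}x0 -{1}xn (integral_itv_chain mf); first last.
  - by move=> j jn; exact: x_mono.
  - by move=> s; rewrite lee_fin sqr_ge0.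
  rewrite (eq_bigr (fun j : 'I_n => ((x j.+1 - x j) * fnorm (c j w) ^+ 2)%:E)); last first.
    move=> -[j jn] _ /=.
    have [xx|xx] := ltP (x j) (x j.+1); last first.
      have -> : x j.+1 = x j by apply/le_anti; rewrite xx x_mono.
      by rewrite set_itvoc0 integral_set0 subrr mul0r.
    rewrite (eq_integral (fun=> (fnorm (c j w) ^+ 2)%:E)); last first.
      move=> s; rewrite inE/= in_itv/= => /andP[s1 s2].
      rewrite /c xx (@sp_evalE j)//; apply/andP; split.
        move: s1; rewrite /x gt_max gt_min => /andP[_ /orP[//|t's]].
        by move: (lt_le_trans t's (le_trans s2 (x_le _))); rewrite ltxx.
      move: s2; rewrite /x le_max => /orP[st|]; last by rewrite le_min => /andP[].
      by move: (lt_le_trans s1 (le_trans st (x_ge j))); rewrite ltxx.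
    rewrite integral_cst//= lebesgue_measure_itv/= lte_fin xx -EFinD -EFinM.
    by rewrite mulrC.
  over.
rewrite /= ge0_integral_sum//; first last.
- by move=> j w _; rewrite lee_fin mulr_ge0 ?sqr_ge0// subr_ge0 x_mono.
- move=> j; under eq_fun do rewrite EFinM.
  by apply: emeasurable_funM => //; exact: mcm.
rewrite -sumEFin; apply: lee_sum => -[j jn] _ /=.
under eq_integral do rewrite EFinM.
rewrite ge0_integralZl//; first last.
- by rewrite lee_fin subr_ge0 x_mono.
- by move=> w _; rewrite lee_fin sqr_ge0.
- exact: mcm.
rewrite EFinM lee_wpmul2l// ?lee_fin ?subr_ge0 ?x_mono//.
have [_ /l2P[_ _ Ic _]] := lcr j jn.
rewrite sqr_sqrtr; last by apply: fine_ge0; apply: integral_ge0 => w _; rewrite lee_fin sqr_ge0.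
by rewrite fineK//; exact: integrable_fin_num Ic.
Qed.

End Interval.
End OneSimpleProcess.
End SimpleProcesses.

(** * Passage from simple processes to the Ito integral *)

Section ItoIntegral.
Variables (R : realType) (dO : measure_display) (Omega : measurableType dO).
Variables (P : probability Omega R) (F : R -> set (set Omega)) (m : nat).
Variable W : R -> Omega -> 'cV[R]_m.
Hypotheses (uc : usual_conditions P F) (bm : brownian_motion P F W).
Local Notation mO := (@measurable dO Omega).
Local Notation l2 := (l2 P).
Local Notation L2 := (L2 P).
Variables (T : R) (p : nat).
Variables (H : R -> Omega -> 'M[R]_(p, m)) (M : R -> Omega -> 'cV[R]_p).
Hypotheses (T0 : 0 <= T) (ito : ito_integral P F T W H M).
Local Notation mu := (@lebesgue_measure R).
Let Z := (measurableTypeR R * Omega)%type.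
Local Notation mZ := (@measurable _ Z).

Lemma sp_integral_meas (S : simple_process R Omega p m) t : simple_process_wf F T S -> 0 <= t ->
  rv_measurable mO (sp_integral S W t).
Proof.
move=> wf t0; have mW s : 0 <= s -> rv_measurable mO (W s).
  by move=> s0; apply: (rv_filtration uc s0); exact: bm_adapted bm _ s0.
rewrite (_ : sp_integral S W t = fun w => \sum_(j < sp_size S) sp_coef S j w *m
    (W (Num.min (sp_time S j.+1) t) w - W (Num.min (sp_time S j) t) w))//.
suff H1 (s : seq 'I_(sp_size S)) : rv_measurable mO (fun w => \sum_(j <- s) sp_coef S j w *m
    (W (Num.min (sp_time S j.+1) t) w - W (Num.min (sp_time S j) t) w)) by exact: H1.
apply: rv_sum => // -[j jn]; apply: rvM => //; first exact: (sp_coef_meas uc wf).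
by apply: rvB => //; apply: mW; rewrite le_min t0 (sp_time_ge0 wf)// ltnW.
Qed.

Lemma ito_meas t : 0 <= t <= T -> rv_measurable mO (M t).
Proof.
move=> /andP[t0 tT]; apply: (rv_filtration uc t0); apply: (ito_adapted ito).
by rewrite t0.
Qed.

Definition ito_error S := (\int[P]_w \int[mu]_(t in `[0%R, T])
   ((fnorm (H t w - sp_eval S t w) ^+ 2)%R)%:E)%E.

(** The convergence of the integrands and those of the integrals at the two times hold along one
    sequence, so a single index serves all three. *)
Lemma ito_approximation t1 t2 e : 0 <= t1 <= T -> 0 <= t2 <= T -> 0 < e ->
  exists S, [/\ simple_process_wf F T S, (ito_error S <= (e ^+ 2)%:E)%E,
    L2 (fun w => M t1 w - sp_integral S W t1 w) e &
    L2 (fun w => M t2 w - sp_integral S W t2 w) e].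
Proof.
move=> t1T t2T e0; have [S [wf cH cM]] := ito_limit ito.
have e2 : 0 < e ^+ 2 by rewrite exprn_gt0.
have [n [H1 [H2 H3]]] := @filter_ex _ (nbhs \oo) _ _ (filterI (cvge0_le e2 cH)
  (filterI (cvge0_le e2 (cM _ t1T)) (cvge0_le e2 (cM _ t2T)))); exists (S n).
have L t : 0 <= t <= T ->
    ('E_P[fun w => (enorm (M t w - sp_integral (S n) W t w) ^+ 2)%R] <= (e ^+ 2)%:E)%E ->
    L2 (fun w => M t w - sp_integral (S n) W t w) e.
  move=> tT; rewrite unlock => E.
  have mX : rv_measurable mO (fun w => M t w - sp_integral (S n) W t w).
    apply: rvB => //; first exact: ito_meas.
    by apply: (sp_integral_meas (wf n)); case/andP: tT.
  split=> //; split; [exact: rmeas_fnorm|exact: ltW|].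
  by under eq_integral do rewrite -enormE.
by split=> //; exact: L.
Qed.

Let rv_snd q r (f : Omega -> 'M[R]_(q, r)) :
  rv_measurable mO f -> rv_measurable mZ (fun z => f z.2).
Proof.
move=> mf i j; have /rmeas_measurable mfij := mf i j.
apply/rmeas_measurable; apply: (measurableT_comp mfij).
exact: measurable_snd.
Qed.

Let ind (t t' s : R) : R := (t < s <= t')%R%:R.

Let rmeas_ind t t' : rmeas (@measurable _ (measurableTypeR R)) (ind t t').
Proof.
apply: (@rmeas_ext _ _ _ _ (\1_(`]t, t']%classic : set R))).
  by move=> s; rewrite indicE mem_setE in_itv.
by apply/rmeas_measurable; exact: measurable_indic.
Qed.

Let rmeas_ind1 t t' : rmeas mZ (fun z => ind t t' z.1).
Proof.
have /rmeas_measurable mi := rmeas_ind t t'.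
by apply/rmeas_measurable; apply: (measurableT_comp mi); exact: measurable_fst.
Qed.

Let rv_sp_eval (S : simple_process R Omega p m) : simple_process_wf F T S ->
  rv_measurable mZ (fun z => sp_eval S z.1 z.2).
Proof.
move=> wf; rewrite /sp_eval; apply: rv_sum => // -[j jn]; apply: rvZ => //=.
  exact: rmeas_ind1.
by apply: rv_snd; exact: (sp_coef_meas uc wf).
Qed.

(* [H] is only jointly measurable off the null set [N]; [Hb] agrees with it
   there and is jointly measurable everywhere. *)
Variable N : set Omega.
Hypotheses (mN : measurable N) (PN : P N = 0%E).
Hypothesis mH : forall i j, measurable_fun (`[0, T] `*` ~` N)
      (fun z : R * Omega => H z.1 z.2 i j).

Let D : set Z := `[0, T] `*` ~` N.

Let Hb (z : Z) : 'M[R]_(p, m) :=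
  \matrix_(i, j) ((fun z : Z => H z.1 z.2 i j) \_ D) z.

Let mD : measurable D.
Proof. by apply: measurableX => //; exact: measurableC. Qed.

Let mHb : rv_measurable mZ Hb.
Proof.
move=> i j; apply: (@rmeas_ext _ _ _ _ ((fun z : Z => H z.1 z.2 i j) \_ D)).
  by move=> z; rewrite mxE.
apply/rmeas_measurable; apply/(measurable_restrictT _ mD).
exact: mH.
Qed.

Let HbE s w : 0 <= s <= T -> ~ N w -> Hb (s, w) = H s w.
Proof.
move=> sT Nw; apply/matrixP => i j; by rewrite mxE patchE mem_set.
Qed.

(** Squared norm on a time window, written with an indicator on the whole product space so that
    Tonelli's theorem applies in either order. *)
Let J q r (X : Z -> 'M[R]_(q, r)) (t t' : R) : \bar R :=
  (\int[mu \x P]_z (ind t t' z.1 * fnorm (X z) ^+ 2)%:E)%E.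

Let sqm q r (X : Z -> 'M[R]_(q, r)) t t' : rv_measurable mZ X ->
  measurable_fun setT (fun z => (ind t t' z.1 * fnorm (X z) ^+ 2)%:E).
Proof.
move=> mX; apply/measurable_EFinP/rmeas_measurable; apply: rmeasM => //.
  exact: rmeas_ind1.
by apply: rmeasX => //; exact: rmeas_fnorm.
Qed.

Let sq0 q r (X : Z -> 'M[R]_(q, r)) t t' z : (0 <= (ind t t' z.1 * fnorm (X z) ^+ 2)%:E)%E.
Proof. by rewrite lee_fin mulr_ge0 ?sqr_ge0// /ind; case: (_ && _). Qed.

Let J_time q r (X : Z -> 'M[R]_(q, r)) t t' : rv_measurable mZ X ->
  J X t t' =
  (\int[P]_w \int[mu]_(s in `]t, t']) (fnorm (X (s, w)) ^+ 2)%:E)%E.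
Proof.
move=> mX; rewrite /J fubini_tonelli2; [|exact: sqm|exact: sq0]; rewrite /fubini_G.
apply: eq_integral => w _; rewrite [RHS]integral_mkcond.
apply: eq_integral => s _; rewrite patchE mem_setE in_itv/= /ind.
by case: (_ && _); rewrite ?mul1r ?mul0r.
Qed.

Let m_section q r (X : Z -> 'M[R]_(q, r)) w : rv_measurable mZ X ->
  measurable_fun [set: measurableTypeR R] (fun s => (fnorm (X (s, w)) ^+ 2)%:E).
Proof.
move=> mX; have : measurable_fun [set: Z] (fun z => (fnorm (X z) ^+ 2)%:E).
  apply/measurable_EFinP/rmeas_measurable; apply: rmeasX => //; exact: rmeas_fnorm.
by move=> /measurableT_comp; apply; exact: pair2_measurable.
Qed.

Let m_time q r (X : Z -> 'M[R]_(q, r)) t t' : rv_measurable mZ X ->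
  measurable_fun [set: Omega] (fun w => \int[mu]_(s in `]t, t']) (fnorm (X (s, w)) ^+ 2)%:E)%E.
Proof.
move=> mX; have := @measurable_fun_fubini_tonelli_G _ _ _ _ R mu _ (sqm t t' mX) (sq0 X t t').
congr (measurable_fun _ _); apply/funext => w; rewrite /fubini_G [RHS]integral_mkcond.
apply: eq_integral => s _; rewrite patchE mem_setE in_itv/= /ind.
by case: (_ && _); rewrite ?mul1r ?mul0r.
Qed.

Let rv_error S : simple_process_wf F T S ->
  rv_measurable mZ (fun z => Hb z - sp_eval S z.1 z.2).
Proof. by move=> wf; apply: rvB => //; exact: rv_sp_eval. Qed.

(** Off the null set the inner time integrals for [H] and [Hb] coincide, the left end point being
    negligible; completeness of [P] then gives measurability of the inner integral for [H]. *)
Lemma ito_errorE S : simple_process_wf F T S ->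
  J (fun z => Hb z - sp_eval S z.1 z.2) 0 T = ito_error S.
Proof.
move=> wf; have mX := rv_error wf.
rewrite (@J_time _ _ (fun z => Hb z - sp_eval S z.1 z.2) _ _ mX).
pose g w := (\int[mu]_(s in `]0%R, T]) (fnorm (Hb (s, w) - sp_eval S s w) ^+ 2)%:E)%E.
pose f w := (\int[mu]_(t in `[0%R, T]) ((fnorm (H t w - sp_eval S t w) ^+ 2)%R)%:E)%E.
have mg : measurable_fun setT g by exact: (m_time _ _ mX).
have gf : ae_eq P setT g f.
  exists N; split=> // w /= H1; apply: contrapT => Nw; apply: H1 => _.
  rewrite /g /f integral_itv_obnd_cbnd; last first.
    by apply: measurable_funTS; exact: (m_section w mX).
  by apply: eq_integral => s; rewrite inE/= in_itv/= => sT; rewrite HbE.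
have mf : measurable_fun setT f by apply: ae_measurable_fun gf mg; exact: uc_complete uc.
apply: ge0_ae_eq_integral => //.
- by move=> w _; apply: integral_ge0 => s _; rewrite lee_fin sqr_ge0.
- by move=> w _; apply: integral_ge0 => s _; rewrite lee_fin sqr_ge0.
Qed.

Let J_split q r (X Y : Z -> 'M[R]_(q, r)) t t' :
  rv_measurable mZ X -> rv_measurable mZ Y -> 0 <= t -> t' <= T ->
  (J (fun z => X z + Y z)%R t t' <= 2%:E * J X 0%R T + 2%:E * J Y t t')%E.
Proof.
move=> mX mY t0 t'T; have mXY := rvD (sigma_algebra_measurable _) mX mY.
rewrite /J -!ge0_integralZl//; try exact: sqm; try exact: sq0.
have m2 (a b : R) (V : Z -> 'M[R]_(q, r)) : rv_measurable mZ V ->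
    measurable_fun setT (fun z => 2%:E * (ind a b z.1 * fnorm (V z) ^+ 2)%:E)%E.
  by move=> mV; apply: emeasurable_funM => //; exact: sqm.
rewrite -ge0_integralD//; first last.
- exact: m2.
- by move=> z _; rewrite mule_ge0// sq0.
- exact: m2.
- by move=> z _; rewrite mule_ge0// sq0.
apply: ge0_le_integral => //.
- by move=> z _; exact: (@sq0 _ _ (fun z => X z + Y z)).
- exact: (@sqm _ _ (fun z => X z + Y z)).
- by apply: emeasurable_funD; exact: m2.
move=> z _; rewrite -!EFinM -EFinD lee_fin.
have i1 : ind t t' z.1 <= ind 0 T z.1.
  rewrite /ind; case: (boolP (t < z.1 <= t')) => [/andP[h1 h2]|_]; last by case: (_ && _).
  by rewrite (le_lt_trans t0 h1) (le_trans h2 t'T).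
have i0 : 0 <= ind t t' z.1 by rewrite /ind; case: (_ && _).
have n1 := fnormD (X z) (Y z); have n2 := fnorm_ge0 (X z + Y z).
have n3 : fnorm (X z + Y z) ^+ 2 <= 2 * fnorm (X z) ^+ 2 + 2 * fnorm (Y z) ^+ 2.
  by have := sqr_ge0 (fnorm (X z) - fnorm (Y z)); nra.
have n4 : ind t t' z.1 * fnorm (X z) ^+ 2 <= ind 0 T z.1 * fnorm (X z) ^+ 2.
  by rewrite ler_wpM2r ?sqr_ge0.
have := ler_wpM2l i0 n3; lra.
Qed.

Let J_B (B : Omega -> 'M[R]_(p, m)) t t' := J (fun z => Hb z - B z.2) t t'.

Lemma sp_error_bound S t t' (B : Omega -> 'M[R]_(p, m)) : simple_process_wf F T S ->
  0 <= t -> t' <= T -> rv_measurable mO B ->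
  (\int[P]_w \int[mu]_(s in `]t, t']) ((fnorm (sp_eval S s w - B w) ^+ 2)%R)%:E <=
   2%:E * ito_error S + 2%:E * J_B B t t')%E.
Proof.
move=> wf t0 t'T mB; have mB2 := rv_snd mB; have mS := rv_sp_eval wf.
have mX : rv_measurable mZ (fun z => sp_eval S z.1 z.2 - Hb z) by exact: rvB.
have mY : rv_measurable mZ (fun z => Hb z - B z.2) by exact: rvB.
have mSB : rv_measurable mZ (fun z => sp_eval S z.1 z.2 - B z.2) by exact: rvB.
rewrite -ito_errorE//.
rewrite -(@J_time _ _ (fun z => sp_eval S z.1 z.2 - B z.2) _ _ mSB).
have := J_split mX mY t0 t'T.
have -> : J (fun z => sp_eval S z.1 z.2 - Hb z) 0 T = J (fun z => Hb z - sp_eval S z.1 z.2) 0 T.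
  by apply: eq_integral => z _; rewrite fnormBC.
by under [X in (J X _ _ <= _)%E -> _]eq_fun do rewrite subrKA.
Qed.

(** The estimate is carried over from simple processes with an error [e] that then tends to 0 by
    [L2_closed]. The factor 2 is the cost of [(x + y)^2 <= 2 x^2 + 2 y^2]. *)
Lemma ito_increment_L2 t t' (B : Omega -> 'M[R]_(p, m)) r Q : 0 <= t -> t <= t' -> t' <= T ->
  rv_measurable (F t) B -> L2 B r -> 0 <= Q -> (J_B B t t' <= (Q ^+ 2)%:E)%E ->
  L2 (fun w => M t' w - M t w - B w *m (W t' w - W t w)) (2 * c_bm R m p * Q).
Proof.
move=> t0 tt' t'T mB lB Q0 JQ.
have cW0 : 0 <= c_bm R m p by rewrite /c_bm !mulr_ge0.
apply: L2_closed => [|e e0]; first by rewrite !mulr_ge0.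
(* The slack consists of [e'] at each end point and of [2 e'] inside the isometry. *)
pose e' := e / (2 + 2 * c_bm R m p).
have d0 : 0 < 2 + 2 * c_bm R m p by lra.
have e'0 : 0 < e' by rewrite divr_gt0.
have tT : 0 <= t <= T by rewrite t0 (le_trans tt').
have t'T2 : 0 <= t' <= T by rewrite (le_trans t0).
have [S [wf eS l1 l2]] := ito_approximation t'T2 tT e'0.
have Sb := sp_error_bound wf t0 t'T (rv_filtration uc t0 mB).
have q0 : 0 <= 2 * e' + 2 * Q by lra.
have lD := L2_sp_increment uc bm wf t0 tt' t'T mB lB q0.
have {lD}lD : L2 (fun w => sp_integral S W t' w - sp_integral S W t w - B w *m (W t' w - W t w))
    (c_bm R m p * (2 * e' + 2 * Q)).
  apply: lD; apply: le_trans Sb _.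
  apply: (@le_trans _ _ (2%:E * (e' ^+ 2)%:E + 2%:E * (Q ^+ 2)%:E)%E).
    by apply: leeD; apply: lee_wpmul2l.
  by rewrite -!EFinM -EFinD lee_fin; nra.
have -> : 2 * c_bm R m p * Q + e = e' + e' + c_bm R m p * (2 * e' + 2 * Q).
  by rewrite /e'; field; rewrite gt_eqF.
apply: L2_ext (L2D (L2B l1 l2) lD) => w.
by apply/matrixP => i j; rewrite !mxE; ring.
Qed.

Lemma ito_increment_orth t t' : 0 <= t -> t <= t' -> t' <= T ->
  (exists r, L2 (fun w => M t' w - M t w) r) ->
  orth P (F t) (fun w => M t' w - M t w).
Proof.
move=> t0 tt' t'T [r lM] i X s mX lX; apply/eqP; rewrite -normr_le0.
apply/ler_addgt0Pr => e e0; rewrite add0r.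
have s0 := l2_ge0 lX.
pose e' := e / (2 * s + 1).
have d0 : 0 < 2 * s + 1 by lra.
have e'0 : 0 < e' by rewrite divr_gt0.
have tT : 0 <= t <= T by rewrite t0 (le_trans tt').
have t'T2 : 0 <= t' <= T by rewrite (le_trans t0).
have [S [wf _ l1 l2']] := ito_approximation t'T2 tT e'0.
have m0 : rv_measurable (F t) (fun=> 0 : 'M[R]_(p, m)).
  by apply: rv_cst; exact: (filtration_sigma uc).
have l0 : L2 (fun=> 0 : 'M[R]_(p, m)) 0.
  by apply: L2_le (L2_cst P _); rewrite fnorm0.
have oD := orth_sp_increment uc bm wf t0 tt' t'T m0 l0 i mX lX.
pose Dw w := sp_integral S W t' w - sp_integral S W t w - 0 *m (W t' w - W t w).
have lE : L2 (fun w => M t' w - M t w - Dw w) (e' + e').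
  apply: L2_ext (L2B l1 l2') => w; rewrite /Dw mul0mx subr0.
  by apply/matrixP => a b; rewrite !mxE; ring.
have lE' := L2_coord i 0 lE.
have lM' := L2_coord i 0 lM.
have lD' : l2 (fun w => Dw w i 0) (r + (e' + e')).
  by apply: l2_ext (l2D lM' (l2N lE')) => w; rewrite !mxE; ring.
have -> : Ex P (fun w => X w * (M t' w - M t w) i 0) =
    Ex P (fun w => X w * (M t' w - M t w - Dw w) i 0).
  rewrite -[RHS]addr0 -oD -ExD; [|exact: l2_integM lX lE'|exact: l2_integM lX lD'].
  by congr Ex; apply/funext => w; rewrite -mulrDr; congr (_ * _); rewrite !mxE; ring.
apply: le_trans (l2_cauchy_schwarz lX lE') _.
have -> : e = e' * (2 * s + 1) by rewrite /e' divfK// gt_eqF.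
by nra.
Qed.

Lemma ito_at0 : L2 (M 0) 0.
Proof.
apply: L2_closed => // e e0; rewrite add0r.
have tT : 0 <= (0 : R) <= T by rewrite lexx.
have [S [wf _ l1 _]] := ito_approximation tT tT e0.
by apply: L2_ext l1 => w; rewrite (sp_integral0 W wf) subr0.
Qed.

(** Tonelli with the expectation inside, so that a bound at each fixed time suffices. *)
Lemma J_B_bound t t' (B : Omega -> 'M[R]_(p, m)) q : 0 <= t -> t <= t' -> t' <= T ->
  rv_measurable mO B -> 0 <= q ->
  (forall s, t <= s <= t' -> L2 (fun w => H s w - B w) q) ->
  (J_B B t t' <= ((Num.sqrt (t' - t) * q) ^+ 2)%:E)%E.
Proof.
move=> t0 tt' t'T mB q0 lHB; have mB2 := rv_snd mB.
have mX : rv_measurable mZ (fun z => Hb z - B z.2) by exact: rvB.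
rewrite /J_B /J fubini_tonelli1; [|exact: sqm mX|exact: (@sq0 _ _ (fun z => Hb z - B z.2))]; rewrite /fubini_F/=.
apply: (@le_trans _ _ (\int[mu]_(s in `]t, t']) (q ^+ 2)%:E)%E); last first.
  rewrite integral_cst//= lebesgue_measure_itv/= lte_fin exprMn sqr_sqrtr ?subr_ge0//.
  have [tt|t't] := ltP t t'; first by rewrite -EFinD -EFinM mulrC.
  by rewrite mule0 lee_fin mulr_ge0 ?sqr_ge0 ?subr_ge0.
rewrite [leRHS]integral_mkcond; apply: ge0_le_integral => //.
- by move=> s _; apply: integral_ge0 => w _; exact: (@sq0 _ _ (fun z => Hb z - B z.2) t t' (s, w)).
- exact: (@measurable_fun_fubini_tonelli_F _ _ _ _ R P _ (sqm t t' mX) (@sq0 _ _ (fun z => Hb z - B z.2) t t')).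
- have mI : measurable (`]t, t']%classic : set (measurableTypeR R)) by exact: measurable_itv.
  by apply/(measurable_restrictT _ mI).
move=> s _; rewrite patchE mem_setE in_itv/= /ind.
case: ifPn => [/andP[s1 s2]|_]; last first.
  by under eq_integral do rewrite mul0r; rewrite integral0.
under eq_integral do rewrite mul1r.
have ts : t <= s <= t' by rewrite (ltW s1).
have [mHB [_ _ HB]] := lHB s ts.
have sT : 0 <= s <= T by rewrite (le_trans t0 (ltW s1)) (le_trans s2).
apply: le_trans HB; rewrite le_eqVlt; apply/orP; left; apply/eqP.
apply: ge0_ae_eq_integral => //.
- have : measurable_fun [set: Z] (fun z => (fnorm (Hb z - B z.2) ^+ 2)%:E).
    apply/measurable_EFinP/rmeas_measurable; apply: rmeasX => //; exact: rmeas_fnorm.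
  by move=> /measurableT_comp; apply; exact: pair1_measurable.
- by apply/measurable_EFinP/rmeas_measurable; apply: rmeasX => //; exact: rmeas_fnorm.
- by move=> w _; rewrite lee_fin sqr_ge0.
- by move=> w _; rewrite lee_fin sqr_ge0.
exists N; split=> // w /= H1; apply: contrapT => Nw; apply: H1 => _.
by rewrite HbE.
Qed.

(** Square integrability of [H] over time and probability follows from its being within distance 1
    of some simple process, which is bounded. *)
Lemma J_finite : exists2 Q : R, 0 <= Q & forall t t' : R, 0 <= t -> t' <= T ->
  (J_B (fun=> 0%R) t t' <= (Q ^+ 2)%:E)%E.
Proof.
have tT : 0 <= (0 : R) <= T by rewrite lexx.
have [S [wf eS _ _]] := ito_approximation tT tT ltr01.
have [K SK] := sp_bounded wf.
pose c := (sp_size S)%:R * `|K|.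
have c0 : 0 <= c by rewrite mulr_ge0.
have Sc s w : fnorm (sp_eval S s w) <= c.
  rewrite /sp_eval (le_trans (fnorm_sum _ _ _))//.
  have -> : c = \sum_(j < sp_size S) `|K| by rewrite sumr_const card_ord /c mulr_natl.
  apply: ler_sum => -[j jn] _ /=; rewrite fnormZ.
  have := le_trans (SK j w jn) (ler_norm K).
  by case: (_ && _); rewrite ?normr1 ?normr0 ?mul1r ?mul0r.
(* The bound [c] is viewed as a constant 1 by 1 matrix in order to be compared inside [J]. *)
have mK : rv_measurable mZ (fun=> c%:M : 'M[R]_1) by exact: rv_cst.
have mS := rv_sp_eval wf.
have mX := rv_error wf.
have JS : (J (fun z => sp_eval S z.1 z.2) 0%R T <= (c ^+ 2 * T)%:E)%E.
  apply: (@le_trans _ _ (J (fun=> c%:M : 'M[R]_1) 0%R T)).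
    apply: ge0_le_integral => //.
    - by move=> z _; exact: (@sq0 _ _ (fun z => sp_eval S z.1 z.2)).
    - exact: sqm mS.
    - exact: sqm mK.
    move=> z _; rewrite lee_fin; apply: ler_wpM2l; first by rewrite /ind; case: (_ && _).
    rewrite ler_pXn2r ?nnegrE ?fnorm_ge0// (le_trans (Sc _ _))//.
    apply: le_trans (coord_le_fnorm _ 0 0); rewrite mxE eqxx mulr1n; exact: ler_norm.
  rewrite (J_time 0 T mK).
  under eq_integral do rewrite integral_cst//=.
  rewrite integral_cst//= probability_setT mule1 lebesgue_measure_itv/= lte_fin.
  have -> : fnorm (c%:M : 'M[R]_1) ^+ 2 = c ^+ 2.
    by rewrite fnorm_sqr !big_ord1 mxE eqxx mulr1n.
  case: ltP => _; first by rewrite oppr0 adde0 -EFinM.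
  by rewrite mule0 lee_fin mulr_ge0 ?sqr_ge0.
pose Q2 := 2 * 1 + 2 * (c ^+ 2 * T).
have Q20 : 0 <= Q2 by rewrite addr_ge0 ?mulr_ge0 ?sqr_ge0.
exists (Num.sqrt Q2) => [|t t' t0 t'T]; first exact: sqrtr_ge0.
rewrite sqr_sqrtr//.
apply: (@le_trans _ _ (J (fun z => Hb z - sp_eval S z.1 z.2 + sp_eval S z.1 z.2)%R 0%R T)).
  rewrite /J_B; apply: ge0_le_integral => //.
  - by move=> z _; exact: (@sq0 _ _ (fun z => Hb z - 0)).
  - apply: (@sqm _ _ (fun z => Hb z - 0)); apply: rvB => //; exact: rv_cst.
  - by apply: (@sqm _ _ (fun z => Hb z - sp_eval S z.1 z.2 + sp_eval S z.1 z.2)); exact: rvD.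
  move=> z _; rewrite subrK subr0 lee_fin ler_wpM2r ?sqr_ge0//.
  rewrite /ind; case: (boolP (t < z.1 <= t')) => [/andP[h1 h2]|_]; last by case: (_ && _).
  by rewrite (le_lt_trans t0 h1) (le_trans h2 t'T).
apply: le_trans (J_split mX mS (lexx 0) (lexx T)) _.
have -> : (Q2%:E = 2%:E * 1%:E + 2%:E * (c ^+ 2 * T)%:E)%E by rewrite -!EFinM -EFinD.
rewrite (ito_errorE wf); apply: leeD; apply: lee_wpmul2l => //.
by rewrite (le_trans eS)// expr1n.
Qed.

End ItoIntegral.

Section ItoEstimates.
Variables (R : realType) (dO : measure_display) (Omega : measurableType dO).
Variables (P : probability Omega R) (F : R -> set (set Omega)) (m : nat).
Variable W : R -> Omega -> 'cV[R]_m.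
Hypotheses (uc : usual_conditions P F) (bm : brownian_motion P F W).
Variables (T : R) (p : nat).
Variables (H : R -> Omega -> 'M[R]_(p, m)) (M : R -> Omega -> 'cV[R]_p).
Hypotheses (T0 : 0 <= T) (ito : ito_integral P F T W H M).
Local Notation L2 := (L2 P).

(** With [B = 0] this bounds the increments of the integral; with [B] the diffusion coefficient of
    the scheme at [t] it is the local error of the noise term. *)
Lemma ito_increment_bound t t' (B : Omega -> 'M[R]_(p, m)) r q :
  0 <= t -> t <= t' -> t' <= T -> rv_measurable (F t) B -> L2 B r -> 0 <= q ->
  (forall s, t <= s <= t' -> L2 (fun w => H s w - B w) q) ->
  L2 (fun w => M t' w - M t w - B w *m (W t' w - W t w))
     (2 * c_bm R m p * (Num.sqrt (t' - t) * q)).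
Proof.
move=> t0 tt' t'T mB lB q0 lHB; have [N [mN PN] mH] := ito_integrand_measurable ito.
apply: (ito_increment_L2 uc bm ito mN PN mH t0 tt' t'T mB lB).
  by rewrite mulr_ge0 ?sqrtr_ge0.
apply: (J_B_bound mN PN mH t0 tt' t'T) => //.
exact: (rv_filtration uc t0 mB).
Qed.

(** [K] is not explicit. It only starts the bootstrap of the moment bound and allows orthogonality
    to be stated. *)
Lemma ito_increment_finite : exists K : R, forall t t', 0 <= t -> t <= t' -> t' <= T ->
  L2 (fun w => M t' w - M t w) K.
Proof.
have [N [mN PN] mH] := ito_integrand_measurable ito.
have [Q Q0 JQ] := J_finite uc bm T0 ito mN PN mH.
exists (2 * c_bm R m p * Q) => t t' t0 tt' t'T.
have m0 : rv_measurable (F t) (fun=> 0 : 'M[R]_(p, m)).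
  by apply: rv_cst; exact: (filtration_sigma uc).
have := ito_increment_L2 uc bm ito mN PN mH t0 tt' t'T m0 (L2_cst P 0) Q0 (JQ t t' t0 t'T).
by apply: L2_ext => w; rewrite mul0mx subr0.
Qed.

Lemma ito_orth t t' : 0 <= t -> t <= t' -> t' <= T ->
  orth P (F t) (fun w => M t' w - M t w).
Proof.
move=> t0 tt' t'T; apply: (ito_increment_orth uc bm ito t0 tt' t'T).
by have [K MK] := ito_increment_finite; exists K; exact: MK.
Qed.

End ItoEstimates.

(** * Absolutely continuous functions and pathwise integrals *)

Section Chains.
Variable R : realType.
Implicit Types (x y s : R) (Step : R -> R -> Prop).

Definition chain Step x y n (q : nat -> R) :=
  [/\ q 0%N = x, q n = y & forall j, (j < n)%N -> q j <= q j.+1 /\ Step (q j) (q j.+1)].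

Lemma chain_extend Step x s s' n q : chain Step x s n q -> s <= s' -> Step s s' ->
  exists n' q', chain Step x s' n' q'.
Proof.
move=> [q0 qn qS] ss' St; exists n.+1, (fun j => if (j <= n)%N then q j else s').
split; rewrite ?ltnn// => j; rewrite ltnS => jn; rewrite jn.
case: ltnP => [jn'|nj]; first exact: qS.
have -> : j = n by apply/eqP; rewrite eqn_leq jn nj.
by rewrite qn.
Qed.

Lemma chain_mono Step x y n q : chain Step x y n q ->
  forall i j, (i <= j)%N -> (j <= n)%N -> q i <= q j.
Proof.
move=> [_ _ qS] i; elim=> [|j IH]; first by rewrite leqn0 => /eqP ->.
rewrite leq_eqVlt => /predU1P[-> //|ij] jn.
exact: le_trans (IH ij (ltnW jn)) (qS j jn).1.
Qed.

Lemma chain_locate Step x y n q s : chain Step x y n q -> (0 < n)%N -> x <= s <= y ->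
  exists2 j, (j < n)%N & q j <= s <= q j.+1.
Proof.
move=> [<- <- _]; elim: n => // n IH _ /andP[s0 sn].
have [qs|sq] := leP (q n) s; first by exists n => //; rewrite qs.
case: n IH sq sn => [|n] IH sq sn; first by move: (le_lt_trans s0 sq); rewrite ltxx.
have [|j jn sj] := IH isT; first by rewrite s0 ltW.
by exists j => //; exact: ltnW.
Qed.

(* Cousin's lemma, by real induction on the right end point. *)
Lemma cousin Step x y : x <= y ->
  (forall c, x <= c <= y -> exists2 r : R, 0 < r & forall s s',
     x <= s -> c - r < s -> s <= c -> c <= s' -> s' < c + r -> Step s c /\ Step c s') ->
  exists n q, chain Step x y n q.
Proof.
move=> xy loc.
pose G := [set s | x <= s <= y /\ exists n q, chain Step x s n q].
have Gx : G x by split; [rewrite lexx|exists 0%N, (fun=> x); split].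
have ubG : ubound G y by move=> s [/andP[]].
have hsG : has_sup G by split; [exists x|exists y].
pose c := sup G.
have xc : x <= c by apply: ub_le_sup => //; exists y.
have cy : c <= y by apply: ge_sup => //; exists x.
have xcy : x <= c <= y by rewrite xc.
have [r r0 cr] := loc c xcy.
have [s [/andP[xs sy] [n [q ch]]] crs] := sup_adherent r0 hsG.
have sc : s <= c by apply: ub_le_sup; [exists y|split; [rewrite xs|exists n, q]].
have [S1 _] := cr s c xs crs sc (lexx c) (ltr_pwDr r0 (lexx c)).
have [n1 [q1 ch1]] := chain_extend ch sc S1.
pose s' := Num.min (c + r / 2) y.
have r2 : 0 < r / 2 by rewrite divr_gt0.
have cs' : c <= s' by rewrite le_min cy lerDl ltW.
have s'r : s' < c + r.
  by rewrite gt_min ltrD2l ltr_pdivrMr// mulr_natr mulr2n ltrDl r0.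
have crc : c - r < c by rewrite ltrBlDr ltrDl.
have [_ S2] := cr c s' xc crc (lexx c) cs' s'r.
have [n2 [q2 ch2]] := chain_extend ch1 cs' S2.
have s'y : s' <= y by rewrite ge_min lexx orbT.
have s'c : s' <= c.
  by apply: ub_le_sup; [exists y|split; [rewrite (le_trans xc)|exists n2, q2]].
exists n2, q2; suff -> : y = s' by [].
apply/le_anti; rewrite s'y andbT leNgt; apply/negP => s'lty.
by move: s'c s'lty; rewrite /s' ge_min gt_min ltxx orbF => /orP[h1|h1] h2; lra.
Qed.

End Chains.

(** * A mean value inequality for absolutely continuous functions *)

Section AbsolutelyContinuous.
Variable R : realType.
Notation mu := (@lebesgue_measure R).

Lemma derivable_secant (f : R -> R) (t c L e : R) : derivable f t 1 ->
  `|'D_1 f t - c| <= L -> 0 < e ->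
  exists2 r : R, 0 < r & forall s, `|s - t| < r ->
    `|f s - f t - c * (s - t)| <= (L + e) * `|s - t|.
Proof.
move=> df dL e0.
have /cvgrPdist_le /(_ e e0) [r r0 H] : (fun h : R => h^-1 *: (f (h *: 1 + t) - f t)) @ 0^' --> 'D_1 f t.
  exact: df.
exists r => // s str; have [->|st] := eqVneq s t.
  by rewrite !subrr mulr0 subrr normr0 mulr0.
have h0 : s - t != 0 by rewrite subr_eq0.
have /= := H (s - t); rewrite /ball_ sub0r normrN => /(_ str h0).
rewrite [_ *: 1]mulr1 subrK => H1.
have -> : f s - f t - c * (s - t) = (s - t) * ((s - t)^-1 * (f s - f t) - c) by field.
rewrite normrM mulrC ler_wpM2r//.
have -> : (s - t)^-1 * (f s - f t) - c = ('D_1 f t - c) - ('D_1 f t - (s - t)^-1 *: (f s - f t)).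
  by rewrite /GRing.scale/=; ring.
by rewrite (le_trans (ler_normB _ _))// lerD.
Qed.

Lemma chain_open_length (O : set R) x y n q (T : nat -> bool) : open O ->
  chain (fun _ _ => True) x y n q ->
  (forall j, (j < n)%N -> T j -> `[q j, q j.+1] `<=` O) ->
  ((\sum_(j < n) (if T j then q j.+1 - q j else 0))%:E <= mu O)%E.
Proof.
move=> oO ch TO; have mO : measurable O by exact: open_measurable.
have qq := chain_mono ch.
suff H k : (k <= n)%N ->
    ((\sum_(j < k) (if T j then q j.+1 - q j else 0))%:E <= mu (O `&` `]q 0%N, q k]))%E.
  by apply: le_trans (H n (leqnn n)) _; rewrite le_measure ?inE//; exact: measurableI.
elim: k => [|k IH] kn; first by rewrite big_ord0.
have -> : O `&` `]q 0%N, q k.+1] = (O `&` `]q 0%N, q k]) `|` (O `&` `]q k, q k.+1]).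
  rewrite -setIUr; congr (_ `&` _); apply/seteqP; split=> s /=; rewrite !in_itv/=.
    by move=> /andP[s1 s2]; have [sk|ks] := leP s (q k); [left|right]; rewrite ?s1 ?s2.
  case=> /andP[s1 s2]; first by rewrite s1 (le_trans s2)// qq.
  by rewrite s2 (le_lt_trans (qq 0%N k _ _) s1)// ltnW.
rewrite measureU//; first last.
- apply/seteqP; split=> // s /= [[_ ]]; rewrite !in_itv/= => /andP[_ s1] [_ /andP[s2 _]].
  by move: (le_lt_trans s1 s2); rewrite ltxx.
- exact: measurableI.
- exact: measurableI.
rewrite big_ord_recr/= EFinD; apply: leeD; first exact: IH (ltnW kn).
case: ifPn => Tk; last by rewrite measure_ge0.
have -> : O `&` `]q k, q k.+1] = `]q k, q k.+1]%classic.
  apply/seteqP; split=> s /=; first by case.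
  move=> sI; split=> //; apply: (TO k kn Tk) => /=.
  by move: sI; rewrite !in_itv/= => /andP[s1 ->]; rewrite ltW.
rewrite lebesgue_measure_itv/= lte_fin; case: ltP => [_|h]; first by rewrite -EFinD.
by rewrite lee_fin subr_le0.
Qed.

(** The exceptional null set is enclosed in an open set [V] of small measure. Cousin's lemma then
    yields a chain each of whose cells either satisfies the secant estimate or lies in [V]; the
    cells in [V] have small total length, so absolute continuity controls the variation over
    them. *)
Lemma ac_increment (f : R -> R) T x y c L : absolutely_continuous_on 0 T f ->
  0 <= x -> x <= y -> y <= T -> 0 <= L ->
  {ae mu, forall t, x <= t <= y -> derivable f t 1 /\ `|'D_1 f t - c| <= L} ->
  `|f y - f x - c * (y - x)| <= L * (y - x).
Proof.
move=> ac x0 xy yT L0 [A [mA A0 dA]]; apply/ler_addgt0Pr => e0 e00.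
(* One [e] times [y - x] for the secants, one for the variation over [V] and one for the linear term
   over [V]. *)
pose e := e0 / (y - x + 2).
have d0 : 0 < y - x + 2 by lra.
have e_gt0 : 0 < e by rewrite divr_gt0.
have [d dpos acd] := ac e e_gt0.
pose d' := Num.min d (e / (`|c| + 1)).
have c1 : 0 < `|c| + 1 by rewrite ltr_wpDl.
have d'0 : 0 < d' by rewrite lt_min dpos divr_gt0.
have A0y : (mu A < +oo)%E by rewrite A0.
have [V [oV AV VA]] := lebesgue_regularity_outer mA A0y d'0.
have Vd : (mu V < d'%:E)%E.
  have mO : measurable V by exact: open_measurable.
  have -> : V = A `|` (V `\` A) by rewrite setDUK.
  apply: le_lt_trans VA; rewrite (le_trans (measureU2 _ _ _))//; first exact: measurableD.
  by rewrite [X in (X + _)%E](_ : _ = 0%E) ?add0e//; exact: A0.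
pose Step u v := `[u, v] `<=` V \/ `|f v - f u - c * (v - u)| <= (L + e) * (v - u).
have [|n [q ch]] := @cousin R Step x y xy.
  move=> t /andP[xt ty]; have [Vt|Vt] := pselect (V t).
    have [r /= r0 rV] := oV t Vt; exists r => // s s' xs rs st ts' s'r.
    by split; left => z /=; rewrite in_itv/= => /andP[z1 z2]; apply: rV;
      rewrite /= ltr_norml; apply/andP; split; lra.
  have [dt Dt] : derivable f t 1 /\ `|'D_1 f t - c| <= L.
    apply: contrapT => nd; apply: Vt; apply: AV; apply: dA => /= H; apply: nd.
    by apply: H; rewrite xt.
  have [r r0 H] := derivable_secant dt Dt e_gt0; exists r => // s s' xs rs st ts' s'r.
  split; right.
    have /H : `|s - t| < r by rewrite ltr_norml; apply/andP; split; lra.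
    rewrite -normrN => H1; apply: le_trans (_ : _ <= (L + e) * `|s - t|) _.
      by apply: le_trans H1; rewrite le_eqVlt; apply/orP; left; apply/eqP; congr `|_|; ring.
    by rewrite ler0_norm ?subr_le0// opprB.
  have /H : `|s' - t| < r by rewrite ltr_norml; apply/andP; split; lra.
  by move=> H1; apply: le_trans H1 _; rewrite ger0_norm ?subr_ge0.
have qq := chain_mono ch; case: (ch) => q0 qn qS.
pose B j := `[< `[q j, q j.+1] `<=` V >].
(* Cells outside [V] are collapsed to a point, which keeps the indexing while restricting the family
   to the cells in [V]. *)
pose v j := if B j then q j.+1 else q j.
have len : \sum_(j < n) (v j - q j) < d'.
  rewrite -lte_fin; apply: le_lt_trans Vd.
  have := @chain_open_length V x y n q B oV _ _.
  rewrite (eq_bigr (fun j : 'I_n => v j - q j)); last first.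
    by move=> j _; rewrite /v; case: ifP => _; rewrite ?subrr.
  apply; first by split=> // j jn; split=> //; exact: (qS j jn).1.
  by move=> j jn /asboolP.
have qx j : (j <= n)%N -> x <= q j by move=> jn; rewrite -q0 qq.
have qy j : (j <= n)%N -> q j <= y by move=> jn; rewrite -qn qq.
have var : \sum_(j < n) `|f (v j) - f (q j)| < e.
  apply: acd.
  - move=> j jn; have := qx j (ltnW jn); have := qy j.+1 jn; have := qy j (ltnW jn).
    by have := (qS j jn).1; rewrite /v; case: ifP => _ *; split; lra.
  - move=> j jn; rewrite /v; case: ifP => _ //; exact: (qS j (ltnW jn)).1.
  - by apply: lt_le_trans len _; rewrite ge_min lexx.
have -> : f y - f x - c * (y - x) = \sum_(j < n) (f (q j.+1) - f (q j) - c * (q j.+1 - q j)).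
  rewrite sumrB -mulr_sumr.
  rewrite -(big_mkord xpredT (fun j => f (q j.+1) - f (q j))) telescope_sumr//.
  by rewrite -(big_mkord xpredT (fun j => q j.+1 - q j)) telescope_sumr// q0 qn.
rewrite (le_trans (ler_norm_sum _ _ _))//.
have step (j : 'I_n) : `|f (q j.+1) - f (q j) - c * (q j.+1 - q j)| <=
    (L + e) * (q j.+1 - q j) + (`|f (v j) - f (q j)| + `|c| * (v j - q j)).
  have [qj sj] := qS j (ltn_ord j).
  have Le : 0 <= (L + e) * (q j.+1 - q j) by rewrite mulr_ge0 ?subr_ge0// addr_ge0// ltW.
  rewrite /v /B; case: asboolP => Bj.
    rewrite (le_trans (ler_normB _ _))// normrM [`|q j.+1 - q j|]ger0_norm ?subr_ge0//.
    by rewrite lerDr.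
  case: sj => // H; rewrite (le_trans H)// lerDl addr_ge0// mulr_ge0//.
  by rewrite subrr.
rewrite (le_trans (ler_sum _ (fun j _ => step j)))// !big_split/= -!mulr_sumr.
have -> : \sum_(j < n) (q j.+1 - q j) = y - x.
  by rewrite -(big_mkord xpredT (fun j => q j.+1 - q j)) telescope_sumr// q0 qn.
have cd : `|c| * (\sum_(j < n) (v j - q j)) <= e.
  have : \sum_(j < n) (v j - q j) <= e / (`|c| + 1).
    by apply: le_trans (ltW len) _; rewrite ge_min lexx orbT.
  set s := \sum_(j < n) _ => se.
  have s0 : 0 <= s.
    apply: sumr_ge0 => j _; rewrite /v; case: ifP => _; rewrite ?subrr// subr_ge0.
    exact: (qS j (ltn_ord j)).1.
  by move: se; rewrite ler_pdivlMr// => se; nra.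
have -> : e0 = e * (y - x + 2) by rewrite /e divfK// gt_eqF.
lra.
Qed.

End AbsolutelyContinuous.

(** * Riemann sums of continuous functions *)

Section RiemannSums.
Variable R : realType.
Notation mu := (@lebesgue_measure R).
Variables (t t' : R) (f : R -> R).
Hypotheses (tt' : t <= t') (cf : {within `[t, t'], continuous f}).

Lemma continuous_integrable_itv s s' : t <= s -> s' <= t' ->
  mu.-integrable `[s, s'] (EFin \o f).
Proof.
move=> ts s't; apply: continuous_compact_integrable; first exact: segment_compact.
apply: continuous_subspaceW cf => z /=; rewrite !in_itv/= => /andP[z1 z2].
by rewrite (le_trans ts)// (le_trans z2).
Qed.

(** Heine's theorem from Cousin's lemma: every cell of the chain comes with a neighbourhood on which
    [f] oscillates by at most [e], and the smallest of the finitely many radii works. *)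
Lemma itv_uniformly_continuous e : 0 < e -> exists2 d : R, 0 < d &
  forall s s' : R, t <= s <= t' -> t <= s' <= t' -> `|s - s'| < d -> `|f s - f s'| <= e.
Proof.
move=> e0; have e2 : 0 < e / 2 by rewrite divr_gt0.
pose Step (u v : R) := exists2 r : R, 0 < r & forall s s' : R,
   u - r < s < v + r -> u - r < s' < v + r -> t <= s <= t' -> t <= s' <= t' ->
   `|f s - f s'| <= e.
have [|n [q ch]] := @cousin R Step t t' tt'.
  move=> c ctt; have ctt' : `[t, t']%classic c by rewrite /= in_itv.
  have /subspace_continuousP/(_ c ctt')/cvgrPdist_le/(_ _ e2) := cf.
  rewrite near_withinE => -[r /= r0 H].
  have Hr s : c - r < s < c + r -> t <= s <= t' -> `|f c - f s| <= e / 2.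
    move=> /andP[s1 s2] st; apply: H; last by rewrite /= in_itv.
    by rewrite /= ltr_norml; apply/andP; split; lra.
  have Hrr s s' : c - r < s < c + r -> t <= s <= t' -> c - r < s' < c + r ->
      t <= s' <= t' -> `|f s - f s'| <= e.
    move=> sr st s'r s't; have -> : f s - f s' = (f c - f s') - (f c - f s) by ring.
    by rewrite (le_trans (ler_normB _ _))// [e]splitr lerD// Hr.
  exists (r / 2); first by rewrite divr_gt0.
  move=> u u' tu ru uc cu u'r.
  by split; exists (r / 2); rewrite ?divr_gt0// => s s' /andP[s1 s2] /andP[s3 s4] st s't;
    apply: Hrr => //; apply/andP; split; lra.
have [q0 qn qS] := ch.
have [d d0 H] : exists2 d : R, 0 < d & forall j (s s' : R), (j < n)%N -> q j <= s <= q j.+1 ->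
    t <= s <= t' -> t <= s' <= t' -> `|s - s'| < d -> `|f s - f s'| <= e.
  elim: {-2}n (leqnn n) => [|k IH] kn; first by exists 1.
  have [d d0 dH] := IH (ltnW kn); have [_ [r r0 rH]] := qS k kn.
  exists (Num.min d r); first by rewrite lt_min d0.
  move=> j s s'; rewrite ltnS leq_eqVlt lt_min => /predU1P[->|jk] sj st s't /andP[sd sr]; last exact: (dH j s s').
  move: sr sj; rewrite ltr_norml => /andP[h1 h2] /andP[h3 h4].
  by apply: rH => //; apply/andP; split; lra.
exists d => // s s' st s't ss'.
have [n0|n0] := posnP n; last by have [j jn sj] := chain_locate ch n0 st; exact: (H j).
have tt : t = t' by rewrite -q0 -qn n0.
move: st s't; rewrite -tt => /le_anti <- /le_anti <-.
by rewrite subrr normr0 ltW.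
Qed.

Lemma Rintegral_oc s s' : t <= s -> s <= s' -> s' <= t' ->
  \int[mu]_(z in `[t, s']) f z - \int[mu]_(z in `[t, s]) f z = \int[mu]_(z in `]s, s']) f z.
Proof.
move=> ts ss' s't; apply: Rintegral_itvB; rewrite ?bnd_simp//.
exact: continuous_integrable_itv.
Qed.

Lemma Rintegral_left_point e s s' : 0 <= e -> t <= s -> s <= s' -> s' <= t' ->
  (forall z, s <= z <= s' -> `|f z - f s| <= e) ->
  `|\int[mu]_(z in `]s, s']) f z - (s' - s) * f s| <= e * (s' - s).
Proof.
move=> e0 ts ss' s't fe.
have I1 : mu.-integrable `]s, s'] (EFin \o f).
  apply: integrableS (continuous_integrable_itv ts s't) => //.
  by apply: subset_itvr; rewrite bnd_simp.
have muE : fine (mu `]s, s']) = s' - s.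
  rewrite lebesgue_measure_itv/= lte_fin; case: ltP => // h.
  by apply/eqP; rewrite eq_sym subr_eq0; apply/eqP/le_anti; rewrite h.
have mI : measurable (`]s, s']%classic : set (measurableTypeR R)) by exact: measurable_itv.
have Ic (c : R) : mu.-integrable `]s, s'] (EFin \o cst c).
  apply/integrableP; split; first by apply/measurable_EFinP; exact: measurable_cst.
  rewrite (_ : (fun x => _) = cst (`|c|%:E)); last by apply/funext.
  rewrite integral_cst//= lebesgue_measure_itv/=; case: ifP => _; rewrite ?mule0//.
  by rewrite -EFinD -EFinM ltry.
have -> : (s' - s) * f s = \int[mu]_(z in `]s, s']) (cst (f s) z).
  by rewrite Rintegral_cst// muE mulrC.
rewrite -(RintegralB _ I1 (Ic (f s)))//.
have IB : mu.-integrable `]s, s'] (EFin \o (fun z => f z - cst (f s) z)).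
  exact: (integrableB mI I1 (Ic (f s))).
rewrite (le_trans (le_normr_Rintegral _ IB))//.
rewrite -muE -(Rintegral_cst _ mI e).
apply: le_Rintegral => //; [exact: integrable_abse IB|exact: Ic|].
by move=> z; rewrite /= in_itv/= => /andP[z1 z2]; apply: fe; rewrite ltW.
Qed.

(** Left end points, with [n.+1] cells so that the mesh is defined for every [n]. *)
Definition riemann_sum n :=
  \sum_(j < n.+1) ((t' - t) / n.+1%:R) * f (t + j%:R * ((t' - t) / n.+1%:R)).

Lemma riemann_sum_cvg : riemann_sum @ \oo --> \int[mu]_(z in `[t, t']) f z.
Proof.
apply/cvgrPdist_le => e e0; pose h := t' - t.
have h0 : 0 <= h by rewrite subr_ge0.
pose e' := e / (h + 1); have h1 : 0 < h + 1 by rewrite ltr_wpDl.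
have e'0 : 0 < e' by rewrite divr_gt0.
have [d d0 dH] := itv_uniformly_continuous e'0.
near=> n; pose g := h / n.+1%:R; pose q j := t + j%:R * g.
have g0 : 0 <= g by rewrite divr_ge0.
have gd : g < d.
  rewrite /g ltr_pdivrMr// mulrC -ltr_pdivrMr//.
  apply: (@lt_trans _ _ n%:R); last by rewrite ltr_nat.
  by near: n; exact: nbhs_infty_gtr.
have qS j : q j.+1 = q j + g by rewrite /q -natr1 mulrDl mul1r addrA.
have qn : q n.+1 = t' by rewrite /q /g mulrC divfK ?pnatr_eq0// /h; ring.
have qt j : t <= q j by rewrite lerDl mulr_ge0.
have qt' j : (j <= n.+1)%N -> q j <= t' by move=> jn; rewrite -qn lerD2l ler_wpM2r// ler_nat.
have qq j : q j <= q j.+1 by rewrite qS lerDl.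
pose FF s := \int[mu]_(z in `[t, s]) f z.
have -> : \int[mu]_(z in `[t, t']) f z = \sum_(j < n.+1) (FF (q j.+1) - FF (q j)).
  rewrite -(big_mkord xpredT (fun j => FF (q j.+1) - FF (q j))) telescope_sumr// qn.
  have -> : FF (q 0) = 0 by rewrite /FF /q mul0r addr0 set_itv1 Rintegral_set1.
  by rewrite subr0.
rewrite /riemann_sum -sumrB (le_trans (ler_norm_sum _ _ _))//.
apply: (@le_trans _ _ (\sum_(j < n.+1) e' * g)).
  apply: ler_sum => -[j jn] _ /=; rewrite -/h -/g -/(q j).
  rewrite Rintegral_oc//; last exact: qt'.
  have -> : g = q j.+1 - q j by rewrite qS addrC addKr.
  apply: Rintegral_left_point => //; [exact: ltW|exact: qt'|move=> z /andP[z1 z2]].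
  have zt : t <= z <= t' by rewrite (le_trans (qt j))// (le_trans z2)// qt'.
  have qjt : t <= q j <= t' by rewrite qt qt'// ltnW.
  apply: dH => //; rewrite ger0_norm ?subr_ge0//; move: z2; rewrite qS; lra.
rewrite sumr_const card_ord -mulr_natl mulrCA /g [_ * (h / _)]mulrC divfK ?pnatr_eq0//.
have -> : e = e' * (h + 1) by rewrite /e' divfK// gt_eqF.
by apply: ler_wpM2l; [exact: ltW|rewrite lerDl].
Unshelve. all: by end_near. Qed.

End RiemannSums.

Section TimeIntegrals.
Variables (R : realType) (dO : measure_display) (Omega : measurableType dO).
Variable P : probability Omega R.
Notation mu := (@lebesgue_measure R).
Local Notation mO := (@measurable dO Omega).

(* Riemann sums and Fatou's lemma replace Fubini's theorem here, so that no
   joint measurability of [f] is needed. *)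
Lemma l2_time_integral (t t' : R) (f : R -> Omega -> R) (z z0 : Omega -> R) c r0 r :
  t <= t' -> 0 <= c -> rmeas mO z -> l2 P z0 r0 ->
  (forall s, t <= s <= t' -> l2 P (f s) r) ->
  {ae P, forall w, {within `[t, t'], continuous (f^~ w)} /\
     `|z w| <= `|z0 w| + c * `|\int[mu]_(s in `[t, t']) f s w| } ->
  l2 P z (r0 + c * ((t' - t) * r)).
Proof.
move=> tt' c0 mz lz0 lf zf; have h0 : 0 <= t' - t by rewrite subr_ge0.
have r_ge0 : 0 <= r by apply: (l2_ge0 (lf t _)); rewrite lexx.
have r00 := l2_ge0 lz0.
pose Rn n w := riemann_sum t t' (f^~ w) n.
have lR n : l2 P (Rn n) ((t' - t) * r).
  have -> : (t' - t) * r = \sum_(j < n.+1) (`|(t' - t) / n.+1%:R| * r).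
    rewrite -mulr_suml sumr_const card_ord ger0_norm ?divr_ge0// -[_ *+ _]mulr_natr.
    by rewrite divfK ?pnatr_eq0.
  apply: l2_sum => -[j jn] /=; apply: l2Z; apply: lf.
  have g0 : 0 <= (t' - t) / n.+1%:R by rewrite divr_ge0.
  rewrite lerDl mulr_ge0//=.
  have : j%:R * ((t' - t) / n.+1%:R) <= n.+1%:R * ((t' - t) / n.+1%:R).
    by rewrite ler_wpM2r// ler_nat ltnW.
  have -> : n.+1%:R * ((t' - t) / n.+1%:R) = t' - t by rewrite mulrC divfK ?pnatr_eq0.
  by rewrite lerBrDl.
pose u n w := `|z0 w| + c * `|Rn n w|.
pose rho := r0 + c * ((t' - t) * r).
have rho0 : 0 <= rho by rewrite addr_ge0// !mulr_ge0.
have lu n : l2 P (u n) rho.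
  by apply: l2D; [exact: l2_norm|rewrite -{2}(ger0_norm c0); apply: l2Z; exact: l2_norm].
split=> //.
have mu2 n : measurable_fun setT (fun w => ((u n w) ^+ 2)%:E).
  by apply/measurable_EFinP/rmeas_measurable; apply: rmeasX => //; case: (lu n).
have uge0 n w : (0 <= ((u n w) ^+ 2)%:E)%E by rewrite lee_fin sqr_ge0.
apply: (@le_trans _ _ (\int[P]_w limn_einf (fun n => ((u n w) ^+ 2)%:E))%E).
  apply: ae_ge0_le_integral => //.
  - by move=> w _; rewrite lee_fin sqr_ge0.
  - by apply/measurable_EFinP/rmeas_measurable; exact: rmeasX.
  - move=> w _; rewrite limn_einf_lim; apply: lime_ge; first exact: is_cvg_einfs.
    by apply: nearW => n; apply: le_ereal_inf_tmp => _ [k _ <-].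
  - rewrite /limn_einf; apply: measurableT_comp; first exact: oppe_measurable.
    by apply: measurable_fun_limn_esup => n; exact: measurableT_comp.
  apply: filterS zf => w [cw zw] _.
  have uw : (fun n => ((u n w) ^+ 2)%:E) @ \oo -->
      ((`|z0 w| + c * `|\int[mu]_(s in `[t, t']) f s w|) ^+ 2)%:E.
    apply/fine_cvgP; split; first exact: nearW.
    have cR : (fun n => `|Rn n w|) @ \oo --> `|\int[mu]_(s in `[t, t']) f s w|.
      by apply: cvg_norm; exact: riemann_sum_cvg tt' cw.
    have cu : (fun n => u n w) @ \oo --> `|z0 w| + c * `|\int[mu]_(s in `[t, t']) f s w|.
      by apply: cvgD; [exact: cvg_cst|apply: cvgM => //; exact: cvg_cst].
    by rewrite expr2; apply: (cvgM cu cu).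
  rewrite (cvg_limn_einf_sup uw).1 lee_fin -real_normK ?num_real//.
  by rewrite ler_pXn2r ?nnegrE ?(le_trans _ zw).
apply: le_trans (fatou _ _ _ _) _ => //.
apply: le_trans (limn_einf_sup _) _; rewrite limn_esup_lim.
apply: lime_le; first exact: is_cvg_esups.
apply: nearW => n; apply: ge_ereal_sup => _ [k _ <-].
by case: (lu k).
Qed.

End TimeIntegrals.

(** * A pathwise Gronwall inequality on short intervals *)

Section PathwiseGronwall.
Variable R : realType.
Notation mu := (@lebesgue_measure R).

(* Integrating the hypothesis once more gives [I <= \int z + c h I] for
   [I = \int y], and [c h <= 1 / 2] absorbs the last term. *)
Lemma short_gronwall (s s' c : R) (y z : R -> R) : s <= s' -> 0 <= c ->
  c * (s' - s) <= 2^-1 ->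
  {within `[s, s'], continuous y} -> {within `[s, s'], continuous z} ->
  (forall t, s <= t <= s' -> 0 <= y t) ->
  (forall t, s <= t <= s' -> y t <= z t + c * \int[mu]_(r in `[s, t]) y r) ->
  forall t, s <= t <= s' -> y t <= z t + 2 * c * \int[mu]_(r in `[s, s']) z r.
Proof.
move=> ss' c0 ch cy cz y0 yz.
pose I := \int[mu]_(r in `[s, s']) y r; pose J := \int[mu]_(r in `[s, s']) z r.
have Iy : mu.-integrable `[s, s'] (EFin \o y) by exact: (continuous_integrable_itv cy).
have Iz : mu.-integrable `[s, s'] (EFin \o z) by exact: (continuous_integrable_itv cz).
have IyI t : s <= t <= s' -> \int[mu]_(r in `[s, t]) y r <= I.
  move=> /andP[st ts']; rewrite -subr_ge0 (Rintegral_oc cy)//.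
  apply: Rintegral_ge0 => r /=; rewrite in_itv/= => /andP[r1 r2]; apply: y0.
  by rewrite r2 (le_trans st (ltW r1)).
have I0 : 0 <= I by apply: Rintegral_ge0 => r /=; rewrite in_itv; exact: y0.
have yzI t : s <= t <= s' -> y t <= z t + c * I.
  by move=> ts; apply: le_trans (yz t ts) _; rewrite lerD2l ler_wpM2l// IyI.
have mI : measurable (`[s, s']%classic : set (measurableTypeR R)) by exact: measurable_itv.
have muE : fine (mu `[s, s']) = s' - s.
  rewrite lebesgue_measure_itv/= lte_fin; case: ltP => // h.
  by apply/eqP; rewrite eq_sym subr_eq0; apply/eqP/le_anti; rewrite h.
have Ic : mu.-integrable `[s, s'] (EFin \o cst (c * I)).
  apply: (@continuous_integrable_itv _ s s' (cst (c * I))) => //.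
  by apply: continuous_subspaceT => x; exact: cvg_cst.
have II : I <= J + c * I * (s' - s).
  have -> : J + c * I * (s' - s) = \int[mu]_(r in `[s, s']) (z r + cst (c * I) r).
    by rewrite RintegralD// Rintegral_cst// muE.
  have Is : mu.-integrable `[s, s'] (EFin \o (fun r => z r + cst (c * I) r)).
    exact: (integrableD mI Iz Ic).
  by apply: le_Rintegral => // r; rewrite /= in_itv/=; exact: yzI.
have IJ : I <= 2 * J by nra.
move=> t ts; apply: le_trans (yzI t ts) _; rewrite lerD2l -/J.
by rewrite [2 * c]mulrC -mulrA ler_wpM2l.
Qed.

End PathwiseGronwall.

(** * The coefficients *)

Section CoefficientBounds.
Variables (R : realType) (d : nat).

(** One constant, one norm and one time exponent for all the hypotheses on a coefficient, so that
    [a] and [b] are treated alike. *)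
Definition coefficient_bound (T rate K : R) q (f : R -> 'cV[R]_d -> 'M[R]_(d, q)) :=
  [/\ forall s x y, 0 <= s -> fnorm (f s x - f s y) <= K * fnorm (x - y),
      forall s x, 0 <= s -> fnorm (f s x) <= K * (1 + fnorm x) &
      forall s t x, 0 <= s <= T -> 0 <= t <= T ->
        fnorm (f s x - f t x) <= K * (1 + fnorm x) * `|s - t| `^ rate].

(** [c + 1] dominates [sqrt c], and [1 + y] dominates [sqrt(1 + y^2)]. *)
Lemma growth_bound (c x y : R) : 0 <= x -> 0 <= y -> 0 <= c ->
  x ^+ 2 <= c * (1 + y ^+ 2) -> x <= (c + 1) * (1 + y).
Proof.
move=> x0 y0 c0 xy; rewrite -ler_sqr ?nnegrE ?mulr_ge0 ?addr_ge0//.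
apply: le_trans xy _; rewrite exprMn.
have h1 : 1 + y ^+ 2 <= (1 + y) ^+ 2 by nra.
have h2 : c <= (c + 1) ^+ 2 by nra.
by rewrite ler_pM// addr_ge0// sqr_ge0.
Qed.

Lemma specnorm_ge0 p q (A : 'M[R]_(p, q)) : 0 <= specnorm A.
Proof.
apply: ub_le_sup; last first.
  by exists 0 => /=; rewrite enormE ?mulmx0 fnorm0.
exists (fnorm A) => _ [v /= v1 <-]; rewrite enormE (le_trans (fnormM _ _))//.
by rewrite ler_piMr ?fnorm_ge0// -enormE.
Qed.

(** The Hoelder exponent is lowered from [alpha] to [r = min(1/2, alpha)] by
    [|s - t|^alpha <= T^(alpha - r) |s - t|^r], and the spectral norm is exchanged for the Frobenius
    norm at the cost of [d m]. In the autonomous case the time increment is 0 and any constant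
    serves. *)
Lemma coefficient_bounds m (a : R -> 'cV[R]_d -> 'cV[R]_d) (b : R -> 'cV[R]_d -> 'M[R]_(d, m))
    (T CLip Clgb rate : R) :
  lipschitz_in_space a b CLip -> 0 < Clgb -> linear_growth a b Clgb ->
  time_regularity a b T rate ->
  [/\ 0 < rate, rate <= 2^-1 & exists K, [/\ 0 <= K,
    coefficient_bound T rate K a & coefficient_bound T rate K b]].
Proof.
move=> lip C0 gr reg.
have [r0 r1 [K1 [K10 aK bK]]] : [/\ 0 < rate, rate <= 2^-1 & exists K1, [/\ 0 <= K1,
    forall s t x, 0 <= s <= T -> 0 <= t <= T ->
        fnorm (a s x - a t x) <= K1 * (1 + fnorm x) * `|s - t| `^ rate &
    forall s t x, 0 <= s <= T -> 0 <= t <= T ->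
        fnorm (b s x - b t x) <= K1 * (1 + fnorm x) * `|s - t| `^ rate]].
  case: reg => [[aut ->]|[alpha [Cna [al0 Cn0 hol ->]]]].
    split; rewrite ?invr_gt0//; exists 0; split=> // s t x /andP[s0 _] /andP[t0 _];
      have [Ea Eb] := aut s t x s0 t0.
      by rewrite Ea subrr fnorm0 !mul0r.
    by rewrite Eb subrr fnorm0 !mul0r.
  split; first by rewrite lt_min invr_gt0 ltr0n al0.
    by rewrite ge_min lexx.
  have pw s t : 0 <= s <= T -> 0 <= t <= T ->
     `|s - t| `^ alpha <= (1 + T `^ (alpha - Num.min 2^-1 alpha)) * `|s - t| `^ (Num.min 2^-1 alpha).
    move=> sT tT; set r := Num.min _ _.
    have rl : r <= alpha by rewrite ge_min lexx orbT.
    have rpos : 0 < r by rewrite lt_min invr_gt0 ltr0n al0.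
    have [->|st] := eqVneq `|s - t| 0.
      by rewrite !powR0 ?gt_eqF// mulr0.
    have -> : `|s - t| `^ alpha = `|s - t| `^ (alpha - r) * `|s - t| `^ r.
      by rewrite -powRD ?subrK// (negPf st) implybT.
    rewrite ler_wpM2r ?powR_ge0//.
    apply: (@le_trans _ _ (T `^ (alpha - r))); last by rewrite lerDr.
    rewrite ge0_ler_powR ?nnegrE ?subr_ge0// ?ler_norml; lra.
  set r := Num.min _ _ in pw *; set c := 1 + _ in pw *.
  have c0 : 0 <= c by rewrite addr_ge0// powR_ge0.
  clearbody c; have Cn1 := ltW Cn0.
  have hol' s t x : 0 <= s <= T -> 0 <= t <= T ->
     fnorm (a s x - a t x) + specnorm (b s x - b t x) <= Cna * c * (1 + fnorm x) * `|s - t| `^ r.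
    move=> sT tT; have := hol s t x sT tT; rewrite !enormE => /le_trans; apply.
    have -> : Cna * c * (1 + fnorm x) * `|s - t| `^ r =
      Cna * (1 + fnorm x) * (c * `|s - t| `^ r) by ring.
    by rewrite ler_wpM2l ?pw// mulr_ge0 ?addr_ge0 ?fnorm_ge0// ltW.
  have X0 (s t : R) (x : 'cV[R]_d) : 0 <= Cna * c * (1 + fnorm x) * `|s - t| `^ r.
    have := fnorm_ge0 x; have := powR_ge0 `|s - t| r => h1 h2.
    by rewrite mulr_ge0// mulr_ge0 ?addr_ge0// mulr_ge0// ltW.
  exists ((1 + (d * m)%:R) * (Cna * c)); split.
  - by rewrite !mulr_ge0 ?addr_ge0.
  - move=> s t x sT tT; have := hol' s t x sT tT; have := specnorm_ge0 (b s x - b t x).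
    have := mulr_ge0 (ler0n R (d * m)) (X0 s t x).
    move=> h1 h2 h3; rewrite -!mulrA mulrDl mul1r !mulrA; move: h1; rewrite !mulrA; lra.
  - move=> s t x sT tT; have := hol' s t x sT tT; have := fnorm_ge0 (a s x - a t x).
    move=> h1 h2; have h3 := fnorm_le_specnorm (b s x - b t x).
    have h4 : specnorm (b s x - b t x) <= Cna * c * (1 + fnorm x) * `|s - t| `^ r by lra.
    have := ler_wpM2l (ler0n R (d * m)) h4; have := X0 s t x.
    move=> h5 h6; rewrite -!mulrA mulrDl mul1r !mulrA; move: h5 h6; rewrite !mulrA; lra.
split=> //; exists (`|CLip| + (Clgb + 1) + K1).
have lb (s : R) (x y : 'cV[R]_d) : CLip * fnorm (x - y) <=
    (`|CLip| + (Clgb + 1) + K1) * fnorm (x - y).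
  rewrite ler_wpM2r ?fnorm_ge0// (le_trans (ler_norm _))//; lra.
have gb (s : R) (x : 'cV[R]_d) : (Clgb + 1) * (1 + fnorm x) <=
    (`|CLip| + (Clgb + 1) + K1) * (1 + fnorm x).
  rewrite ler_wpM2r ?addr_ge0 ?fnorm_ge0//; have := normr_ge0 CLip; lra.
have kb (x : 'cV[R]_d) (p : R) : 0 <= p -> K1 * (1 + fnorm x) * p <=
    (`|CLip| + (Clgb + 1) + K1) * (1 + fnorm x) * p.
  move=> p0; rewrite ler_wpM2r// ler_wpM2r ?addr_ge0 ?fnorm_ge0//.
  have := normr_ge0 CLip; lra.
split; first by have := normr_ge0 CLip; lra.
- split=> [s x y s0|s x s0|s t x sT tT].
  + apply: le_trans (lb s x y); have [+ _] := lip s x y s0; by rewrite !enormE.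
  + apply: le_trans (gb s x); apply: growth_bound; [exact: fnorm_ge0|exact: fnorm_ge0|exact: ltW|].
    have := gr s x s0; rewrite !enormE; apply: le_trans; rewrite lerDl; exact: sqr_ge0.
  + by apply: le_trans (aK s t x sT tT) (kb _ _ _); exact: powR_ge0.
- split=> [s x y s0|s x s0|s t x sT tT].
  + apply: le_trans (lb s x y); have [_] := lip s x y s0; by rewrite !enormE.
  + apply: le_trans (gb s x); apply: growth_bound; [exact: fnorm_ge0|exact: fnorm_ge0|exact: ltW|].
    have := gr s x s0; rewrite !enormE; apply: le_trans; rewrite lerDr; exact: sqr_ge0.
  + by apply: le_trans (bK s t x sT tT) (kb _ _ _); exact: powR_ge0.
Qed.

End CoefficientBounds.

(** * Bounds and Lipschitz estimates for the coupled system *)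

Section CoefficientsInL2.
Variables (R : realType) (dO : measure_display) (Omega : measurableType dO).
Variables (P : probability Omega R) (d k : nat) (T rate K : R).
Hypothesis K0 : 0 <= K.
Local Notation l2 := (l2 P).
Local Notation L2 := (L2 P).

(** [(U - U')^T y + U'^T (y - y')], where [U'^T] is an isometry. The factor [fnorm y] is the reason
    why Lipschitz constants depend on a moment bound. *)
Lemma fnorm_lift (U U' : 'M[R]_(k, d)) (y y' : 'cV[R]_k) : U' *m U'^T = 1%:M ->
  fnorm (U^T *m y - U'^T *m y') <= fnorm (U - U') * fnorm y + fnorm (y - y').
Proof.
move=> UU; have -> : U^T *m y - U'^T *m y' = (U - U')^T *m y + U'^T *m (y - y').
  by rewrite linearB/= mulmxBl mulmxBr addrA subrK.
rewrite (le_trans (fnormD _ _))// (fnorm_isometry _ UU) lerD2r.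
by rewrite (le_trans (fnormM _ _))// fnorm_tr.
Qed.

Section OneCoefficient.
Variables (q : nat) (f : R -> 'cV[R]_d -> 'M[R]_(d, q)).
Hypothesis cf : coefficient_bound T rate K f.
Implicit Types (U : 'M[R]_(k, d)) (Y : Omega -> 'cV[R]_k).

Lemma rv_coefficient G t U Y : sigma_algebra setT G -> 0 <= t -> U *m U^T = 1%:M ->
  rv_measurable G Y -> rv_measurable G (fun w => f t (U^T *m Y w)).
Proof.
move=> sG t0 UU mY i j; case: cf => fL _ _.
apply: (@rmeas_lipschitz _ _ _ _ sG _ (fun y => f t (U^T *m y) i j) K Y) => // x y.
have -> : f t (U^T *m x) i j - f t (U^T *m y) i j = (f t (U^T *m x) - f t (U^T *m y)) i j.
  by rewrite !mxE.
rewrite (le_trans (coord_le_fnorm _ _ _))// (le_trans (fL _ _ _ t0))//.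
by rewrite ler_wpM2l// -mulmxBr fnorm_isometry.
Qed.

Lemma L2_coefficient t U Y B : 0 <= t -> U *m U^T = 1%:M -> L2 Y B ->
  L2 (fun w => f t (U^T *m Y w)) (K * (1 + B)).
Proof.
move=> t0 UU lY; rewrite mulrDr mulr1; apply: L2_affine (lY) => //.
  by apply: rv_coefficient => //; case: lY.
case: cf => _ fg _; apply: aeW => w; rewrite (le_trans (fg _ _ t0))//.
by rewrite fnorm_isometry// mulrDr mulr1.
Qed.

Lemma L2_coefficientB s t U U' Y Y' B u e tau :
  0 <= s <= T -> 0 <= t <= T -> U *m U^T = 1%:M -> U' *m U'^T = 1%:M ->
  L2 Y B -> L2 Y' B -> L2 (fun w => Y w - Y' w) e ->
  fnorm (U - U') <= u -> `|s - t| `^ rate <= tau ->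
  L2 (fun w => f s (U^T *m Y w) - f t (U'^T *m Y' w)) (K * (1 + B) * (u + e + tau)).
Proof.
move=> sT tT UU UU' lY lY' lE Uu st; have [s0 _] := andP sT; have [t0 _] := andP tT.
have u0 : 0 <= u := le_trans (fnorm_ge0 _) Uu.
have tau0 : 0 <= tau := le_trans (powR_ge0 _ _) st.
have e0 := L2_ge0 lE; have B0 := L2_ge0 lY.
case: (cf) => fL _ fT.
have lb : L2 (fun w => f s (U^T *m Y w) - f t (U'^T *m Y' w))
    (`|K| * (`|u| * B + e) + `|K * tau| * (`|1| + B)).
  have l1 := l2D (l2Z K (l2D (l2Z u lY.2) lE.2)) (l2Z (K * tau) (l2D (l2_cst P 1) lY'.2)).
  apply: L2_dom l1.
    apply: rvB => //; apply: rv_coefficient => //; by [case: lY|case: lY'].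
  apply: aeW => w; rewrite ger0_norm; last first.
    by rewrite !(addr_ge0, mulr_ge0)// fnorm_ge0.
  rewrite -[X in fnorm (X - _)](subrK (f s (U'^T *m Y' w))) -addrA.
  rewrite (le_trans (fnormD _ _))// lerD//.
    rewrite (le_trans (fL _ _ _ s0))// ler_wpM2l// (le_trans (fnorm_lift _ _ _ UU'))//.
    by rewrite lerD2r ler_wpM2r// fnorm_ge0.
  rewrite (le_trans (fT _ _ _ sT tT))// fnorm_isometry// mulrAC.
  by rewrite ler_wpM2r ?addr_ge0 ?fnorm_ge0// ler_wpM2l.
apply: L2_le lb; rewrite normr1 !ger0_norm ?mulr_ge0//.
have -> : K * (1 + B) * (u + e + tau) = K * ((1 + B) * u + (1 + B) * e) + K * tau * (1 + B) by ring.
rewrite lerD2r ler_wpM2l//; nra.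
Qed.

(** Serves as a bound and as a Lipschitz constant for [U f(t, U^T Y)]: [k] bounds [fnorm U], and the
    1 accounts for the variation of the left factor [U]. *)
Definition c_proj (B : R) := (1 + k%:R) * (K * (1 + B)).

Lemma c_proj_ge0 B : 0 <= B -> 0 <= c_proj B.
Proof. by move=> B0; rewrite /c_proj !mulr_ge0 ?addr_ge0. Qed.

Lemma rv_projected G t U Y : sigma_algebra setT G -> 0 <= t -> U *m U^T = 1%:M ->
  rv_measurable G Y -> rv_measurable G (fun w => U *m f t (U^T *m Y w)).
Proof.
by move=> sG t0 UU mY; apply: rvM => //; [exact: rv_cst|exact: rv_coefficient].
Qed.

Lemma L2_projected t U Y B : 0 <= t -> U *m U^T = 1%:M -> L2 Y B ->
  L2 (fun w => U *m f t (U^T *m Y w)) (c_proj B).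
Proof.
move=> t0 UU lY; have B0 := L2_ge0 lY; apply: L2_le (L2Ml U (L2_coefficient t0 UU lY)).
rewrite /c_proj ler_wpM2r ?mulr_ge0 ?addr_ge0//.
by rewrite (le_trans (fnorm_orthonormal_le UU))// lerDr.
Qed.

Lemma L2_projectedB s t U U' Y Y' B u e tau :
  0 <= s <= T -> 0 <= t <= T -> U *m U^T = 1%:M -> U' *m U'^T = 1%:M ->
  L2 Y B -> L2 Y' B -> L2 (fun w => Y w - Y' w) e ->
  fnorm (U - U') <= u -> `|s - t| `^ rate <= tau ->
  L2 (fun w => U *m f s (U^T *m Y w) - U' *m f t (U'^T *m Y' w))
     (c_proj B * (u + e + tau)).
Proof.
move=> sT tT UU UU' lY lY' lE Uu st; have [s0 _] := andP sT.
have u0 : 0 <= u := le_trans (fnorm_ge0 _) Uu.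
have tau0 : 0 <= tau := le_trans (powR_ge0 _ _) st.
have e0 := L2_ge0 lE; have B0 := L2_ge0 lY.
have l1 := L2D (L2Ml (U - U') (L2_coefficient s0 UU lY))
  (L2Ml U' (L2_coefficientB sT tT UU UU' lY lY' lE Uu st)).
apply: L2_le (L2_ext _ l1); last by move=> w; rewrite mulmxBl mulmxBr addrA subrK.
have c0 : 0 <= K * (1 + B) by rewrite mulr_ge0 ?addr_ge0.
have -> : c_proj B * (u + e + tau) = (u + e + tau) * (K * (1 + B)) +
   k%:R * (K * (1 + B) * (u + e + tau)) by rewrite /c_proj; ring.
rewrite lerD//; first by rewrite ler_wpM2r//; lra.
by rewrite ler_wpM2r ?(mulr_ge0 c0) ?addr_ge0// (fnorm_orthonormal_le UU').
Qed.

End OneCoefficient.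
Section BasisField.
Variables (a : R -> 'cV[R]_d -> 'cV[R]_d) (g : R).
Hypothesis ca : coefficient_bound T rate K a.
Hypothesis g0 : 0 <= g.
Implicit Types (U : 'M[R]_(k, d)) (Y : Omega -> 'cV[R]_k).

(* The DO equation for the basis reads [U' = basis_field t U Y]. *)
Definition basis_field t U Y : 'M[R]_(k, d) :=
  invmx (second_moment P Y) *m (drift_moment P a t U Y *m coproj U).

Lemma basis_field_tangent t U Y : U *m U^T = 1%:M -> U *m (basis_field t U Y)^T = 0.
Proof.
move=> UU; have C0 : coproj U *m U^T = 0.
  by rewrite /coproj mulmxBl mul1mx -mulmxA UU mulmx1 subrr.
apply: trmx_inj; rewrite trmx_mul trmxK trmx0 /basis_field -!mulmxA C0 !mulmx0//.
Qed.

(** [gI] bounds the inverse second moment, [cD] the drift moment, [cDl] is a Lipschitz constant of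
    the drift moment, and [cP] bounds the complementary projector. *)
Let gI := (k * k)%:R * g.
Let cD B := (k * d)%:R * (B * (K * (1 + B))).
Let cDl B := (k * d)%:R * (K * (1 + B) ^+ 2).
Let cP : R := d%:R + k%:R * k%:R.

(** The first summand bounds the field; the other three are its Lipschitz constants through the
    inverse, the drift moment and the projector. Their sum serves both purposes. *)
Definition c_field B := gI * cD B * cP +
  (gI * ((k * k)%:R * (2 * B)) * gI * cD B * cP + gI * cDl B * cP + gI * cD B * (2 * k%:R)).

Let gI0 : 0 <= gI. Proof. by rewrite mulr_ge0. Qed.
Let cD0 B : 0 <= B -> 0 <= cD B. Proof. by move=> B0; rewrite !mulr_ge0 ?addr_ge0. Qed.
Let cDl0 B : 0 <= B -> 0 <= cDl B.
Proof. by move=> B0; rewrite !mulr_ge0 ?exprn_ge0 ?addr_ge0. Qed.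
Let cP0 : 0 <= cP. Proof. by rewrite addr_ge0 ?mulr_ge0. Qed.

Lemma c_field_ge0 B : 0 <= B -> 0 <= c_field B.
Proof.
move=> B0; have h1 := cD0 B0; have h2 := cDl0 B0.
by rewrite /c_field !(addr_ge0, mulr_ge0).
Qed.

Lemma fnorm_coproj U : U *m U^T = 1%:M -> fnorm (coproj U) <= cP.
Proof.
move=> UU; rewrite /coproj (le_trans (fnormB _ _))// lerD//.
  by apply: fnorm_orthonormal_le; rewrite trmx1 mulmx1.
rewrite (le_trans (fnormM _ _))// fnorm_tr ler_pM ?fnorm_ge0//; exact: fnorm_orthonormal_le.
Qed.

Lemma fnorm_drift_moment t U Y B : 0 <= t -> U *m U^T = 1%:M -> L2 Y B ->
  fnorm (drift_moment P a t U Y) <= cD B.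
Proof. by move=> t0 UU lY; exact: (fnorm_Emx lY (L2_coefficient ca t0 UU lY)). Qed.

(** The product form is kept besides [fnorm_basis_field_le] because the moment recursion needs the
    explicit growth in [B]. *)
Lemma fnorm_basis_field t U Y B : 0 <= t -> U *m U^T = 1%:M -> L2 Y B ->
  inv_norm_le (second_moment P Y) g ->
  fnorm (basis_field t U Y) <= gI * cD B * cP.
Proof.
move=> t0 UU lY iY; have B0 := L2_ge0 lY.
rewrite (le_trans (fnormM _ _))// -mulrA ler_pM ?fnorm_ge0//; first exact: inv_norm_fnorm.
rewrite (le_trans (fnormM _ _))// ler_pM ?fnorm_ge0//; first exact: fnorm_drift_moment.
exact: fnorm_coproj.
Qed.

Lemma fnorm_basis_field_le t U Y B : 0 <= t -> U *m U^T = 1%:M -> L2 Y B ->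
  inv_norm_le (second_moment P Y) g ->
  fnorm (basis_field t U Y) <= c_field B.
Proof.
move=> t0 UU lY iY; apply: le_trans (fnorm_basis_field t0 UU lY iY) _.
have B0 := L2_ge0 lY; have h1 := cD0 B0; have h2 := cDl0 B0.
by rewrite /c_field lerDl !(addr_ge0, mulr_ge0).
Qed.

(** The three factors are changed one at a time; for the first,
    [C^-1 - C'^-1 = - C^-1 (C - C') C'^-1]. *)
Lemma fnorm_basis_fieldB s t U U' Y Y' B u e tau :
  0 <= s <= T -> 0 <= t <= T -> U *m U^T = 1%:M -> U' *m U'^T = 1%:M ->
  L2 Y B -> L2 Y' B -> L2 (fun w => Y w - Y' w) e ->
  inv_norm_le (second_moment P Y) g -> inv_norm_le (second_moment P Y') g ->
  fnorm (U - U') <= u -> `|s - t| `^ rate <= tau ->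
  fnorm (basis_field s U Y - basis_field t U' Y') <= c_field B * (u + e + tau).
Proof.
move=> sT tT UU UU' lY lY' lE iY iY' Uu st; have [s0 _] := andP sT; have [t0 _] := andP tT.
have u0 : 0 <= u := le_trans (fnorm_ge0 _) Uu.
have tau0 : 0 <= tau := le_trans (powR_ge0 _ _) st.
have e0 := L2_ge0 lE; have B0 := L2_ge0 lY; have h1 := cD0 B0; have h2 := cDl0 B0.
rewrite /basis_field.
set D := drift_moment P a s U Y; set D' := drift_moment P a t U' Y'.
set C := second_moment P Y in iY *; set C' := second_moment P Y' in iY' *.
have DD : fnorm (D - D') <= cDl B * (u + e + tau).
  have := fnorm_EmxB lY' (L2_coefficient ca s0 UU lY) lE
    (L2_coefficientB ca sT tT UU UU' lY lY' lE Uu st).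
  move/le_trans; apply; rewrite /cDl -[leRHS]mulrA ler_wpM2l//.
  have -> : K * (1 + B) ^+ 2 * (u + e + tau) = K * (1 + B) * (u + e + tau) +
    B * (K * (1 + B) * (u + e + tau)) by ring.
  rewrite lerD2r mulrC ler_wpM2l ?mulr_ge0 ?addr_ge0//; lra.
have PP : fnorm (coproj U - coproj U') <= 2 * k%:R * u.
  have -> : coproj U - coproj U' = - ((U - U')^T *m U + U'^T *m (U - U')).
    rewrite [(U - U')^T]linearB/= mulmxBl mulmxBr addrA subrK opprB /coproj opprB.
    by rewrite [LHS]addrC addrA subrK.
  rewrite fnormN (le_trans (fnormD _ _))//.
  have e1 : fnorm ((U - U')^T *m U) <= u * k%:R.
    by rewrite (le_trans (fnormM _ _))// fnorm_tr ler_pM ?fnorm_ge0// fnorm_orthonormal_le.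
  have e2 : fnorm (U'^T *m (U - U')) <= k%:R * u.
    by rewrite (le_trans (fnormM _ _))// fnorm_tr ler_pM ?fnorm_ge0// fnorm_orthonormal_le.
  lra.
have II : fnorm (invmx C - invmx C') <= gI * ((k * k)%:R * (2 * B)) * gI * e.
  have -> : invmx C - invmx C' = - (invmx C *m (C - C') *m invmx C').
    rewrite mulmxBr mulVmx; last by case: iY.
    by rewrite mulmxBl mul1mx mulmxK ?opprB//; case: iY'.
  rewrite fnormN (le_trans (fnormM _ _))//.
  have CC : fnorm (C - C') <= (k * k)%:R * (2 * B) * e.
    have := fnorm_EmxB lY' lY lE lE; move/le_trans; apply; rewrite -mulrA ler_wpM2l//; lra.
  have -> : gI * ((k * k)%:R * (2 * B)) * gI * e = gI * ((k * k)%:R * (2 * B) * e) * gI by ring.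
  rewrite ler_pM ?fnorm_ge0//; last exact: inv_norm_fnorm.
  by rewrite (le_trans (fnormM _ _))// ler_pM ?fnorm_ge0//; exact: inv_norm_fnorm.
have DP : fnorm (D *m coproj U) <= cD B * cP.
  rewrite (le_trans (fnormM _ _))// ler_pM ?fnorm_ge0//; last exact: fnorm_coproj.
  exact: fnorm_drift_moment.
have -> : invmx C *m (D *m coproj U) - invmx C' *m (D' *m coproj U') =
    (invmx C - invmx C') *m (D *m coproj U) +
    (invmx C' *m ((D - D') *m coproj U) + invmx C' *m (D' *m (coproj U - coproj U'))).
  move: (coproj U) (coproj U') => Q Q'.
  rewrite !(mulmxBl, mulmxBr) -!addrA; congr (_ + _).
  by rewrite addrA addNr add0r addrA addNr add0r.
set v := u + e + tau in DD *.
have v0 : 0 <= v by rewrite !addr_ge0.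
have ev : e <= v by rewrite /v; lra.
have uv : u <= v by rewrite /v; lra.
have t1 : fnorm ((invmx C - invmx C') *m (D *m coproj U)) <=
    gI * ((k * k)%:R * (2 * B)) * gI * v * (cD B * cP).
  rewrite (le_trans (fnormM _ _))// ler_pM ?fnorm_ge0// (le_trans II)// ler_wpM2l//.
  by rewrite !mulr_ge0.
have t2 : fnorm (invmx C' *m ((D - D') *m coproj U)) <= gI * (cDl B * v * cP).
  rewrite (le_trans (fnormM _ _))// ler_pM ?fnorm_ge0//; first exact: inv_norm_fnorm.
  rewrite (le_trans (fnormM _ _))// ler_pM ?fnorm_ge0//; exact: fnorm_coproj.
have t3 : fnorm (invmx C' *m (D' *m (coproj U - coproj U'))) <= gI * (cD B * (2 * k%:R * v)).
  rewrite (le_trans (fnormM _ _))// ler_pM ?fnorm_ge0//; first exact: inv_norm_fnorm.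
  rewrite (le_trans (fnormM _ _))// ler_pM ?fnorm_ge0//; first exact: fnorm_drift_moment.
  by rewrite (le_trans PP)// ler_wpM2l// mulr_ge0.
have t4 : 0 <= gI * cD B * cP * v by rewrite mulr_ge0// mulr_ge0// mulr_ge0.
rewrite (le_trans (fnormD _ _))//; have := fnormD (invmx C' *m ((D - D') *m coproj U))
  (invmx C' *m (D' *m (coproj U - coproj U'))).
move=> t5.
have -> : c_field B * v = gI * cD B * cP * v + (gI * ((k * k)%:R * (2 * B)) * gI * v * (cD B * cP)
  + (gI * (cDl B * v * cP) + gI * (cD B * (2 * k%:R * v)))) by rewrite /c_field; ring.
lra.
Qed.

End BasisField.
End CoefficientsInL2.

(** * The Euler-Maruyama scheme *)

Lemma ler_sum_widen (R : numDomainType) (f : nat -> R) n N : (n <= N)%N ->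
  (forall i, 0 <= f i) -> \sum_(i < n) f i <= \sum_(i < N) f i.
Proof.
move=> nN f0; rewrite -!(big_mkord xpredT f) [leRHS](@big_cat_nat _ _ _ n)//= lerDl.
by apply: sumr_ge0.
Qed.

Section DriftMartingaleDecomposition.
Variables (R : realType) (dO : measure_display) (Omega : measurableType dO).
Variables (P : probability Omega R) (p N : nat) (G : nat -> set (set Omega)).
Local Notation mO := (@measurable dO Omega).
Local Notation l2 := (l2 P).
Local Notation L2 := (L2 P).
Variables (Z D xi : nat -> Omega -> 'cV[R]_p) (z0 : R) (al r : nat -> R).
Hypothesis sG : forall n, (n <= N)%N -> sigma_algebra setT (G n).
Hypothesis G_mono : forall i j, (i <= j)%N -> (j <= N)%N -> G i `<=` G j.
Hypothesis G_meas : forall n, (n <= N)%N -> G n `<=` mO.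
Hypothesis mxi : forall n, (n < N)%N -> rv_measurable (G n.+1) (xi n).
Hypothesis oxi : forall n, (n < N)%N -> orth P (G n) (xi n).
Hypothesis lxi : forall n, (n < N)%N -> L2 (xi n) (r n).
Hypothesis ZS : forall n, (n < N)%N -> forall w, Z n.+1 w = Z n w + D n w + xi n w.
Hypothesis lZ0 : L2 (Z 0%N) z0.
Hypothesis lD : forall n, (n < N)%N -> L2 (D n) (al n).

Lemma decomposition_sum n w : (n <= N)%N ->
  Z n w = Z 0%N w + \sum_(i < n) D i w + \sum_(i < n) xi i w.
Proof.
elim: n => [|n IH] nN; first by rewrite !big_ord0 !addr0.
rewrite ZS// IH ?(ltnW nN)// !big_ord_recr/= !addrA; congr (_ + _).
by rewrite -!addrA; congr (_ + (_ + _)); rewrite addrC.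
Qed.

(** Drift terms add in norm, martingale increments only in squares. Hence drift errors of size
    [dt^(1 + rate)] and martingale errors of size [dt^(1/2 + rate)] both accumulate to [dt^rate]. *)
Lemma decomposition_L2 n : (n <= N)%N ->
  L2 (Z n) (z0 + \sum_(i < n) al i + Num.sqrt (\sum_(i < n) r i ^+ 2)).
Proof.
move=> nN; have lS : L2 (fun w => \sum_(i < n) D i w) (\sum_(i < n) al i).
  by apply: L2_sum => i; apply: lD; exact: leq_trans (ltn_ord i) nN.
have := L2D (L2D lZ0 lS) (martingale_sum_L2 sG G_mono mxi oxi lxi nN).
by apply: L2_ext => w; rewrite (decomposition_sum w nN).
Qed.

Lemma decomposition_max :
  l2 (fun w => \big[Num.max/0]_(n < N.+1) fnorm (Z n w))
     (z0 + \sum_(i < N) al i + p%:R * (4 * Num.sqrt (\sum_(i < N) r i ^+ 2))).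
Proof.
have lS : l2 (fun w => \sum_(i < N) fnorm (D i w)) (\sum_(i < N) al i).
  by apply: l2_sum => i; exact: (lD (ltn_ord i)).2.
have l1 := l2D (l2D lZ0.2 lS) (martingale_max sG G_mono G_meas mxi oxi lxi).
apply: l2_dom (l1).
  apply: rmeas_bigmax => // -[n /= nN]; apply: rmeas_fnorm => //.
  by case: (decomposition_L2 nN).
have M0 (V : nat -> 'cV[R]_p) : 0 <= \big[Num.max/0]_(n < N.+1) fnorm (V n).
  by elim/big_ind : _ => //= [x y x0 y0|i _]; rewrite ?le_max ?x0 ?fnorm_ge0.
apply: aeW => w; rewrite ger0_norm ?(M0 (Z^~ w))//.
have S0 : 0 <= \sum_(i < N) fnorm (D i w) by apply: sumr_ge0 => i _; exact: fnorm_ge0.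
rewrite ger0_norm; last by rewrite !addr_ge0 ?fnorm_ge0// (M0 (fun n => \sum_(i < n) xi i w)).
apply: bigmax_le => [|n _].
  by rewrite !addr_ge0 ?fnorm_ge0// (M0 (fun n => \sum_(i < n) xi i w)).
have nN : (n <= N)%N by rewrite -ltnS.
rewrite decomposition_sum// (le_trans (fnormD _ _))// lerD//; last first.
  exact: (le_bigmax _ (fun n : 'I_N.+1 => fnorm (\sum_(i < n) xi i w)) n).
rewrite (le_trans (fnormD _ _))// lerD2l (le_trans (fnorm_sum _ _ _))//.
by apply: (@ler_sum_widen R (fun i => fnorm (D i w)) n N nN) => i; exact: fnorm_ge0.
Qed.

End DriftMartingaleDecomposition.

Section EulerMaruyamaStep.
Variables (R : realType) (dO : measure_display) (Omega : measurableType dO).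
Variables (P : probability Omega R) (d m k : nat) (W : R -> Omega -> 'cV[R]_m).
Variables (a : R -> 'cV[R]_d -> 'cV[R]_d) (b : R -> 'cV[R]_d -> 'M[R]_(d, m)) (g : R).
Local Notation G t U Y := (basis_field P a t U Y).

(** The variable [Y] with tilde of the scheme, before multiplication by the triangular factor. *)
Definition em_predictor (dt : R) (n : nat) (U : 'M[R]_(k, d)) (Y : Omega -> 'cV[R]_k) w : 'cV[R]_k :=
  Y w + dt *: (U *m a (n%:R * dt) (U^T *m Y w)) +
  U *m b (n%:R * dt) (U^T *m Y w) *m (W (n.+1%:R * dt) w - W (n%:R * dt) w).

Section OneStep.
Variables (dt : R) (N n : nat) (Un : nat -> 'M[R]_(k, d)) (Yn : nat -> Omega -> 'cV[R]_k).
Variables (U0 : 'M[R]_(k, d)) (Y0 : Omega -> 'cV[R]_k).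
Hypothesis em : dlr_euler_maruyama P a b W U0 Y0 dt N Un Yn.
Hypotheses (nN : (n < N)%N) (UU : Un n *m (Un n)^T = 1%:M).
Hypothesis iY : inv_norm_le (second_moment P (Yn n)) g.
Let Gn := G (n%:R * dt) (Un n) (Yn n).

Lemma em_step_cholesky : exists S : 'M[R]_k,
  [/\ Un n.+1 *m (Un n.+1)^T = 1%:M,
      fnorm (S - 1%:M) <= k%:R * fnorm (dt *: Gn) ^+ 2,
      forall y : 'cV[R]_k, fnorm (S *m y) ^+ 2 <= (1 + fnorm (dt *: Gn) ^+ 2) * fnorm y ^+ 2,
      fnorm (Un n.+1 - Un n - dt *: Gn) <= k%:R * (k%:R * fnorm (dt *: Gn) ^+ 2) &
      forall w, Yn n.+1 w = S *m em_predictor dt n (Un n) (Yn n) w].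
Proof.
have [U' [S [eU [qr QQ Sup Spos] eY]]] := em_step em nN.
have eU' : U' = Un n + dt *: Gn.
  have Cu : second_moment P (Yn n) \in unitmx by case: iY.
  have := congr1 (mulmx (invmx (second_moment P (Yn n)))) eU.
  by rewrite mulmxDr !mulKmx// -scalemxAr.
have eUS : U' = S^T *m Un n.+1 by apply: trmx_inj; rewrite trmx_mul trmxK.
have tan : Un n *m (dt *: Gn)^T = 0.
  by rewrite linearZ/= -scalemxAr basis_field_tangent// scaler0.
have tan' : (dt *: Gn) *m (Un n)^T = 0.
  by apply: trmx_inj; rewrite trmx_mul trmxK tan trmx0.
have gram : S^T *m S = 1%:M + (dt *: Gn) *m (dt *: Gn)^T.
  have : U' *m U'^T = S^T *m S.
    by rewrite eUS trmx_mul trmxK -mulmxA (mulmxA (Un n.+1)) QQ mul1mx.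
  move=> <-; rewrite eU' [(_ + _)^T]linearD/= mulmxDl !mulmxDr UU tan tan' addr0 add0r//.
have Sp := cholesky_perturbation Sup Spos gram.
exists S; split=> //; first by move=> y; exact: (cholesky_apply gram).
(* The unnormalised basis is [S^T *m Un n.+1], so the departure of the new basis from the explicit
   Euler step is governed by [S - 1]. *)
have -> : Un n.+1 - Un n - dt *: Gn = - ((S - 1%:M)^T *m Un n.+1).
  rewrite [(S - _)^T]linearB/= trmx1 mulmxBl mul1mx -eUS eU' opprB opprD addrA//.
rewrite fnormN (le_trans (fnormM _ _))// fnorm_tr mulrC ler_pM ?fnorm_ge0//.
exact: fnorm_orthonormal_le.
Qed.

End OneStep.
End EulerMaruyamaStep.

(** * The recursion for the second moments of the scheme *)

Section CubicRecursion.
Variable R : realType.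

(** [h] bounds the second moment. The first factor is the usual growth of an Euler-Maruyama step;
    the second is the inflation by the triangular factor, with the basis field bounded by a multiple
    of [h]. *)
Definition cubic_step (c1 c2 dt h : R) := (1 + c1 * dt) * (1 + c2 * dt ^+ 2 * h ^+ 2) * h.

Lemma cubic_step_ge1 c1 c2 dt h : 0 <= c1 -> 0 <= c2 -> 0 <= dt -> 1 <= h ->
  h <= cubic_step c1 c2 dt h.
Proof.
move=> c10 c20 dt0 h1; have h0 : 0 <= h by rewrite (le_trans ler01).
rewrite /cubic_step ler_peMl//; by apply: mulr_ege1; rewrite lerDl ?mulr_ge0 ?exprn_ge0.
Qed.

Lemma cubic_step_le c1 c2 dt dt' h h' : 0 <= c1 -> 0 <= c2 -> 0 <= dt -> dt <= dt' ->
  0 <= h -> h <= h' -> cubic_step c1 c2 dt h <= cubic_step c1 c2 dt' h'.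
Proof.
move=> c10 c20 dt0 dtt h0 hh; have dt'0 := le_trans dt0 dtt; have h'0 := le_trans h0 hh.
have e1 : dt ^+ 2 <= dt' ^+ 2 by rewrite lerXn2r ?nnegrE.
have e2 : h ^+ 2 <= h' ^+ 2 by rewrite lerXn2r ?nnegrE.
have p : 0 <= c2 * dt ^+ 2 * h ^+ 2 by rewrite !mulr_ge0 ?exprn_ge0.
rewrite /cubic_step ler_pM//.
- by rewrite mulr_ge0 ?addr_ge0 ?mulr_ge0.
- rewrite ler_pM ?addr_ge0 ?mulr_ge0//; first by rewrite lerD2l ler_wpM2l.
  by rewrite lerD2l ler_pM ?mulr_ge0 ?exprn_ge0// ler_wpM2l.
Qed.

(* For small steps the cubic term costs at most a factor [1 + dt]; for large
   ones there are boundedly many steps. *)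
Lemma cubic_recursion_bounded (T c1 c2 h0 : R) : 0 < T -> 0 <= c1 -> 0 <= c2 -> 1 <= h0 ->
  exists2 H : R, 0 <= H & forall N, (0 < N)%N ->
    forall n, (n <= N)%N -> iter n (cubic_step c1 c2 (T / N%:R)) h0 <= H.
Proof.
move=> T0 c10 c20 h01; have h00 : 0 <= h0 by rewrite (le_trans ler01).
pose A := h0 * expR ((c1 + 1) * T).
have A0 : 0 <= A by rewrite mulr_ge0// expR_ge0.
(* For [dt <= d0] the cubic correction [c2 dt^2 h^2] stays below [dt] as long as [h <= A], and [A]
   is the exponential bound that results, so the induction closes on itself. *)
pose d0 := (c2 * A ^+ 2 + 1)^-1.
have d0p : 0 < d0 by rewrite invr_gt0 ltr_wpDl ?mulr_ge0 ?exprn_ge0.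
have [M MT] : exists M : nat, T / d0 < M%:R.
  by exists (Num.truncn (T / d0)).+1; rewrite truncnS_gt.
pose y n := iter n (cubic_step c1 c2 T) h0.
have y1 n : 1 <= y n.
  elim: n => [|n IH] //; rewrite /y iterS; apply: le_trans (IH) _.
  by apply: cubic_step_ge1 => //; exact: ltW.
have ymono i j : (i <= j)%N -> y i <= y j.
  move=> ij; rewrite -(subnK ij); elim: (j - i)%N => [|l IH]; first by rewrite add0n.
  by rewrite addSn (le_trans IH)// /y iterS; apply: cubic_step_ge1 => //; [exact: ltW|exact: (y1 (l + i)%N)].
exists (A + y M) => [|N N0 n nN]; first by rewrite addr_ge0// (le_trans ler01)// y1.
set dt := T / N%:R; have dt_gt0 : 0 < dt by rewrite divr_gt0// ltr0n.
have dt0 := ltW dt_gt0.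
have dtT : N%:R * dt = T by rewrite /dt mulrC divfK// pnatr_eq0 -lt0n.
pose x i := iter i (cubic_step c1 c2 dt) h0.
have x1 i : 1 <= x i.
  elim: i => [|i IH] //; rewrite /x iterS; apply: le_trans (IH) _.
  by apply: cubic_step_ge1 => //; exact: ltW.
have [dtd|dtd] := leP dt d0.
  suff H i : (i <= N)%N -> x i <= h0 * expR ((c1 + 1) * (i%:R * dt)).
    rewrite (@le_trans _ _ A)//; last by rewrite lerDl (le_trans ler01)// y1.
    apply: le_trans (H n nN) _; rewrite /A ler_wpM2l// ler_expR ler_wpM2l ?addr_ge0//.
    by rewrite -dtT ler_wpM2r ?ler_nat// ltW.
  elim: i => [|i IH] iN; first by rewrite mul0r mulr0 expR0 mulr1.
  have iN' := ltnW iN; have xi := IH iN'.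
  have xA : x i <= A.
    apply: le_trans xi _; rewrite /A ler_wpM2l// ler_expR ler_wpM2l ?addr_ge0//.
    by rewrite -dtT ler_wpM2r ?ler_nat// ltW.
  have xi0 : 0 <= x i by rewrite (le_trans ler01).
  have sm : c2 * dt ^+ 2 * x i ^+ 2 <= dt.
    have e : x i ^+ 2 <= A ^+ 2 by rewrite lerXn2r ?nnegrE.
    have e' : c2 * dt * x i ^+ 2 <= 1.
      apply: (@le_trans _ _ (c2 * d0 * A ^+ 2)).
        by apply: ler_pM => //; [exact: mulr_ge0|exact: sqr_ge0|exact: ler_wpM2l].
      rewrite mulrAC /d0 ler_pdivrMr ?ltr_wpDl ?mulr_ge0 ?exprn_ge0// mul1r; lra.
    have -> : c2 * dt ^+ 2 * x i ^+ 2 = dt * (c2 * dt * x i ^+ 2) by ring.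
    by rewrite ler_piMr// ltW.
  rewrite /x iterS -/(x i) /cubic_step.
  have -> : (c1 + 1) * (i.+1%:R * dt) = c1 * dt + dt + (c1 + 1) * (i%:R * dt).
    by rewrite -natr1; ring.
  have q0 : 0 <= c2 * dt ^+ 2 * x i ^+ 2 by rewrite mulr_ge0 ?sqr_ge0// mulr_ge0 ?sqr_ge0.
  have p0 : 0 <= c1 * dt by exact: mulr_ge0.
  rewrite !expRD [leRHS]mulrCA; apply: ler_pM => //; first by apply: mulr_ge0; exact: addr_ge0.
  apply: ler_pM; [exact: addr_ge0|exact: addr_ge0|exact: expR_ge1Dx|].
  by rewrite (le_trans _ (expR_ge1Dx _))// lerD2l.
have NM : (n <= M)%N.
  rewrite (leq_trans nN)// ltnW// -(ltr_nat R) (lt_trans _ MT)//.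
  by rewrite ltr_pdivlMr// -dtT ltr_pM2l ?ltr0n.
rewrite (@le_trans _ _ (y M)) ?lerDr// (le_trans _ (ymono _ _ NM))//.
elim: n {nN NM} => [|n IH] //; rewrite /y !iterS; apply: cubic_step_le => //.
  by rewrite /dt ler_piMr ?invf_le1 ?ler1n ?ltr0n//; exact: ltW.
by rewrite (le_trans ler01)// x1.
Qed.

End CubicRecursion.

(** * Uniform moment bounds for the scheme *)

Section EulerMaruyamaMoments.
Variables (R : realType) (dO : measure_display) (Omega : measurableType dO).
Variables (P : probability Omega R) (F : R -> set (set Omega)) (d m k : nat).
Variable W : R -> Omega -> 'cV[R]_m.
Variables (a : R -> 'cV[R]_d -> 'cV[R]_d) (b : R -> 'cV[R]_d -> 'M[R]_(d, m)).
Variables (T rate K g : R).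
Hypotheses (uc : usual_conditions P F) (bm : brownian_motion P F W).
Hypotheses (T0 : 0 < T) (K0 : 0 <= K) (g0 : 0 <= g).
Hypotheses (ca : coefficient_bound T rate K a) (cb : coefficient_bound T rate K b).
Local Notation l2 := (l2 P).
Local Notation L2 := (L2 P).
Local Notation c_phi := (c_proj k K).
Local Notation cW := (c_bm R m k).

Section Predictor.
Variables (dt : R) (n : nat) (U : 'M[R]_(k, d)) (Y : Omega -> 'cV[R]_k) (r : R).
Hypotheses (dt0 : 0 <= dt) (UU : U *m U^T = 1%:M).
Hypotheses (mY : rv_measurable (F (n%:R * dt)) Y) (lY : L2 Y r).
Let t := n%:R * dt.
Let t' := n.+1%:R * dt.
Let t0 : 0 <= t. Proof. exact: mulr_ge0. Qed.
Let tt' : t <= t'. Proof. by rewrite ler_wpM2r// ler_nat. Qed.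
Let sF : sigma_algebra setT (F t). Proof. exact: (filtration_sigma uc). Qed.

Lemma rv_em_predictor : rv_measurable (F t') (em_predictor W a b dt n U Y).
Proof.
have sF' : sigma_algebra setT (F t') by apply: (filtration_sigma uc); exact: le_trans tt'.
apply: rvD => //; last first.
  apply: rvM => //; last exact: (rv_increment uc bm).
  by apply: (rv_mono uc t0 tt'); apply: (rv_projected K0 cb).
apply: (rv_mono uc t0 tt'); apply: rvD => //; apply: rvZ => //; first exact: rmeas_cst.
exact: (rv_projected K0 ca).
Qed.

(** Orthogonality of the noise makes the second moment grow by a factor [1 + O(dt)]; the triangle
    inequality would only give [1 + O(sqrt dt)]. *)
Lemma L2_em_predictor : L2 (em_predictor W a b dt n U Y)
  (Num.sqrt ((r + dt * c_phi r) ^+ 2 + (cW * Num.sqrt dt * c_phi r) ^+ 2)).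
Proof.
have mb := rv_projected K0 cb sF t0 UU mY; have lb := L2_projected K0 cb t0 UU lY.
have la := L2_projected K0 ca t0 UU lY.
apply: (L2_pythagoras (G := F t)).
- apply: rvD => //; apply: rvZ => //; first exact: rmeas_cst.
  exact: (rv_projected K0 ca).
- by have := L2D lY (L2Z dt la); rewrite ger0_norm.
- have Edt : t' - t = dt by rewrite /t' -natr1 mulrDl mul1r addrC addKr.
  by have := L2_bm_mul uc bm t0 tt' mb lb; rewrite Edt.
- exact: (orth_bm uc bm t0 tt' mb lb).
Qed.

End Predictor.

(** For [r >= 1] the projected coefficients are at most [ka r], and the basis field at most
    [kg r^2]. [c1] collects the expansion of [(1 + ka dt)^2 + cW^2 ka^2 dt], with [dt^2 <= T dt]. *)
Let ka := 2 * ((1 + k%:R) * K).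
Let kg := (k * k)%:R * g * ((k * d)%:R * (2 * K)) * (d%:R + k%:R * k%:R).
Let c1 := 2 * ka + ka ^+ 2 * T + cW ^+ 2 * ka ^+ 2.
Let c2 := kg ^+ 2.

(** Keeping [h >= 1] turns the affine growth [1 + r] into the linear [2 r], so that the recursion is
    homogeneous enough to iterate. *)
Lemma em_moment_step dt N n (Un : nat -> 'M[R]_(k, d)) (Yn : nat -> Omega -> 'cV[R]_k) U0 Y0 h :
  0 <= dt -> dt <= T -> 1 <= h -> (n < N)%N ->
  dlr_euler_maruyama P a b W U0 Y0 dt N Un Yn ->
  Un n *m (Un n)^T = 1%:M -> rv_measurable (F (n%:R * dt)) (Yn n) ->
  inv_norm_le (second_moment P (Yn n)) g -> L2 (Yn n) (Num.sqrt h) ->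
  [/\ Un n.+1 *m (Un n.+1)^T = 1%:M, rv_measurable (F (n.+1%:R * dt)) (Yn n.+1) &
      L2 (Yn n.+1) (Num.sqrt (cubic_step c1 c2 dt h))].
Proof.
move=> dt0 dtT h1 nN em UU mY iY lY; have h0 : 0 <= h by rewrite (le_trans ler01).
have [S [UU' _ Sy _ SY]] := em_step_cholesky em nN UU iY.
have mp := rv_em_predictor dt0 UU mY; have lp := L2_em_predictor dt0 UU mY lY.
have t'0 : 0 <= n.+1%:R * dt by rewrite mulr_ge0.
have mY' : rv_measurable (F (n.+1%:R * dt)) (Yn n.+1).
  apply: (rv_ext (X := fun w => S *m em_predictor W a b dt n (Un n) (Yn n) w)) => //.
  apply: rvM => //; [exact: (filtration_sigma uc)|].
  by apply: rv_cst; exact: (filtration_sigma uc).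
split=> //.
set G := dt *: _ in Sy; set r := Num.sqrt h in lY lp.
have r0 : 0 <= r by exact: sqrtr_ge0.
have r1 : 1 <= r by rewrite -(@sqrtr1 R) ler_sqrt.
have rh : r ^+ 2 = h by rewrite sqr_sqrtr.
have EG : Num.sqrt (1 + fnorm G ^+ 2) ^+ 2 = 1 + fnorm G ^+ 2.
  by rewrite sqr_sqrtr ?addr_ge0 ?sqr_ge0.
have lS := l2Z (Num.sqrt (1 + fnorm G ^+ 2)) lp.2.
have lY' : L2 (Yn n.+1) (`|Num.sqrt (1 + fnorm G ^+ 2)| *
   Num.sqrt ((r + dt * c_phi r) ^+ 2 + (cW * Num.sqrt dt * c_phi r) ^+ 2)).
  apply: L2_dom lS; first exact: (rv_filtration uc t'0).
  apply: aeW => w; rewrite ger0_norm ?mulr_ge0 ?fnorm_ge0// SY.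
  by rewrite -ler_sqr ?nnegrE ?mulr_ge0 ?fnorm_ge0// exprMn EG.
apply: L2_le lY'.
rewrite ger0_norm// -sqrtrM ?addr_ge0 ?sqr_ge0//.
have ka0 : 0 <= ka by rewrite !mulr_ge0 ?addr_ge0.
have cr : c_phi r <= ka * r.
  rewrite /c_proj /ka -!mulrA [2 * _]mulrCA ler_wpM2l ?addr_ge0// mulrCA ler_wpM2l//; lra.
have cr0 : 0 <= c_phi r by exact: c_proj_ge0.
have kg0 : 0 <= kg by rewrite !mulr_ge0 ?addr_ge0 ?mulr_ge0.
have cW0 : 0 <= cW by rewrite /c_bm !mulr_ge0.
have hc : 0 <= cubic_step c1 c2 dt h.
  rewrite /cubic_step !mulr_ge0 ?addr_ge0// ?mulr_ge0 ?sqr_ge0 ?addr_ge0 ?mulr_ge0 ?sqr_ge0//.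
  exact: ltW.
rewrite ler_sqrt//.
have -> : cubic_step c1 c2 dt h = (1 + c2 * dt ^+ 2 * h ^+ 2) * ((1 + c1 * dt) * h).
  by rewrite /cubic_step; ring.
apply: ler_pM.
- by rewrite addr_ge0// sqr_ge0.
- by rewrite addr_ge0 ?sqr_ge0.
- have -> : c2 * dt ^+ 2 * h ^+ 2 = dt ^+ 2 * (kg * h) ^+ 2 by rewrite /c2; ring.
  rewrite lerD2l /G fnormZ exprMn (ger0_norm dt0); apply: ler_wpM2l; first exact: sqr_ge0.
  have Gb : fnorm (basis_field P a (n%:R * dt) (Un n) (Yn n)) <= kg * h.
    have := fnorm_basis_field K0 ca (mulr_ge0 (ler0n _ n) dt0) UU lY iY.
    move/le_trans; apply; rewrite /kg [leRHS]mulrAC; apply: ler_wpM2r.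
      by rewrite addr_ge0 ?mulr_ge0.
    rewrite -!mulrA ler_wpM2l// ler_wpM2l// ler_wpM2l// -rh !mulrA.
    have := ler_wpM2l (mulr_ge0 K0 r0) r1; nra.
  by rewrite lerXn2r ?nnegrE ?fnorm_ge0 ?mulr_ge0.
- have e1 : (r + dt * c_phi r) ^+ 2 <= ((1 + ka * dt) * r) ^+ 2.
    rewrite lerXn2r ?nnegrE ?addr_ge0 ?mulr_ge0 ?addr_ge0 ?mulr_ge0//.
    have := ler_wpM2l dt0 cr; lra.
  have e2 : (cW * Num.sqrt dt * c_phi r) ^+ 2 <= (cW ^+ 2 * dt * ka ^+ 2) * r ^+ 2.
    have e3 : c_phi r ^+ 2 <= (ka * r) ^+ 2 by rewrite lerXn2r// nnegrE; exact: le_trans cr.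
    have -> : (cW * Num.sqrt dt * c_phi r) ^+ 2 = cW ^+ 2 * dt * c_phi r ^+ 2.
      by rewrite -{2}(sqr_sqrtr dt0); ring.
    have -> : cW ^+ 2 * dt * ka ^+ 2 * r ^+ 2 = cW ^+ 2 * dt * (ka * r) ^+ 2 by ring.
    by rewrite ler_wpM2l// mulr_ge0// sqr_ge0.
  rewrite (le_trans (lerD e1 e2))// exprMn -mulrDl rh ler_wpM2r// /c1.
  have := ler_wpM2l (mulr_ge0 (sqr_ge0 ka) dt0) dtT; nra.
Qed.

(** [B] is chosen before the number of steps, the scheme and its initial data; only the bound [h0]
    on the initial second moment enters. *)
Lemma em_moments h0 : 1 <= h0 -> exists2 B : R, 0 <= B &
  forall N (Un : nat -> 'M[R]_(k, d)) (Yn : nat -> Omega -> 'cV[R]_k) U0 Y0,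
  let dt := T / N%:R in (0 < N)%N ->
  dlr_euler_maruyama P a b W U0 Y0 dt N Un Yn ->
  U0 *m U0^T = 1%:M -> rv_measurable (F 0) Y0 -> L2 Y0 (Num.sqrt h0) ->
  (forall n, (n <= N)%N -> inv_norm_le (second_moment P (Yn n)) g) ->
  forall n, (n <= N)%N -> [/\ Un n *m (Un n)^T = 1%:M,
    rv_measurable (F (n%:R * dt)) (Yn n) & L2 (Yn n) B].
Proof.
move=> h01; have ka0 : 0 <= ka by rewrite !mulr_ge0 ?addr_ge0.
have c10 : 0 <= c1.
  have e1 : 0 <= ka ^+ 2 * T by rewrite mulr_ge0 ?sqr_ge0 ?ltW.
  have e2 : 0 <= cW ^+ 2 * ka ^+ 2 by rewrite mulr_ge0 ?sqr_ge0.
  rewrite /c1; lra.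
have c20 : 0 <= c2 by exact: sqr_ge0.
have [H H0 HN] := cubic_recursion_bounded T0 c10 c20 h01.
exists (Num.sqrt H) => [|N Un Yn U0 Y0 dt N0 em UU0 mY0 lY0 iY n nN]; first exact: sqrtr_ge0.
have dt0 : 0 <= dt by apply: divr_ge0 => //; exact: ltW.
have dtT : dt <= T by rewrite /dt ler_piMr ?invf_le1 ?ler1n ?ltr0n//; exact: ltW.
suff [UU mY lY] : [/\ Un n *m (Un n)^T = 1%:M, rv_measurable (F (n%:R * dt)) (Yn n) &
    L2 (Yn n) (Num.sqrt (iter n (cubic_step c1 c2 dt) h0))].
  by split=> //; apply: L2_le lY; rewrite ler_sqrt// HN.
have x1 i : 1 <= iter i (cubic_step c1 c2 dt) h0.
  elim: i => [|i IH] //; rewrite iterS; apply: le_trans (IH) _.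
  exact: cubic_step_ge1.
elim: n nN => [|n IH] nN; first by rewrite (em_init_U em) (em_init_Y em) mul0r.
have [UU mY lY] := IH (ltnW nN).
exact: (em_moment_step dt0 dtT (x1 n) nN em UU mY (iY _ (ltnW nN)) lY).
Qed.

End EulerMaruyamaMoments.

(** * The DO solution *)

Section PathContinuity.
Variable R : realType.
Notation mu := (@lebesgue_measure R).

Lemma absolutely_continuous_within (x y : R) (f : R -> R) :
  absolutely_continuous_on x y f -> {within `[x, y], continuous f}.
Proof.
move=> ac; apply/subspace_continuousP => s; rewrite /= in_itv/= => sxy.
apply/cvgrPdist_le => e e0; have [d d0 H] := ac e e0.
rewrite near_withinE; exists d => //= r sr; rewrite in_itv/= => rxy; apply: ltW.
have [sr'|rs] := leP s r.
  have := H 1%N (fun=> s) (fun=> r).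
  rewrite !big_ord1 distrC; apply => //; last by rewrite (le_lt_trans (ler_norm _))// distrC.
  by move=> i _; split=> //; [case/andP: sxy|case/andP: rxy].
have := H 1%N (fun=> r) (fun=> s).
rewrite !big_ord1; apply => //; last by rewrite (le_lt_trans (ler_norm _)).
by move=> i _; split; [case/andP: rxy|exact: ltW|case/andP: sxy].
Qed.

Lemma within_fnorm_near p q (A : set R) (f : R -> 'M[R]_(p, q)) (x e : R) :
  (forall i j, {within A, continuous (fun t => f t i j)}) -> A x -> 0 < e ->
  \forall r \near within A (nbhs x), fnorm (f r - f x) <= e.
Proof.
move=> fA Ax e0; pose e' := e / ((p * q)%:R + 1).
have d0 : 0 < (p * q)%:R + 1 :> R by rewrite ltr_wpDl.
have e'0 : 0 < e' by rewrite divr_gt0.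
have : \forall r \near within A (nbhs x), forall i, forall j, `|f r i j - f x i j| <= e'.
  apply: filter_forall => i; apply: filter_forall => j.
  have /subspace_continuousP/(_ x Ax)/cvgrPdist_le/(_ _ e'0) := fA i j.
  by apply: filterS => r; rewrite distrC.
apply: filterS => r H; rewrite (le_trans (fnorm_le_coord (c := e') _))//.
  by move=> i j; rewrite !mxE.
have <- : ((p * q)%:R + 1) * e' = e by rewrite mulrC /e' divfK// gt_eqF.
by rewrite ler_wpM2r ?ltW// ltrDl.
Qed.

Lemma within_coord p q (A : set R) (f : R -> 'M[R]_(p, q)) i j :
  {within A, continuous f} -> {within A, continuous (fun t => f t i j)}.
Proof.
move=> /subspace_continuousP cf; apply/subspace_continuousP => x Ax.
exact: (cvg_comp f (fun M : 'M[R]_(p, q) => M i j) (cf x Ax) (@coord_continuous R p q i j (f x))).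
Qed.

Lemma within_fnorm p q (A : set R) (f : R -> 'M[R]_(p, q)) (B : 'M[R]_(p, q)) (c : R) :
  {within A, continuous f} -> {within A, continuous (fun t => c + fnorm (f t - B))}.
Proof.
move=> cf; apply/subspace_continuousP => x Ax; apply/cvgrPdist_le => e e0.
have := within_fnorm_near (fun i j => @within_coord p q A f i j cf) Ax e0.
apply: filterS => y; apply: le_trans.
change (`|c + fnorm (f x - B) - (c + fnorm (f y - B))| <= fnorm (f y - f x)).
rewrite ler_norml; have := fnormD (f x - f y) (f y - B); have := fnormD (f y - f x) (f x - B).
rewrite !addrA !subrK (fnormBC (f x) (f y)); lra.
Qed.

Lemma Rintegral_increment (T t t' : R) (f : R -> R) : {within `[0, T], continuous f} ->
  0 <= t -> t <= t' -> t' <= T ->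
  \int[mu]_(z in `[0, t']) f z - \int[mu]_(z in `[0, t]) f z = \int[mu]_(z in `[t, t']) f z.
Proof.
move=> cf t0 tt' t'T.
have ct : {within `[t, t'], continuous f}.
  apply: continuous_subspaceW cf => z /=; rewrite !in_itv/= => /andP[z1 z2].
  by rewrite (le_trans t0)// (le_trans z2).
rewrite (Rintegral_oc cf)// -(Rintegral_oc ct)// set_itv1 Rintegral_set1 subr0//.
Qed.

End PathContinuity.

Section ProjectedPath.
Variables (R : realType) (d k q : nat) (T rate K : R).
Hypotheses (K0 : 0 <= K) (rate0 : 0 < rate).
Variable f : R -> 'cV[R]_d -> 'M[R]_(d, q).
Hypothesis cf : coefficient_bound T rate K f.

Lemma fnorm_projectedB s t (U U' : 'M[R]_(k, d)) (y y' : 'cV[R]_k) :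
  0 <= s <= T -> 0 <= t <= T -> U' *m U'^T = 1%:M -> U *m U^T = 1%:M ->
  fnorm (U *m f s (U^T *m y) - U' *m f t (U'^T *m y')) <=
  (1 + k%:R) * K * (1 + fnorm y) * (fnorm (U - U') + fnorm (y - y') + `|s - t| `^ rate).
Proof.
move=> sT tT UU' UU; have [s0 _] := andP sT; have [t0 _] := andP tT; case: cf => fL fg fT.
have -> : U *m f s (U^T *m y) - U' *m f t (U'^T *m y') =
  (U - U') *m f s (U^T *m y) + U' *m ((f s (U^T *m y) - f t (U^T *m y)) +
    (f t (U^T *m y) - f t (U'^T *m y'))).
  by rewrite mulmxBl addrA subrK mulmxBr addrA subrK.
set u := fnorm (U - U'); set e := fnorm (y - y'); set p := _ `^ rate; set n := fnorm y.
have [u0 e0 p0 n0] : [/\ 0 <= u, 0 <= e, 0 <= p & 0 <= n].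
  by split; rewrite ?fnorm_ge0 ?powR_ge0.
have h1 : fnorm ((U - U') *m f s (U^T *m y)) <= u * (K * (1 + n)).
  rewrite (le_trans (fnormM _ _))// ler_wpM2l//.
  by have := fg _ (U^T *m y) s0; rewrite fnorm_isometry.
have h2 : fnorm (f s (U^T *m y) - f t (U^T *m y)) <= K * (1 + n) * p.
  by have := fT _ _ (U^T *m y) sT tT; rewrite fnorm_isometry.
have h3 : fnorm (f t (U^T *m y) - f t (U'^T *m y')) <= K * (u * n + e).
  rewrite (le_trans (fL _ _ _ t0))// ler_wpM2l//; exact: fnorm_lift.
have h4 : fnorm (U' *m ((f s (U^T *m y) - f t (U^T *m y)) +
    (f t (U^T *m y) - f t (U'^T *m y')))) <= k%:R * (K * (1 + n) * p + K * (u * n + e)).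
  rewrite (le_trans (fnormM _ _))// ler_pM ?fnorm_ge0 ?fnorm_orthonormal_le//.
  by rewrite (le_trans (fnormD _ _))// lerD.
rewrite (le_trans (fnormD _ _))// (le_trans (lerD h1 h4))//.
rewrite -subr_ge0.
have -> : (1 + k%:R) * K * (1 + n) * (u + e + p) -
  (u * (K * (1 + n)) + k%:R * (K * (1 + n) * p + K * (u * n + e))) =
  K * (1 + n) * (e + p) + k%:R * K * (u + n * e) by ring.
by rewrite addr_ge0 ?mulr_ge0 ?addr_ge0 ?mulr_ge0.
Qed.

(** Makes the drift integral of almost every path a limit of Riemann sums. Continuity in time comes
    from the Hoelder hypothesis, in space from the Lipschitz one. *)
Lemma continuous_projected (U : R -> 'M[R]_(k, d)) (y : R -> 'cV[R]_k) i j :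
  (forall t, 0 <= t <= T -> U t *m (U t)^T = 1%:M) ->
  (forall i j, {within `[0, T], continuous (fun t => U t i j)}) ->
  {within `[0, T], continuous y} ->
  {within `[0, T], continuous (fun t => (U t *m f t ((U t)^T *m y t)) i j)}.
Proof.
move=> UU cU cy; apply/subspace_continuousP => s sT'; have sT : 0 <= s <= T by move: sT'; rewrite /= in_itv.
pose A := (1 + k%:R) * K * (1 + fnorm (y s)).
have A0 : 0 <= A by rewrite !mulr_ge0 ?addr_ge0 ?fnorm_ge0.
apply/cvgrPdist_le => e e0; pose e' := e / (A * 3 + 1).
have d0 : 0 < A * 3 + 1 by rewrite ltr_wpDl// mulr_ge0.
have e'0 : 0 < e' by rewrite divr_gt0.
have nU : \forall r \near within `[0, T]%classic (nbhs s), fnorm (U r - U s) <= e'.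
  exact: within_fnorm_near cU sT' e'0.
have ny : \forall r \near within `[0, T]%classic (nbhs s), fnorm (y r - y s) <= e'.
  exact: within_fnorm_near (fun i' j' => @within_coord R _ _ _ _ i' j' cy) sT' e'0.
have np : \forall r \near within `[0, T]%classic (nbhs s), `|s - r| `^ rate <= e'.
  rewrite near_withinE; exists (e' `^ rate^-1) => /=; first by rewrite powR_gt0.
  move=> r /= sr _; have := @ge0_ler_powR _ rate (ltW rate0) `|s - r| (e' `^ rate^-1).
  rewrite !nnegrE powR_ge0 normr_ge0 => /(_ isT isT (ltW sr)).
  by rewrite -powRrM mulVf ?gt_eqF// powRr1// ltW.
have nT : \forall r \near within `[0, T]%classic (nbhs s), 0 <= r <= T.
  by rewrite near_withinE; apply: nearW => r; rewrite /= in_itv.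
near=> r.
have h1 : fnorm (U r - U s) <= e' by near: r.
have h2 : fnorm (y r - y s) <= e' by near: r.
have h3 : `|s - r| `^ rate <= e' by near: r.
have rT : 0 <= r <= T by near: r.
rewrite [X in `|X|](_ : _ = (U s *m f s ((U s)^T *m y s) - U r *m f r ((U r)^T *m y r)) i j); last first.
  by rewrite [RHS]mxE [X in _ = _ + X]mxE.
rewrite (le_trans (coord_le_fnorm _ _ _))//.
rewrite (le_trans (fnorm_projectedB _ _ sT rT (UU _ rT) (UU _ sT)))// -/A.
rewrite (@le_trans _ _ (A * (e' * 3)))//.
  rewrite ler_wpM2l// !(fnormBC _ (U r)) (fnormBC _ (y r)); lra.
have : (A * 3 + 1) * e' = e by rewrite mulrC /e' divfK// gt_eqF.
have := ltW e'0; lra.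
Unshelve. all: by end_near. Qed.

End ProjectedPath.

Section DynamicallyOrthogonal.
Variables (R : realType) (dO : measure_display) (Omega : measurableType dO).
Variables (P : probability Omega R) (F : R -> set (set Omega)) (d m k : nat).
Variable W : R -> Omega -> 'cV[R]_m.
Variables (a : R -> 'cV[R]_d -> 'cV[R]_d) (b : R -> 'cV[R]_d -> 'M[R]_(d, m)).
Variables (T rate K g : R).
Hypotheses (uc : usual_conditions P F) (bm : brownian_motion P F W).
Hypotheses (T0 : 0 < T) (K0 : 0 <= K) (g0 : 0 <= g) (rate0 : 0 < rate).
Hypotheses (ca : coefficient_bound T rate K a) (cb : coefficient_bound T rate K b).
Local Notation mO := (@measurable dO Omega).
Local Notation mu := (@lebesgue_measure R).
Local Notation l2 := (l2 P).
Local Notation L2 := (L2 P).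
Local Notation c_phi := (c_proj k K).
Local Notation cW := (c_bm R m k).

Section Solution.
Variables (U0 : 'M[R]_(k, d)) (Y0 : Omega -> 'cV[R]_k).
Variables (U : R -> 'M[R]_(k, d)) (Y : R -> Omega -> 'cV[R]_k).
Variable M : R -> Omega -> 'cV[R]_k.
Hypothesis ds : do_solution P a b W U0 Y0 F T U Y.
Hypothesis ito : ito_integral P F T W (fun s w => U s *m b s ((U s)^T *m Y s w)) M.
Hypothesis Yeq : {ae P, forall w, forall t : R, 0 <= t <= T ->
  Y t w = Y0 w + \col_i (\int[lebesgue_measure]_(s in `[0, t])
                    (U s *m a s ((U s)^T *m Y s w)) i 0) + M t w}.

Let T0' : 0 <= T := ltW T0.
Let UU := do_orthonormal ds.
Let Phi s w := U s *m a s ((U s)^T *m Y s w).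

Lemma do_U_within i j : {within `[0, T], continuous (fun t => U t i j)}.
Proof. exact/absolutely_continuous_within/(do_abs_continuous ds). Qed.

Lemma do_meas t : 0 <= t <= T -> rv_measurable mO (Y t).
Proof.
by move=> tT; apply: (rv_filtration uc (t := t)); [case/andP: tT|exact: (do_adapted ds)].
Qed.

Lemma do_paths : {ae P, forall w, [/\ {within `[0, T], continuous (fun t => Y t w)},
   {within `[0, T], continuous (fun t => M t w)},
   forall i, {within `[0, T], continuous (fun t => Phi t w i 0)} &
   forall s t i, 0 <= s -> s <= t -> t <= T ->
     (Y t w - Y s w - (M t w - M s w)) i 0 = \int[mu]_(r in `[s, t]) Phi r w i 0]}.
Proof.
move: (do_continuous ds) (ito_continuous ito) Yeq; apply: filterS3 => w cY cM eY.
have cPhi i : {within `[0, T], continuous (fun t => Phi t w i 0)}.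
  exact: (continuous_projected K0 rate0 ca UU do_U_within cY).
split=> // s t i s0 st tT; rewrite -(Rintegral_increment (cPhi i) s0 st tT).
rewrite (eY s) ?s0 ?(le_trans st)// (eY t) ?tT ?(le_trans s0)// !mxE; ring.
Qed.

(** [Y 0] agrees with [Y0] only almost surely, as [M 0] vanishes only almost surely; an error bound
    0 expresses this. *)
Lemma do_initial_error : rv_measurable mO Y0 -> L2 (fun w => Y0 w - Y 0 w) 0.
Proof.
move=> mY0; have l1 := ito_at0 uc bm T0' ito.
have z0T : 0 <= (0 : R) <= T by rewrite lexx.
apply: L2_dom_mx l1; first by apply: rvB => //; exact: do_meas.
apply: filterS Yeq => w eY; rewrite eY//; set z := \col_i _.
have -> : z = 0 by apply/colP => i; rewrite !mxE set_itv1 Rintegral_set1.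
by rewrite addr0 opprD addrA subrr add0r fnormN.
Qed.

Lemma do_initial r0 : L2 Y0 r0 -> L2 (Y 0) r0.
Proof.
move=> lY0; have l1 := L2B lY0 (do_initial_error lY0.1).
by rewrite addr0 in l1; apply: L2_ext l1 => w; rewrite opprB addrC subrK.
Qed.

Let c := (k * 1)%:R * ((1 + k%:R) * K).
Let c0 : 0 <= c. Proof. by rewrite !mulr_ge0 ?addr_ge0. Qed.

Lemma fnorm_Phi s w : 0 <= s <= T -> fnorm (Phi s w) <= (1 + k%:R) * K * (1 + fnorm (Y s w)).
Proof.
move=> sT; have [s0 _] := andP sT; case: ca => _ fg _.
rewrite (le_trans (fnormM _ _))// -mulrA ler_pM ?fnorm_ge0//.
  by rewrite (le_trans (fnorm_orthonormal_le (UU sT)))// lerDr.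
by have := fg _ ((U s)^T *m Y s w) s0; rewrite fnorm_isometry// UU.
Qed.

(** Gronwall is applied to each path and expectations are taken afterwards: the resulting bound
    involves only [Y s] and increments of [M], whose second moments are controlled, so no regularity
    of [t -> E|Y(t)|^2] is needed. *)
Lemma do_short_finite s s' rs La : 0 <= s -> s <= s' -> s' <= T -> c * (s' - s) <= 2^-1 ->
  L2 (Y s) rs -> (forall t, s <= t <= s' -> L2 (fun w => M t w - M s w) La) ->
  forall t, s <= t <= s' -> L2 (Y t) (2 * (1 + rs + La)).
Proof.
move=> s0 ss' s'T ch lYs lM t /[dup] ts /andP[st ts'].
have itv r : s <= r <= s' -> 0 <= r <= T.
  by move=> /andP[r1 r2]; rewrite (le_trans s0)// (le_trans r2).
pose z (r : R) (w : Omega) : R := `|1| + fnorm (Y s w) + fnorm (M r w - M s w).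
have lz r : s <= r <= s' -> l2 (z r) (`|1| + rs + La).
  move=> rs'; apply: l2D; last exact: (lM r rs').2.
  by apply: l2D; [have := l2_cst P `|1|; rewrite normr_id|exact: lYs.2].
have r_ge0 : 0 <= rs := L2_ge0 lYs.
have La0 : 0 <= La := L2_ge0 (lM t ts).
have mY := do_meas (itv t ts).
have h0 : 0 <= s' - s by rewrite subr_ge0.
have l1 : l2 (fun w => fnorm (Y t w)) (`|1| + rs + La + 2 * c * ((s' - s) * (`|1| + rs + La))).
  apply: (@l2_time_integral _ _ _ P s s' z _ (z t)) => //.
  - by rewrite mulr_ge0.
  - exact: rmeas_fnorm.
  - exact: lz.
  apply: filterS do_paths => w [cY cM cPhi eY].
  have sub : `[s, s']%classic `<=` `[0, T]%classic.
    by move=> r; rewrite /= !in_itv/=; exact: itv.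
  have cz : {within `[s, s'], continuous (z^~ w)}.
    have := within_fnorm (B := M s w) (c := `|1| + fnorm (Y s w)) cM.
    exact: (continuous_subspaceW sub).
  have cy : {within `[s, s'], continuous (fun r => 1 + fnorm (Y r w))}.
    apply: (continuous_subspaceW sub); have := within_fnorm (B := 0) (c := 1) cY.
    rewrite (_ : (fun t0 => 1 + fnorm (Y t0 w - 0)) = (fun r => 1 + fnorm (Y r w)))//.
    by apply/funext => r; rewrite subr0.
  split=> //.
  have z0 r : 0 <= z r w by rewrite /z !addr_ge0 ?fnorm_ge0.
  rewrite !ger0_norm ?fnorm_ge0//; last by apply: Rintegral_ge0 => r _.
  (* Adding 1 to the norm turns the affine growth of the drift into the linear form that Gronwall
     requires. *)
  suff : 1 + fnorm (Y t w) <= z t w + 2 * c * \int[mu]_(r in `[s, s']) z r w by lra.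
  apply: (short_gronwall ss' c0 ch cy cz) => // [r _|r rs'].
    by rewrite addr_ge0 ?fnorm_ge0.
  have [sr rs2] := andP rs'; have rT := itv r rs'.
  set I := \int[mu]_(_ in _) _.
  have Iy : mu.-integrable `[s, r] (EFin \o (fun r => 1 + fnorm (Y r w))).
    exact: (continuous_integrable_itv cy).
  have HI : fnorm (Y r w - Y s w - (M r w - M s w)) <= c * I.
    rewrite /c -mulrA; apply: fnorm_le_coord => i j; rewrite (ord1 j) eY//; last by case/andP: rT.
    have IP : mu.-integrable `[s, r] (EFin \o (fun r => Phi r w i 0)).
      by apply: (continuous_integrable_itv (cPhi i)) => //; case/andP: rT.
    rewrite (le_trans (le_normr_Rintegral _ IP))//.
    have mI : measurable (`[s, r]%classic : set (measurableTypeR R)) by exact: measurable_itv.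
    pose C := (1 + k%:R) * K.
    have IZ : mu.-integrable `[s, r] (EFin \o (fun x => C * (1 + fnorm (Y x w)))).
      exact: (integrableZl mI C Iy).
    rewrite -/C -(RintegralZl C mI Iy).
    apply: le_Rintegral => //; first exact: integrable_abse IP.
    move=> x; rewrite /= in_itv/= => /andP[x1 x2].
    rewrite (le_trans (coord_le_fnorm _ _ _))// fnorm_Phi// itv// x1 (le_trans x2)//.
  have -> : Y r w = (Y r w - Y s w - (M r w - M s w)) + (Y s w + (M r w - M s w)).
    by rewrite addrA [_ + Y s w]addrAC !subrK.
  have := fnormD (Y r w - Y s w - (M r w - M s w)) (Y s w + (M r w - M s w)).
  have := fnormD (Y s w) (M r w - M s w).
  rewrite /z normr1; lra.
split=> //; apply: l2_le l1; rewrite normr1; set q := 1 + rs + La.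
have q0 : 0 <= q by rewrite !addr_ge0.
have -> : q + 2 * c * ((s' - s) * q) = q + 2 * (c * (s' - s)) * q by ring.
have := ler_wpM2r q0 ch; lra.
Qed.

Lemma do_M_increment s t B : 0 <= s -> s <= t -> t <= T ->
  (forall r, s <= r <= t -> L2 (Y r) B) ->
  L2 (fun w => M t w - M s w) (2 * cW * (Num.sqrt (t - s) * c_phi B)).
Proof.
move=> s0 st tT lY; have B0 : 0 <= B by apply: (L2_ge0 (lY s _)); rewrite lexx.
have m0 : rv_measurable (F s) (fun=> 0 : 'M[R]_(k, m)).
  by apply: rv_cst; exact: (filtration_sigma uc).
have := ito_increment_bound uc bm ito s0 st tT m0 (L2_cst P 0) (c_proj_ge0 k K0 B0).
move=> H; apply: L2_ext (H _) => [w|r rst]; first by rewrite mul0mx subr0.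
have rT : 0 <= r <= T by case/andP: rst => r1 r2; rewrite (le_trans s0)// (le_trans r2).
have [r0 _] := andP rT.
by apply: L2_ext (L2_projected K0 cb r0 (UU rT) (lY r rst)) => w; rewrite subr0.
Qed.

(** Bootstrap that removes the inexplicit bound on [M]. A bound [B] for [Y] on the interval gives
    [(1 + B) / 4] for the increments of [M], hence the new bound [2 (1 + rs) + (1 + B) / 2], so each
    round halves the excess over [6 (1 + rs)]. *)
Lemma do_short_moment s s' rs : 0 <= s -> s <= s' -> s' <= T -> c * (s' - s) <= 2^-1 ->
  2 * cW * (Num.sqrt (s' - s) * ((1 + k%:R) * K)) <= 4^-1 ->
  L2 (Y s) rs -> forall t, s <= t <= s' -> L2 (Y t) (6 * (1 + rs) + 1).
Proof.
move=> s0 ss' s'T ch kh lYs.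
have rs0 : 0 <= rs := L2_ge0 lYs.
have cW0 : 0 <= cW by rewrite /c_bm !mulr_ge0.
have [La lM] := ito_increment_finite uc bm T0' ito.
have [B0 B00 lB0] : exists2 B0, 0 <= B0 & forall t, s <= t <= s' -> L2 (Y t) (6 * (1 + rs) + B0).
  have H := do_short_finite s0 ss' s'T ch lYs.
  have {}H : forall t, s <= t <= s' -> L2 (Y t) (2 * (1 + rs + La)).
    by apply: H => t /andP[t1 t2]; apply: lM => //; exact: le_trans s'T.
  have La0 : 0 <= La by apply: (L2_ge0 (lM s s' s0 ss' s'T)).
  exists (2 * La); first by rewrite mulr_ge0.
  by move=> t /H; apply: L2_le; lra.
suff lj j : forall t, s <= t <= s' -> L2 (Y t) (6 * (1 + rs) + B0 / 2 ^+ j).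
  (* More than [B0] halvings bring the excess below 1. *)
  move=> t ts; apply: L2_le (lj (Num.truncn B0).+1 t ts).
  rewrite lerD2l ler_pdivrMr ?exprn_gt0// mul1r.
  apply: (@le_trans _ _ (Num.truncn B0).+1%:R); first by rewrite ltW// truncnS_gt.
  by rewrite -natrX ler_nat ltnW// ltn_expl.
elim: j => [|j IH] t ts; first by rewrite expr0 divr1; exact: lB0.
set B := 6 * (1 + rs) + B0 / 2 ^+ j in IH.
have B0' : 0 <= B by apply: (L2_ge0 (IH s _)); rewrite lexx.
have lL r : s <= r <= s' -> L2 (fun w => M r w - M s w) (4^-1 * (1 + B)).
  move=> /andP[r1 r2]; apply: L2_le (do_M_increment (B := B) s0 r1 (le_trans r2 s'T) _); last first.
    by move=> x /andP[x1 x2]; apply: IH; rewrite x1 (le_trans x2).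
  rewrite /c_proj; have -> : 2 * cW * (Num.sqrt (r - s) * ((1 + k%:R) * (K * (1 + B)))) =
    2 * cW * (Num.sqrt (r - s) * ((1 + k%:R) * K)) * (1 + B) by ring.
  apply: ler_wpM2r; first exact: addr_ge0.
  rewrite (le_trans _ kh)// ler_wpM2l ?mulr_ge0//.
  by rewrite ler_wpM2r ?mulr_ge0 ?addr_ge0// ler_wsqrtr// lerD2r.
apply: L2_le (do_short_finite s0 ss' s'T ch lYs lL ts).
rewrite exprS invfM mulrCA; move: (B0 / 2 ^+ j) @B B0' {lL IH} => x B _; rewrite /B; lra.
Qed.

Variable B : R.
Hypothesis lYB : forall t, 0 <= t <= T -> L2 (Y t) B.
Hypothesis iY : forall t, 0 <= t <= T -> inv_norm_le (second_moment P (Y t)) g.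

Let B0 : 0 <= B. Proof. by apply: (L2_ge0 (lYB (t := 0) _)); rewrite lexx. Qed.

(** [psi] is 0 for a plain bound on the drift, and the drift of the scheme at the left end point for
    the local error. *)
Lemma do_drift_increment s t (psi : Omega -> 'cV[R]_k) q : 0 <= s -> s <= t -> t <= T ->
  rv_measurable mO psi -> (forall r, s <= r <= t -> L2 (fun w => Phi r w - psi w) q) ->
  L2 (fun w => Y t w - Y s w - (M t w - M s w) - (t - s) *: psi w)
     ((k * 1)%:R * ((t - s) * q)).
Proof.
move=> s0 st tT mpsi lpsi; have sT : 0 <= s <= T by rewrite s0 (le_trans st).
have tT' : 0 <= t <= T by rewrite tT (le_trans s0).
have mM r : 0 <= r <= T -> rv_measurable mO (M r) by exact: (ito_meas uc ito).
have mZ : rv_measurable mO (fun w => Y t w - Y s w - (M t w - M s w) - (t - s) *: psi w).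
  apply: rvB => //; last by apply: rvZ => //; exact: rmeas_cst.
  by apply: rvB => //; apply: rvB => //; [exact: do_meas|exact: do_meas|exact: mM|exact: mM].
apply: L2_of_coord => i j; rewrite (ord1 j).
have l1 : l2 (fun w => (Y t w - Y s w - (M t w - M s w) - (t - s) *: psi w) i 0)
    (0 + 1 * ((t - s) * q)); last by move: l1; rewrite add0r mul1r.
apply: (@l2_time_integral _ _ _ P s t (fun r w => (Phi r w - psi w) i 0) _ (fun=> 0)) => //.
- exact: (mZ i 0).
- by have := l2_cst P 0; rewrite normr0.
- by move=> r rst; exact: (L2_coord i 0 (lpsi r rst)).
apply: filterS do_paths => w [_ _ cPhi eY].
have cP : {within `[s, t], continuous (fun r => Phi r w i 0)}.
  apply: continuous_subspaceW (cPhi i) => r; rewrite /= !in_itv/= => /andP[r1 r2].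
  by rewrite (le_trans s0)// (le_trans r2).
have mI : measurable (`[s, t]%classic : set (measurableTypeR R)) by exact: measurable_itv.
have IP : mu.-integrable `[s, t] (EFin \o (fun r => Phi r w i 0)).
  exact: (continuous_integrable_itv cP).
have cc : {within `[s, t], continuous (cst (psi w i 0) : R -> R)}.
  by apply: continuous_subspaceT => x; exact: cvg_cst.
have IC : mu.-integrable `[s, t] (EFin \o cst (psi w i 0)).
  exact: (continuous_integrable_itv cc).
have E : (fun r => (Phi r w - psi w) i 0) = (fun r => Phi r w i 0 - cst (psi w i 0) r).
  by apply/funext => r; rewrite [LHS]mxE [X in _ + X]mxE.
split.
  rewrite E; apply/subspace_continuousP => r rst; apply: cvgB; last exact: cvg_cst.
  by have /subspace_continuousP/(_ r rst) := cP.
have muE : fine (mu `[s, t]) = t - s.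
  rewrite lebesgue_measure_itv/= lte_fin; case: ltP => // ts.
  by apply/eqP; rewrite eq_sym subr_eq0; apply/eqP/le_anti; rewrite ts.
rewrite E (RintegralB mI IP IC) Rintegral_cst// muE.
rewrite [X in `|X|]mxE eY// [X in _ + X]mxE [X in _ - X]mxE normr0 add0r mul1r.
by rewrite [psi w i 0 * _]mulrC.
Qed.

(** Hoelder constant of exponent 1/2 for [Y] in mean square; [sqrt T] turns the linear modulus of
    the drift part into a square root. *)
Definition c_path := (k * 1)%:R * Num.sqrt T * c_phi B + 2 * cW * c_phi B.

Let cphi0 : 0 <= c_phi B. Proof. exact: c_proj_ge0. Qed.
Let cW0 : 0 <= cW. Proof. by rewrite /c_bm !mulr_ge0. Qed.

Lemma c_path_ge0 : 0 <= c_path.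
Proof. by apply: addr_ge0; apply: mulr_ge0 => //; apply: mulr_ge0. Qed.

Lemma do_M_increment_sqrt s t : 0 <= s -> s <= t -> t <= T ->
  L2 (fun w => M t w - M s w) (2 * cW * c_phi B * Num.sqrt (t - s)).
Proof.
move=> s0 st tT; apply: L2_le (do_M_increment (B := B) s0 st tT _); first by lra.
by move=> r /andP[r1 r2]; apply: lYB; rewrite (le_trans s0)// (le_trans r2).
Qed.

Lemma do_drift_bound s t : 0 <= s -> s <= t -> t <= T ->
  L2 (fun w => Y t w - Y s w - (M t w - M s w)) ((k * 1)%:R * ((t - s) * c_phi B)).
Proof.
move=> s0 st tT.
have m0 : rv_measurable mO (fun=> 0 : 'cV[R]_k) by exact: rv_cst.
have H := do_drift_increment s0 st tT m0.
apply: L2_ext (H (c_phi B) _) => [w|r /andP[r1 r2]]; first by rewrite scaler0 subr0.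
have rT : 0 <= r <= T by rewrite (le_trans s0)// (le_trans r2).
have [r0 _] := andP rT.
by apply: L2_ext (L2_projected K0 ca r0 (UU rT) (lYB rT)) => w; rewrite subr0.
Qed.

Lemma do_Y_increment s t : 0 <= s -> s <= t -> t <= T ->
  L2 (fun w => Y t w - Y s w) (c_path * Num.sqrt (t - s)).
Proof.
move=> s0 st tT.
have := L2D (do_drift_bound s0 st tT) (do_M_increment_sqrt s0 st tT).
move=> H; apply: L2_le (L2_ext _ H) => [|w]; last by rewrite subrK.
have h0 : 0 <= t - s by rewrite subr_ge0.
have hh : t - s <= Num.sqrt T * Num.sqrt (t - s).
  rewrite -{1}(sqr_sqrtr h0) expr2 ler_wpM2r// ler_wsqrtr//; lra.
move: cphi0 hh; rewrite /c_path; set p := c_phi B; set x := Num.sqrt T => p0 hh.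
have -> : ((k * 1)%:R * x * p + 2 * cW * p) * Num.sqrt (t - s) =
  (k * 1)%:R * ((x * Num.sqrt (t - s)) * p) + 2 * cW * p * Num.sqrt (t - s) by ring.
by rewrite lerD2r ler_wpM2l// ler_wpM2r.
Qed.

(** Lipschitz constant of [U]. *)
Definition c_basis := (k * d)%:R * c_field d k K g B.

Lemma c_basis_ge0 : 0 <= c_basis.
Proof. by rewrite /c_basis mulr_ge0// c_field_ge0. Qed.

Lemma do_U_velocity : {ae mu, forall r, 0 <= r <= T -> derivable U r 1 /\
  'D_1 U r = basis_field P a r (U r) (Y r)}.
Proof.
have [N [mN N0 HN]] := do_U_equation ds; exists N; split=> // r nQ; apply: HN => H; apply: nQ => rT.
have [dU _ eU] := H rT; split=> //.
by rewrite /basis_field -eU mulKmx//; case: (iY rT).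
Qed.

(** [A] is 0 for the Lipschitz bound on [U], and the field at time [s] for the local error of an
    Euler step. *)
Lemma do_U_linear s t (A : 'M[R]_(k, d)) L : 0 <= s -> s <= t -> t <= T -> 0 <= L ->
  (forall r, s <= r <= t -> fnorm (basis_field P a r (U r) (Y r) - A) <= L) ->
  fnorm (U t - U s - (t - s) *: A) <= (k * d)%:R * (L * (t - s)).
Proof.
move=> s0 st tT L0 GA; apply: fnorm_le_coord => i j.
have := ac_increment (c := A i j) (do_abs_continuous ds i j) s0 st tT L0.
rewrite !mxE [A i j * _]mulrC; apply.
have [N [mN N0 HN]] := do_U_velocity; exists N; split=> // r nQ; apply: HN => H; apply: nQ => rst.
have rT : 0 <= r <= T by case/andP: rst => r1 r2; rewrite (le_trans s0)// (le_trans r2).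
have [dU eU] := H rT; split; first exact: (derivable_mxP _ _ _).1.
have -> : 'D_1 (fun t => U t i j) r = 'D_1 U r i j by rewrite derive_mx// mxE.
rewrite eU (le_trans _ (GA r rst))// (le_trans _ (coord_le_fnorm _ i j))//.
by rewrite [X in _ <= `|X|]mxE [X in _ <= `|_ + X|]mxE.
Qed.

Lemma do_U_increment s t : 0 <= s -> s <= t -> t <= T ->
  fnorm (U t - U s) <= c_basis * (t - s).
Proof.
move=> s0 st tT; have cf0 := c_field_ge0 d k K0 g0 B0.
have := do_U_linear (A := 0) s0 st tT cf0; rewrite scaler0 subr0 /c_basis -mulrA; apply.
move=> r /andP[r1 r2]; have rT : 0 <= r <= T by rewrite (le_trans s0)// (le_trans r2).
have [r0 _] := andP rT.
by rewrite subr0; exact: (fnorm_basis_field_le K0 ca g0 r0 (UU rT) (lYB rT) (iY rT)).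
Qed.

(** Consistency of the explicit Euler step for the basis: along the solution the field changes
    through [U], through [Y] and through the explicit time dependence, which give the three
    summands. *)
Lemma do_U_secant s t tau : 0 <= s -> s <= t -> t <= T -> (t - s) `^ rate <= tau ->
  fnorm (U t - U s - (t - s) *: basis_field P a s (U s) (Y s)) <=
  c_basis * (c_basis * (t - s) + c_path * Num.sqrt (t - s) + tau) * (t - s).
Proof.
move=> s0 st tT tst; have cf0 := c_field_ge0 d k K0 g0 B0.
have tau0 : 0 <= tau := le_trans (powR_ge0 _ _) tst.
have h0 : 0 <= t - s by rewrite subr_ge0.
have sT : 0 <= s <= T by rewrite s0 (le_trans st).
have v0 : 0 <= c_basis * (t - s) + c_path * Num.sqrt (t - s) + tau.
  by rewrite !addr_ge0// mulr_ge0// ?c_basis_ge0 ?c_path_ge0.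
have := do_U_linear (A := basis_field P a s (U s) (Y s)) s0 st tT (mulr_ge0 cf0 v0).
set V := _ + tau; have -> : c_basis * V * (t - s) = (k * d)%:R * (c_field d k K g B * V * (t - s)).
  by rewrite {1}/c_basis -!mulrA.
apply; move=> r /andP[r1 r2]; have rT : 0 <= r <= T by rewrite (le_trans s0)// (le_trans r2).
apply: (fnorm_basis_fieldB K0 ca g0 rT sT (UU rT) (UU sT) (lYB rT) (lYB sT) _ (iY rT) (iY sT)).
- apply: L2_le (do_Y_increment s0 r1 (le_trans r2 tT)).
  by rewrite ler_wpM2l ?c_path_ge0// ler_wsqrtr// lerD2r.
- apply: le_trans (do_U_increment s0 r1 (le_trans r2 tT)) _.
  by rewrite ler_wpM2l ?c_basis_ge0// lerD2r.
- apply: le_trans tst; rewrite ger0_norm ?subr_ge0//.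
  by rewrite ge0_ler_powR ?nnegrE ?subr_ge0 ?(ltW rate0)// lerD2r.
Qed.

End Solution.

(** The short intervals have a length fixed by the coefficients, so [[0, T]] is covered by a number
    of them that is known before the solution, and the bound of [do_short_moment] is iterated that
    many times. *)
Lemma do_moments r0 : 0 <= r0 -> exists2 B : R, 0 <= B & forall
    (U0 : 'M[R]_(k, d)) (Y0 : Omega -> 'cV[R]_k)
    (U : R -> 'M[R]_(k, d)) (Y : R -> Omega -> 'cV[R]_k),
  do_solution P a b W U0 Y0 F T U Y -> L2 Y0 r0 ->
  forall t, 0 <= t <= T -> L2 (Y t) B.
Proof.
move=> r00; have cW0 : 0 <= cW by rewrite /c_bm !mulr_ge0.
have T0' := ltW T0.
pose c := (k * 1)%:R * ((1 + k%:R) * K); pose q := 2 * cW * ((1 + k%:R) * K).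
have c0 : 0 <= c by rewrite !mulr_ge0 ?addr_ge0.
have q0 : 0 <= q by rewrite !mulr_ge0 ?addr_ge0.
(* [h <= e1] gives [c h <= 1/2] and [h <= e2^2] gives [q sqrt(h) <= 1/4], the two smallness
   conditions of [do_short_moment]. *)
pose e1 := (2 * c + 1)^-1; pose e2 := (4 * q + 1)^-1.
have c1 : 0 < 2 * c + 1 by rewrite ltr_wpDl// mulr_ge0.
have q1 : 0 < 4 * q + 1 by rewrite ltr_wpDl// mulr_ge0.
have e10 : 0 < e1 by rewrite invr_gt0.
have e20 : 0 < e2 by rewrite invr_gt0.
pose e := Num.min e1 (e2 ^+ 2).
have e0 : 0 < e by rewrite lt_min e10 exprn_gt0.
pose N := (Num.truncn (T / e)).+1; pose h := T / N%:R.
have h0 : 0 < h by rewrite divr_gt0// ltr0n.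
have he : h <= e.
  rewrite /h ler_pdivrMr ?ltr0n// mulrC -ler_pdivrMr// ltW//; exact: truncnS_gt.
have ch : c * h <= 2^-1.
  have h1 : h <= e1 by apply: le_trans he _; rewrite ge_min lexx.
  have : (2 * c + 1) * e1 = 1 by rewrite divff// gt_eqF.
  have := ler_wpM2l c0 h1; lra.
have qh : q * Num.sqrt h <= 4^-1.
  have h2 : Num.sqrt h <= e2.
    rewrite -(ger0_norm (ltW e20)) -sqrtr_sqr ler_wsqrtr// (le_trans he)// ge_min lexx orbT//.
  have : (4 * q + 1) * e2 = 1 by rewrite divff// gt_eqF.
  have := ler_wpM2l q0 h2; lra.
pose next (r : R) := 6 * (1 + r) + 1; pose B i := iter i next r0.
have Bge i : 0 <= B i by elim: i => [|i IH] //; rewrite /B iterS -/(B i) /next; lra.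
have Ble i : B i <= B i.+1 by rewrite /B iterS -/(B i) /next; have := Bge i; lra.
exists (B N) => // U0 Y0 U Y ds lY0; have [M ito Yeq] := do_Y_equation ds.
suff H i : (i <= N)%N -> forall t, 0 <= t <= i%:R * h -> L2 (Y t) (B i).
  move=> t tT; apply: (H N (leqnn N)); move: tT; rewrite /h mulrC divfK ?pnatr_eq0//.
have NhT : N%:R * h = T by rewrite /h mulrC divfK ?pnatr_eq0.
elim: i => [|i IH] iN t.
  by rewrite mul0r => /le_anti <-; exact: (do_initial ds ito Yeq).
move=> /andP[t0 ti]; have [tt|tt] := leP t (i%:R * h).
  by apply: L2_le (Ble i) (IH (ltnW iN) t _); rewrite t0.
have ih0 : 0 <= i%:R * h by rewrite mulr_ge0// ltW.
have hh : i.+1%:R * h - i%:R * h = h by rewrite -natr1; ring.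
rewrite /B iterS -/(B i) /next.
apply: (do_short_moment (s := i%:R * h) (s' := i.+1%:R * h) ds ito Yeq) => //.
- by rewrite -subr_ge0 hh ltW.
- by rewrite -NhT ler_wpM2r ?ler_nat// ltW.
- by rewrite hh.
- rewrite hh; have -> : 2 * cW * (Num.sqrt h * ((1 + k%:R) * K)) = q * Num.sqrt h by rewrite /q; ring.
  exact: qh.
- by apply: IH; [exact: ltnW|rewrite ih0 lexx].
- by rewrite ltW.
Qed.

End DynamicallyOrthogonal.

(** * The error estimate *)

Section QuadraticGronwall.
Variable R : realType.

(** Cauchy-Schwarz brings the accumulated drift errors into the quadratic form in which the
    martingale errors appear, so that one Gronwall inequality treats both. *)
Lemma sum_le_sqrt (n : nat) (dt T : R) (v : nat -> R) : 0 <= dt -> n%:R * dt <= T ->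
  \sum_(i < n) dt * v i <= Num.sqrt T * Num.sqrt (dt * \sum_(i < n) v i ^+ 2).
Proof.
move=> dt0 nT; have T0 : 0 <= T by apply: le_trans nT; rewrite mulr_ge0.
have S0 : 0 <= \sum_(i < n) v i ^+ 2 by apply: sumr_ge0 => i _; exact: sqr_ge0.
rewrite (le_trans (ler_norm _))// -ler_sqr ?nnegrE ?mulr_ge0 ?sqrtr_ge0//.
rewrite real_normK ?num_real// exprMn !sqr_sqrtr ?mulr_ge0// -mulr_sumr exprMn.
have := sum_cauchy_schwarz (fun i : 'I_n => v i) (fun=> 1).
under eq_bigr do rewrite mulr1; rewrite expr1n sumr_const card_ord => CS.
rewrite -[_ *+ _]mulr_natl mulr1 in CS.
have -> : T * (dt * \sum_(i < n) v i ^+ 2) = T * dt * (\sum_(i < n) v i ^+ 2) by ring.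
apply: (@le_trans _ _ (dt ^+ 2 * ((\sum_(i < n) v i ^+ 2) * n%:R))).
  by rewrite ler_wpM2l ?sqr_ge0.
have -> : dt ^+ 2 * ((\sum_(i < n) v i ^+ 2) * n%:R) =
  n%:R * dt * dt * (\sum_(i < n) v i ^+ 2) by ring.
by rewrite ler_wpM2r// ler_wpM2r.
Qed.

(** Value at the final time of the supersolution used in [quadratic_gronwall], with the power
    bounded by an exponential. *)
Definition c_gronwall (C T : R) := Num.sqrt (2 * C ^+ 2 * T * expR (8 * C ^+ 2 * T)).

(* [x_n = rho (A (1 + beta)^n)^(1/2)] with [A = 2 C^2 T], [beta = 8 C^2 dt] is a
   supersolution of [x_n = C (dt \sum_(i < n) (2 x_i + rho)^2)^(1/2)]. *)
Lemma quadratic_gronwall (Q : nat -> R -> Prop) (N : nat) (C dt T rho : R) :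
  0 <= C -> 0 <= dt -> N%:R * dt <= T -> 0 <= rho ->
  (forall n x y, x <= y -> Q n x -> Q n y) ->
  (forall n (x : nat -> R), (n <= N)%N -> (forall i, 0 <= x i) ->
     (forall i, (i < n)%N -> Q i (x i)) ->
     Q n (C * Num.sqrt (dt * \sum_(i < n) (2 * x i + rho) ^+ 2))) ->
  forall n, (n <= N)%N -> Q n (c_gronwall C T * rho).
Proof.
move=> C0 dt0 NT rho0 Qmono Qstep.
have T0 : 0 <= T by apply: le_trans NT; rewrite mulr_ge0.
pose A := 2 * C ^+ 2 * T; pose be := 8 * C ^+ 2 * dt.
have A0 : 0 <= A by rewrite !mulr_ge0 ?sqr_ge0.
have be0 : 0 <= be by rewrite !mulr_ge0 ?sqr_ge0.
pose y i := Num.sqrt (A * (1 + be) ^+ i).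
have q0 i : 0 <= A * (1 + be) ^+ i by rewrite mulr_ge0// exprn_ge0// addr_ge0.
have y2 i : y i ^+ 2 = A * (1 + be) ^+ i by rewrite sqr_sqrtr.
have H n : (n <= N)%N -> Q n (y n * rho).
  have [M] := ubnP n; elim: M n => // M IH n; rewrite ltnS => nM nN.
  have nT : n%:R * dt <= T by apply: le_trans NT; rewrite ler_wpM2r// ler_nat.
  apply: (Qmono _ _ _ _ (Qstep n (fun i => y i * rho) nN _ _)); last first.
  - move=> i ni; apply: IH; [exact: leq_trans ni nM|exact: ltnW (leq_trans ni nN)].
  - by move=> i; rewrite mulr_ge0// sqrtr_ge0.
  rewrite -ler_sqr ?nnegrE ?mulr_ge0 ?sqrtr_ge0// exprMn sqr_sqrtr; last first.
    by rewrite mulr_ge0// sumr_ge0// => i _; exact: sqr_ge0.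
  have S1 : \sum_(i < n) (2 * (y i * rho) + rho) ^+ 2 <=
      \sum_(i < n) rho ^+ 2 * (8 * (A * (1 + be) ^+ i) + 2).
    apply: ler_sum => i _; rewrite -y2.
    have -> : (2 * (y i * rho) + rho) ^+ 2 = rho ^+ 2 * (2 * y i + 1) ^+ 2 by ring.
    rewrite ler_wpM2l ?sqr_ge0// -subr_ge0.
    have -> : 8 * y i ^+ 2 + 2 - (2 * y i + 1) ^+ 2 = (2 * y i - 1) ^+ 2 by ring.
    exact: sqr_ge0.
  have S2 : \sum_(i < n) rho ^+ 2 * (8 * (A * (1 + be) ^+ i) + 2) =
      rho ^+ 2 * (8 * A * (\sum_(i < n) (1 + be) ^+ i) + 2 * n%:R).
    rewrite -mulr_sumr big_split/= sumr_const card_ord -!mulr_sumr.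
    by congr (_ * (_ + _)); rewrite ?mulrA ?mulr_natr.
  have S3 : be * (\sum_(i < n) (1 + be) ^+ i) = (1 + be) ^+ n - 1.
    by rewrite [RHS]subrX1 [1 + be - 1]addrC addKr.
  have C2dt : 0 <= C ^+ 2 * dt by rewrite mulr_ge0 ?sqr_ge0.
  rewrite mulrA (le_trans (ler_wpM2l C2dt S1))// S2 exprMn y2.
  set G := \sum_(i < n) (1 + be) ^+ i in S3 *.
  have -> : C ^+ 2 * dt * (rho ^+ 2 * (8 * A * G + 2 * n%:R)) =
    rho ^+ 2 * (A * (be * G) + 2 * C ^+ 2 * (n%:R * dt)) by rewrite /be; ring.
  rewrite S3 [leRHS]mulrC ler_wpM2l ?sqr_ge0//.
  have : 2 * C ^+ 2 * (n%:R * dt) <= A by rewrite /A ler_wpM2l// mulr_ge0 ?sqr_ge0.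
  lra.
move=> n nN; apply: Qmono (H n nN); rewrite ler_wpM2r//.
have nT : n%:R * dt <= T by apply: le_trans NT; rewrite ler_wpM2r// ler_nat.
rewrite ler_wsqrtr// ler_wpM2l//.
apply: (@le_trans _ _ (expR be ^+ n)).
  by rewrite lerXn2r ?nnegrE ?expR_ge0 ?addr_ge0// expR_ge1Dx.
rewrite -expRM_natl ler_expR /be.
have -> : n%:R * (8 * C ^+ 2 * dt) = 8 * C ^+ 2 * (n%:R * dt) by ring.
by rewrite ler_wpM2l// mulr_ge0 ?sqr_ge0.
Qed.

End QuadraticGronwall.

Section ErrorConstants.
Variables (R : realType) (d m k : nat) (T rate K g B : R).
Local Notation c_phi := (c_proj k K B).
Local Notation cW := (c_bm R m k).
Local Notation cf := (c_field d k K g B).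
Local Notation cb := (c_basis d k K g B).
Local Notation cp := (c_path m k T K B).

(** With [rho = dt^rate], [c_sqrt] and [c_time] convert [sqrt dt] and [dt] into multiples of [rho],
    and [c_incr] does so for the modulus of the solution and the coefficients over one step. [c_U],
    [c_drift] and [c_mart] are the local error constants of the basis and of the two parts of [Y],
    and [c_pred] bounds the predictor. *)
Definition c_sqrt := T `^ (2^-1 - rate).
Definition c_time := Num.sqrt T * c_sqrt.
Definition c_incr := cb * c_time + cp * c_sqrt + 1.
Definition c_U := k%:R * (k%:R * cf ^+ 2) * c_time + cb * c_incr + cf.
Definition c_pred := B + T * c_phi + cW * Num.sqrt T * c_phi.
Definition c_drift := k%:R * cf ^+ 2 * c_pred * c_time + (k * 1)%:R * (c_phi * c_incr).
Definition c_mart := 2 * cW * (c_phi * c_incr).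
Definition c_error := (c_drift + c_U) * Num.sqrt T + c_mart.
(** Bounds the norm of the maximum of [|Y(t_n)|]. In [c_strong] it multiplies the basis error; the
    other summand is the maximal error of [Y]. *)
Definition c_sup := (k * 1)%:R * c_phi * T + k%:R * (4 * (2 * cW * c_phi * Num.sqrt T)) + B.
Definition c_strong :=
  c_gronwall c_error T * c_sup +
  (c_drift * T + k%:R * (4 * (c_mart * Num.sqrt T))) * (2 * c_gronwall c_error T + 1).

End ErrorConstants.

(** * Local errors, their accumulation and the strong error *)

Section ErrorEstimate.
Variables (R : realType) (dO : measure_display) (Omega : measurableType dO).
Variables (P : probability Omega R) (F : R -> set (set Omega)) (d m k : nat).
Variable W : R -> Omega -> 'cV[R]_m.
Variables (a : R -> 'cV[R]_d -> 'cV[R]_d) (b : R -> 'cV[R]_d -> 'M[R]_(d, m)).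
Variables (T rate K g : R).
Hypotheses (uc : usual_conditions P F) (bm : brownian_motion P F W).
Hypotheses (T0 : 0 < T) (K0 : 0 <= K) (g0 : 0 <= g) (rate0 : 0 < rate) (rate_half : rate <= 2^-1).
Hypotheses (ca : coefficient_bound T rate K a) (cb : coefficient_bound T rate K b).
Local Notation mO := (@measurable dO Omega).
Local Notation l2 := (l2 P).
Local Notation L2 := (L2 P).
Variables (U0 : 'M[R]_(k, d)) (Y0 : Omega -> 'cV[R]_k).
Variables (U : R -> 'M[R]_(k, d)) (Y : R -> Omega -> 'cV[R]_k).
Variable M : R -> Omega -> 'cV[R]_k.
Hypothesis ds : do_solution P a b W U0 Y0 F T U Y.
Hypothesis ito : ito_integral P F T W (fun s w => U s *m b s ((U s)^T *m Y s w)) M.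
Hypothesis Yeq : {ae P, forall w, forall t : R, 0 <= t <= T ->
  Y t w = Y0 w + \col_i (\int[lebesgue_measure]_(s in `[0, t])
                    (U s *m a s ((U s)^T *m Y s w)) i 0) + M t w}.
Variables (N : nat) (Un : nat -> 'M[R]_(k, d)) (Yn : nat -> Omega -> 'cV[R]_k).
Let dt := T / N%:R.
Hypotheses (N0 : (0 < N)%N) (em : dlr_euler_maruyama P a b W U0 Y0 dt N Un Yn).
Variable B : R.
Hypothesis lY : forall t, 0 <= t <= T -> L2 (Y t) B.
Hypothesis iY : forall t, 0 <= t <= T -> inv_norm_le (second_moment P (Y t)) g.
Hypothesis UUn : forall n, (n <= N)%N -> Un n *m (Un n)^T = 1%:M.
Hypothesis mYn : forall n, (n <= N)%N -> rv_measurable (F (n%:R * dt)) (Yn n).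
Hypothesis lYn : forall n, (n <= N)%N -> L2 (Yn n) B.
Hypothesis iYn : forall n, (n <= N)%N -> inv_norm_le (second_moment P (Yn n)) g.

Let t n := n%:R * dt.
Let rho := dt `^ rate.
Let E n w := Yn n w - Y (t n) w.
Let u n := fnorm (Un n - U (t n)).
(** The triangular factor is left out of the martingale part; its effect, [S - 1] applied to the
    whole predictor, is of order [dt^2] and belongs to [D]. *)
Let xi n w := Un n *m b (t n) ((Un n)^T *m Yn n w) *m (W (t n.+1) w - W (t n) w) -
  (M (t n.+1) w - M (t n) w).
Let D n w := E n.+1 w - E n w - xi n w.
Local Notation c_phi := (c_proj k K B).
Local Notation cW := (c_bm R m k).
Local Notation cf := (c_field d k K g B).
Local Notation cbs := (c_basis d k K g B).
Local Notation cp := (c_path m k T K B).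
Local Notation cs := (c_sqrt T rate).
Local Notation ct := (c_time T rate).
Local Notation ci := (c_incr d m k T rate K g B).
Local Notation cpr := (c_pred m k T K B).
Local Notation cU := (c_U d m k T rate K g B).
Local Notation cD := (c_drift d m k T rate K g B).
Local Notation cX := (c_mart d m k T rate K g B).

Let UU := do_orthonormal ds.
Let NR : (0 : R) < N%:R. Proof. by rewrite ltr0n. Qed.
Let dt_gt0 : 0 < dt. Proof. exact: divr_gt0. Qed.
Let dt0 : 0 <= dt. Proof. exact: ltW. Qed.
Let dtT : dt <= T. Proof. by rewrite /dt ler_pdivrMr// ler_peMr ?ler1n// ltW. Qed.
Let NdtT : N%:R * dt = T. Proof. by rewrite /dt mulrC divfK// gt_eqF. Qed.
Let t0 n : 0 <= t n. Proof. exact: mulr_ge0. Qed.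
Let tT n : (n <= N)%N -> t n <= T.
Proof. by move=> nN; rewrite -NdtT ler_wpM2r// ler_nat. Qed.
Let t0T n : (n <= N)%N -> 0 <= t n <= T. Proof. by move=> nN; rewrite t0 tT. Qed.
Let tS n : t n.+1 - t n = dt. Proof. by rewrite /t -natr1; ring. Qed.
Let tt n : t n <= t n.+1. Proof. by rewrite -subr_ge0 tS. Qed.
Let rho0 : 0 <= rho. Proof. exact: powR_ge0. Qed.
Let B0 : 0 <= B. Proof. by apply: (L2_ge0 (lYn (n := 0) _)). Qed.
Let cphi0 : 0 <= c_phi. Proof. exact: c_proj_ge0. Qed.
Let cW0 : 0 <= cW. Proof. by rewrite /c_bm !mulr_ge0. Qed.
Let cf0 : 0 <= cf. Proof. exact: c_field_ge0. Qed.
Let cb0 : 0 <= cbs. Proof. by apply: mulr_ge0. Qed.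
Let cp0 : 0 <= cp.
Proof. by apply: addr_ge0; apply: mulr_ge0 => //; apply: mulr_ge0. Qed.
Let cs0 : 0 <= cs. Proof. exact: powR_ge0. Qed.
Let ct0 : 0 <= ct. Proof. by apply: mulr_ge0. Qed.
Let ci1 : 1 <= ci. Proof. by rewrite lerDr addr_ge0// mulr_ge0. Qed.
Let ci0 : 0 <= ci. Proof. exact: le_trans ci1. Qed.
Let cpr0 : 0 <= cpr.
Proof.
rewrite /c_pred; have h1 : 0 <= T * c_phi by rewrite mulr_ge0// ltW.
have h2 : 0 <= cW * Num.sqrt T * c_phi by rewrite mulr_ge0// mulr_ge0.
by apply: addr_ge0 => //; exact: addr_ge0.
Qed.
Let cU0 : 0 <= cU.
Proof.
apply: addr_ge0 => //; apply: addr_ge0; last exact: mulr_ge0.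
by apply: mulr_ge0 => //; apply: mulr_ge0 => //; apply: mulr_ge0 => //; exact: sqr_ge0.
Qed.
Let cD0 : 0 <= cD.
Proof.
apply: addr_ge0; last by apply: mulr_ge0 => //; exact: mulr_ge0.
by apply: mulr_ge0 => //; apply: mulr_ge0 => //; apply: mulr_ge0 => //; exact: sqr_ge0.
Qed.
Let cX0 : 0 <= cX. Proof. by apply: mulr_ge0; apply: mulr_ge0. Qed.

(** The place where [rate <= 1/2] enters: [dt^(1/2 - rate) <= T^(1/2 - rate)]. *)
Lemma sqrt_step : Num.sqrt dt <= cs * rho.
Proof.
rewrite -powR12_sqrt// /c_sqrt /rho -{1}(subrK rate 2^-1) powRD; last first.
  by apply/implyP => _; rewrite gt_eqF.
rewrite ler_wpM2r// ge0_ler_powR ?nnegrE ?subr_ge0// ltW//.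
Qed.

Lemma step_le : dt <= ct * rho.
Proof.
rewrite /c_time -mulrA; apply: (@le_trans _ _ (Num.sqrt T * Num.sqrt dt)).
  by rewrite -{1}(sqr_sqrtr dt0) expr2 ler_wpM2r// ler_wsqrtr.
by rewrite ler_wpM2l// sqrt_step.
Qed.

Lemma incr_le : cbs * dt + cp * Num.sqrt dt + rho <= ci * rho.
Proof.
rewrite /c_incr [leRHS]mulrDl mul1r lerD2r [leRHS]mulrDl -[cbs * ct * rho]mulrA -[cp * cs * rho]mulrA.
by apply: lerD; [exact: (ler_wpM2l cb0 step_le)|exact: (ler_wpM2l cp0 sqrt_step)].
Qed.

Lemma em_basis_bound n : (n < N)%N -> fnorm (dt *: basis_field P a (t n) (Un n) (Yn n)) <= dt * cf.
Proof.
move=> nN; have nN' := ltnW nN; rewrite fnormZ (ger0_norm dt0) ler_wpM2l//.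
exact: (fnorm_basis_field_le K0 ca g0 (t0 n) (UUn nN') (lYn nN') (iYn nN')).
Qed.

Lemma basis_error_step n x : (n < N)%N -> L2 (E n) x -> u n <= x ->
  u n.+1 <= u n + dt * (cU * (2 * x + rho)).
Proof.
move=> nN lE ux; have nN' := ltnW nN.
have x0 : 0 <= x := L2_ge0 lE.
have [S [_ _ _ US _]] := em_step_cholesky em nN (UUn nN') (iYn nN').
have Gb := em_basis_bound nN.
have sec := do_U_secant uc bm T0 K0 g0 rate0 ca cb ds ito Yeq lY iY (t0 n) (tt n) (tT nN) (lexx _).
rewrite tS -/rho in sec.
have GG : fnorm (basis_field P a (t n) (Un n) (Yn n) - basis_field P a (t n) (U (t n)) (Y (t n))) <=
    cf * (x + x + 0).
  apply: (fnorm_basis_fieldB K0 ca g0 (t0T nN') (t0T nN') (UUn nN') (UU (t0T nN')) (lYn nN')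
    (lY (t0T nN')) lE (iYn nN') (iY (t0T nN')) ux).
  by rewrite subrr normr0 powR0 ?gt_eqF.
set Gn := basis_field P a (t n) (Un n) (Yn n) in US Gb GG.
set G := basis_field P a (t n) (U (t n)) (Y (t n)) in sec GG.
(* Previous error, defect of the orthonormalisation, consistency error of the DO basis, and
   propagation through the Lipschitz field. *)
have e : Un n.+1 - U (t n.+1) = (Un n - U (t n)) + ((Un n.+1 - Un n - dt *: Gn) -
   (U (t n.+1) - U (t n) - dt *: G) + dt *: (Gn - G)).
  by rewrite scalerBr; apply/matrixP => i j; rewrite !mxE; ring.
have h1 : fnorm (Un n.+1 - Un n - dt *: Gn) <= dt * (k%:R * (k%:R * cf ^+ 2) * ct * rho).
  apply: le_trans US _.
  have -> : dt * (k%:R * (k%:R * cf ^+ 2) * ct * rho) = k%:R * (k%:R * (dt * (ct * rho) * cf ^+ 2)).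
    by ring.
  rewrite ler_wpM2l// ler_wpM2l//; apply: (@le_trans _ _ ((dt * cf) ^+ 2)).
    by rewrite lerXn2r ?nnegrE ?fnorm_ge0//; exact: mulr_ge0.
  rewrite exprMn expr2 ler_wpM2r ?sqr_ge0// ler_wpM2l//; exact: step_le.
have h2 : fnorm (U (t n.+1) - U (t n) - dt *: G) <= dt * (cbs * ci * rho).
  apply: le_trans sec _; rewrite mulrC ler_wpM2l// -mulrA ler_wpM2l//; exact: incr_le.
have h3 : fnorm (dt *: (Gn - G)) <= dt * (cf * (2 * x)).
  by rewrite fnormZ (ger0_norm dt0) ler_wpM2l// (le_trans GG)// ler_wpM2l// addr0 mulr_natl mulr2n.
rewrite /u e (le_trans (fnormD _ _))// lerD2l (le_trans (fnormD _ _))//.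
apply: le_trans (lerD (le_trans (fnormB _ _) (lerD h1 h2)) h3) _.
rewrite -!mulrDr ler_wpM2l// /c_U.
set q1 := k%:R * (k%:R * cf ^+ 2) * ct; set q2 := cbs * ci.
have q10 : 0 <= q1 by apply: mulr_ge0 => //; apply: mulr_ge0 => //; apply: mulr_ge0 => //; exact: sqr_ge0.
have q20 : 0 <= q2 by exact: mulr_ge0.
have x2 : 0 <= 2 * x by exact: mulr_ge0.
rewrite -mulrDl [leRHS]mulrDl; apply: lerD; apply: ler_wpM2l => //; rewrite ?lerDl ?lerDr//.
exact: addr_ge0.
Qed.

(** Compares the DO solution inside a step with the scheme at the left end point: modulus of the
    solution over the step plus the error already present at [t n]. *)
Let L2_coupling n x r : (n < N)%N -> L2 (E n) x -> u n <= x -> t n <= r <= t n.+1 ->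
  [/\ 0 <= r <= T, L2 (fun w => Y r w - Yn n w) (cp * Num.sqrt dt + x),
     fnorm (U r - Un n) <= cbs * dt + x & `|r - t n| `^ rate <= rho].
Proof.
move=> nN lE ux /andP[r1 r2]; have nN' := ltnW nN; have rT := le_trans r2 (tT nN).
have h0 : 0 <= r - t n by rewrite subr_ge0.
have rdt : r - t n <= dt by rewrite -(tS n) lerD2r.
split; first by rewrite (le_trans (t0 n)).
- have := L2B (do_Y_increment uc bm T0 K0 rate0 ca cb ds ito Yeq lY (t0 n) r1 rT) lE.
  move=> H; apply: L2_le (L2_ext _ H) => [|w]; last by rewrite /E opprB addrA subrK.
  by rewrite lerD2r ler_wpM2l// ler_wsqrtr.
- have -> : U r - Un n = (U r - U (t n)) - (Un n - U (t n)) by rewrite opprB addrA subrK.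
  rewrite (le_trans (fnormB _ _))// lerD//.
  apply: le_trans (do_U_increment T0 K0 g0 ca ds lY iY (t0 n) r1 rT) _.
  by rewrite ler_wpM2l.
- by rewrite ger0_norm// ge0_ler_powR ?nnegrE// ltW.
Qed.

(** Origin of the form [2 x + rho] of the local errors: [x] once for the basis, once for [Y], and
    [rho] for everything that moves within a step. *)
Let coupling_le x : 0 <= x ->
  c_phi * (cbs * dt + x + (cp * Num.sqrt dt + x) + rho) <= c_phi * ci * (2 * x + rho).
Proof.
move=> x0; rewrite -mulrA ler_wpM2l//; have h1 := incr_le.
have -> : cbs * dt + x + (cp * Num.sqrt dt + x) + rho = 2 * x + (cbs * dt + cp * Num.sqrt dt + rho).
  by ring.
by rewrite mulrDr; apply: lerD => //; rewrite ler_peMl// mulr_ge0.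
Qed.

Lemma drift_error n x : (n < N)%N -> L2 (E n) x -> u n <= x ->
  L2 (D n) (cD * (2 * x + rho) * dt).
Proof.
move=> nN lE ux; have nN' := ltnW nN; have x0 : 0 <= x := L2_ge0 lE.
have [S [_ S1 _ _ SY]] := em_step_cholesky em nN (UUn nN') (iYn nN').
have Gb := em_basis_bound nN.
pose psi w := Un n *m a (t n) ((Un n)^T *m Yn n w).
have mpsi : rv_measurable mO psi.
  apply: (rv_filtration uc (t0 n)); apply: (rv_projected K0 ca) => //.
  - exact: (filtration_sigma uc).
  - exact: UUn.
  - exact: mYn.
have lpsi r : t n <= r <= t n.+1 -> L2 (fun w => U r *m a r ((U r)^T *m Y r w) - psi w)
    (c_phi * ci * (2 * x + rho)).
  move=> rr; have [rT le lu lt] := L2_coupling nN lE ux rr.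
  apply: L2_le (coupling_le x0) _.
  exact: (L2_projectedB K0 ca rT (t0T nN') (UU rT) (UUn nN') (lY rT) (lYn nN') le lu lt).
have l1 := do_drift_increment uc K0 rate0 ca ds ito Yeq (t0 n) (tt n) (tT nN) mpsi lpsi.
have lp := L2_em_predictor uc bm K0 ca cb dt0 (UUn nN') (mYn nN') (lYn nN').
have l2 := L2B (L2Ml (S - 1%:M) lp) l1.
have alg (v y p q z z' M1 M2 : 'cV[R]_k) : v - (y + p + q) - (z' - z - (M2 - M1) - p) =
    v - z' - (y - z) - (q - (M2 - M1)).
  by apply/matrixP => i j; rewrite !mxE; ring.
apply: L2_le (L2_ext _ l2) => [|w]; last by rewrite /D /E SY mulmxBl mul1mx tS; exact: alg.
rewrite tS.
set Q := Num.sqrt _.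
have Qc : Q <= cpr.
  rewrite /Q /c_pred; set x1 := B + dt * c_phi; set x2 := cW * Num.sqrt dt * c_phi.
  have x10 : 0 <= x1 by apply: addr_ge0 => //; exact: mulr_ge0.
  have x20 : 0 <= x2 by rewrite mulr_ge0// mulr_ge0.
  apply: (@le_trans _ _ (x1 + x2)).
    have -> : x1 + x2 = Num.sqrt ((x1 + x2) ^+ 2) by rewrite sqrtr_sqr ger0_norm// addr_ge0.
    by apply: ler_wsqrtr; rewrite (sqrrD x1 x2) lerD2r lerDl mulrn_wge0// mulr_ge0.
  rewrite lerD//; first by rewrite lerD2l ler_wpM2r.
  by rewrite ler_wpM2r// ler_wpM2l// ler_wsqrtr.
have h1 : fnorm (S - 1%:M) * Q <= k%:R * cf ^+ 2 * cpr * ct * rho * dt.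
  have -> : k%:R * cf ^+ 2 * cpr * ct * rho * dt = (k%:R * (dt * (ct * rho) * cf ^+ 2)) * cpr by ring.
  rewrite ler_pM ?fnorm_ge0 ?sqrtr_ge0// (le_trans S1)// ler_wpM2l//.
  apply: (@le_trans _ _ ((dt * cf) ^+ 2)).
    by rewrite lerXn2r ?nnegrE ?fnorm_ge0//; exact: mulr_ge0.
  rewrite exprMn expr2 ler_wpM2r ?sqr_ge0// ler_wpM2l//; exact: step_le.
apply: le_trans (lerD h1 (lexx _)) _; rewrite /c_drift.
set q1 := k%:R * cf ^+ 2 * cpr * ct; set q2 := c_phi * ci.
have q10 : 0 <= q1.
  by apply: mulr_ge0 => //; apply: mulr_ge0 => //; apply: mulr_ge0 => //; exact: sqr_ge0.
have -> : (q1 + (k * 1)%:R * q2) * (2 * x + rho) * dt =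
    q1 * (2 * x + rho) * dt + (k * 1)%:R * (dt * (q2 * (2 * x + rho))) by ring.
by rewrite lerD2r; apply: ler_wpM2r => //; apply: ler_wpM2l => //; rewrite lerDr mulr_ge0.
Qed.

Lemma martingale_error n x : (n < N)%N -> L2 (E n) x -> u n <= x ->
  [/\ rv_measurable (F (t n.+1)) (xi n), orth P (F (t n)) (xi n) &
      L2 (xi n) (cX * (2 * x + rho) * Num.sqrt dt)].
Proof.
move=> nN lE ux; have nN' := ltnW nN; have x0 : 0 <= x := L2_ge0 lE.
pose be w := Un n *m b (t n) ((Un n)^T *m Yn n w).
have mbe : rv_measurable (F (t n)) be.
  apply: (rv_projected K0 cb) => //; [exact: (filtration_sigma uc)|exact: UUn|exact: mYn].
have lbe : L2 be c_phi by exact: (L2_projected K0 cb (t0 n) (UUn nN') (lYn nN')).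
have q0 : 0 <= c_phi * ci * (2 * x + rho) by rewrite !mulr_ge0 ?addr_ge0 ?mulr_ge0.
have lH r : t n <= r <= t n.+1 -> L2 (fun w => U r *m b r ((U r)^T *m Y r w) - be w)
    (c_phi * ci * (2 * x + rho)).
  move=> rr; have [rT le lu lt] := L2_coupling nN lE ux rr.
  apply: L2_le (coupling_le x0) _.
  exact: (L2_projectedB K0 cb rT (t0T nN') (UU rT) (UUn nN') (lY rT) (lYn nN') le lu lt).
have l1 := ito_increment_bound uc bm ito (t0 n) (tt n) (tT nN) mbe lbe q0 lH.
have lW := L2_bm_mul uc bm (t0 n) (tt n) mbe lbe.
have lM := do_M_increment_sqrt uc bm K0 cb ds ito lY (t0 n) (tt n) (tT nN).
have sF' : sigma_algebra setT (F (t n.+1)) by exact: (filtration_sigma uc).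
split.
- apply: rvB => //; last first.
    apply: rvB => //; first exact: (ito_adapted ito (t0T nN)).
    exact: (rv_mono uc (t0 n) (tt n) (ito_adapted ito (t0T nN'))).
  apply: rvM => //; first exact: (rv_mono uc (t0 n) (tt n) mbe).
  exact: (rv_increment uc bm (t0 n) (tt n)).
- apply: (orthD lW (L2N lM)); first exact: (orth_bm uc bm (t0 n) (tt n) mbe lbe).
  by apply: (orthN lM); exact: (ito_orth uc bm (ltW T0) ito (t0 n) (tt n) (tT nN)).
- apply: L2_le (L2_ext _ (L2N l1)) => [|w]; last by rewrite /xi opprB.
  rewrite tS /c_mart; by rewrite le_eqVlt; apply/predU1P; left; ring.
Qed.

(** The errors of [Y] and of the basis feed each other and are therefore propagated under one common
    bound. *)
Let Q n x := L2 (E n) x /\ u n <= x.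

Let ce0 : 0 <= c_error d m k T rate K g B.
Proof.
rewrite /c_error; apply: addr_ge0 => //; apply: mulr_ge0 => //; exact: addr_ge0.
Qed.

Let sF n : sigma_algebra setT (F (t n)). Proof. exact: (filtration_sigma uc). Qed.
Let F_mono i j : (i <= j)%N -> F (t i) `<=` F (t j).
Proof. by move=> ij; apply: (filtration_mono uc (t0 i)); rewrite ler_wpM2r// ler_nat. Qed.
Let F_meas n : F (t n) `<=` mO. Proof. exact: (filtration_meas uc). Qed.
Let ES n w : E n.+1 w = E n w + D n w + xi n w.
Proof. by rewrite /D -addrA subrK addrC subrK. Qed.

Let lE0 : L2 (E 0%N) 0.
Proof.
have mY0 : rv_measurable mO Y0.
  by rewrite -(em_init_Y em); apply: (rv_filtration uc (t0 0%N)); exact: mYn.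
have := do_initial_error uc bm T0 ds ito Yeq mY0.
by apply: L2_ext => w; rewrite /E (em_init_Y em) /t mul0r.
Qed.

(** Both initial errors vanish, so only local errors are summed: those of the basis and of the drift
    through [sum_le_sqrt], those of the martingale part by orthogonality. *)
Lemma error_step n (x : nat -> R) : (n <= N)%N -> (forall i, 0 <= x i) ->
  (forall i, (i < n)%N -> Q i (x i)) ->
  Q n (c_error d m k T rate K g B * Num.sqrt (dt * \sum_(i < n) (2 * x i + rho) ^+ 2)).
Proof.
move=> nN x0 Qx; have iN i : (i < n)%N -> (i < N)%N by move=> /leq_trans; exact.
pose v i := 2 * x i + rho.
have nT : n%:R * dt <= T by exact: tT.
have := sum_le_sqrt v dt0 nT.
have S0 : 0 <= dt * \sum_(i < n) v i ^+ 2.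
  by rewrite mulr_ge0// sumr_ge0// => i _; exact: sqr_ge0.
have V0 := sqrtr_ge0 (dt * \sum_(i < n) v i ^+ 2).
set V := Num.sqrt (dt * \sum_(i < n) v i ^+ 2) in V0 * => SV.
have mart i (ni : (i < n)%N) := martingale_error (iN i ni) (Qx i ni).1 (Qx i ni).2.
have s1 : 0 <= Num.sqrt T * V by rewrite mulr_ge0.
split.
  have mxi i : (i < n)%N -> rv_measurable (F (t i.+1)) (xi i) by move=> /mart[].
  have oxi i : (i < n)%N -> orth P (F (t i)) (xi i) by move=> /mart[].
  have lxi i : (i < n)%N -> L2 (xi i) (cX * v i * Num.sqrt dt) by move=> /mart[].
  have lD i : (i < n)%N -> L2 (D i) (cD * v i * dt).
    by move=> ni; exact: (drift_error (iN i ni) (Qx i ni).1 (Qx i ni).2).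
  have := decomposition_L2 (fun i _ => sF i) (fun i j ij _ => F_mono ij) mxi oxi lxi
    (fun i _ => ES i) lE0 lD (leqnn n).
  apply: L2_le; rewrite add0r.
  have -> : \sum_(i < n) cD * v i * dt = cD * (\sum_(i < n) dt * v i).
    by rewrite mulr_sumr; apply: eq_bigr => i _; rewrite -mulrA [v i * _]mulrC.
  have -> : \sum_(i < n) (cX * v i * Num.sqrt dt) ^+ 2 = cX ^+ 2 * (dt * \sum_(i < n) v i ^+ 2).
    rewrite !mulr_sumr; apply: eq_bigr => i _; rewrite -{2}(sqr_sqrtr dt0); ring.
  rewrite sqrtrM ?sqr_ge0// sqrtr_sqr ger0_norm// -/V.
  rewrite /c_error [leRHS]mulrDl lerD2r (le_trans (ler_wpM2l cD0 SV))//.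
  by rewrite -[leRHS]mulrA [leRHS]mulrDl lerDl mulr_ge0.
have un j : (j <= n)%N -> u j <= \sum_(i < j) dt * (cU * v i).
  elim: j => [|j IH] jn.
    by rewrite big_ord0 /u (em_init_U em) /t mul0r (do_init ds) subrr fnorm0.
  rewrite big_ord_recr/=; have ujx := basis_error_step (iN j jn) (Qx j jn).1 (Qx j jn).2.
  by apply: le_trans ujx _; rewrite lerD2r; apply: IH; exact: ltnW.
apply: le_trans (un n (leqnn n)) _.
have -> : \sum_(i < n) dt * (cU * v i) = cU * (\sum_(i < n) dt * v i).
  by rewrite mulr_sumr; apply: eq_bigr => i _; rewrite mulrCA.
rewrite (le_trans (ler_wpM2l cU0 SV))// /c_error [leRHS]mulrDl -[_ * _ * V]mulrA.
by rewrite [(cD + cU) * _]mulrDl -addrA addrCA lerDl; apply: addr_ge0; exact: mulr_ge0.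
Qed.

Let X := c_gronwall (c_error d m k T rate K g B) T.
Let X0 : 0 <= X. Proof. exact: sqrtr_ge0. Qed.

Lemma error_bound n : (n <= N)%N -> L2 (E n) (X * rho) /\ u n <= X * rho.
Proof.
have NT : N%:R * dt <= T by rewrite NdtT.
apply: (quadratic_gronwall (Q := Q) ce0 dt0 NT rho0) => [{}n x y xy [lE ux]|]; last exact: error_step.
by split; [exact: L2_le lE|exact: le_trans xy].
Qed.

(** Once the errors at the individual times are known to be at most [X rho], the local errors are
    explicit, and the maximum is reached by Doob's inequality without a second Gronwall argument. *)
Lemma error_max : l2 (fun w => \big[Num.max/0]_(n < N.+1) fnorm (E n w))
  ((cD * T + k%:R * (4 * (cX * Num.sqrt T))) * (2 * X + 1) * rho).
Proof.
pose v := 2 * (X * rho) + rho.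
have v0 : 0 <= v by rewrite addr_ge0// mulr_ge0// mulr_ge0.
have mart i (iN : (i < N)%N) :=
  martingale_error iN (error_bound (ltnW iN)).1 (error_bound (ltnW iN)).2.
have mxi i : (i < N)%N -> rv_measurable (F (t i.+1)) (xi i) by move=> /mart[].
have oxi i : (i < N)%N -> orth P (F (t i)) (xi i) by move=> /mart[].
have lxi i : (i < N)%N -> L2 (xi i) (cX * v * Num.sqrt dt) by move=> /mart[].
have lD i : (i < N)%N -> L2 (D i) (cD * v * dt).
  by move=> iN; exact: (drift_error iN (error_bound (ltnW iN)).1 (error_bound (ltnW iN)).2).
have := decomposition_max (fun i _ => sF i) (fun i j ij _ => F_mono ij) (fun i _ => F_meas (n := i))
  mxi oxi lxi (fun i _ => ES i) lE0 lD.
apply: l2_le; rewrite add0r !sumr_const !card_ord -[cD * v * dt *+ N]mulr_natl -[_ ^+ 2 *+ N]mulr_natl.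
have -> : N%:R * (cX * v * Num.sqrt dt) ^+ 2 = (cX * v) ^+ 2 * T.
  by rewrite -[X in _ = _ * X]NdtT -{2}(sqr_sqrtr dt0); ring.
have cv0 : 0 <= cX * v by exact: mulr_ge0.
rewrite sqrtrM ?sqr_ge0// sqrtr_sqr (ger0_norm cv0).
have -> : N%:R * (cD * v * dt) = cD * v * T by rewrite -[X in _ = _ * X]NdtT; ring.
by rewrite le_eqVlt; apply/predU1P; left; rewrite /v; ring.
Qed.

(** The basis error is multiplied by [|Y(t_n)|] in the lifted error, so the maximum over [n] has to
    be controlled for the DO solution as well. *)
Lemma solution_max : l2 (fun w => \big[Num.max/0]_(n < N.+1) fnorm (Y (t n) w))
  (c_sup m k T K B).
Proof.
pose xM i w := M (t i.+1) w - M (t i) w.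
have mxi i : (i < N)%N -> rv_measurable (F (t i.+1)) (xM i).
  move=> iN; apply: rvB => //; first exact: (ito_adapted ito (t0T iN)).
  exact: (rv_mono uc (t0 i) (tt i) (ito_adapted ito (t0T (ltnW iN)))).
have oxi i : (i < N)%N -> orth P (F (t i)) (xM i).
  by move=> iN; exact: (ito_orth uc bm (ltW T0) ito (t0 i) (tt i) (tT iN)).
have lxi i : (i < N)%N -> L2 (xM i) (2 * cW * c_phi * Num.sqrt dt).
  move=> iN; have := do_M_increment_sqrt uc bm K0 cb ds ito lY (t0 i) (tt i) (tT iN).
  by rewrite tS.
have lD i : (i < N)%N -> L2 (fun w => Y (t i.+1) w - Y (t i) w - xM i w) ((k * 1)%:R * (dt * c_phi)).
  move=> iN; have := do_drift_bound uc K0 rate0 ca ds ito Yeq lY (t0 i) (tt i) (tT iN).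
  by rewrite tS.
have YS i (_ : (i < N)%N) w : Y (t i.+1) w = Y (t i) w + (Y (t i.+1) w - Y (t i) w - xM i w) + xM i w.
  by rewrite -addrA subrK addrC subrK.
have lY0 : L2 (Y (t 0%N)) B by apply: lY; exact: t0T.
have := decomposition_max (fun i _ => sF i) (fun i j ij _ => F_mono ij) (fun i _ => F_meas (n := i))
  mxi oxi lxi YS lY0 lD.
apply: l2_le; rewrite !sumr_const !card_ord -[_ * (dt * _) *+ N]mulr_natl -[_ ^+ 2 *+ N]mulr_natl.
have cv0 : 0 <= 2 * cW * c_phi by rewrite mulr_ge0// mulr_ge0.
have -> : N%:R * (2 * cW * c_phi * Num.sqrt dt) ^+ 2 = (2 * cW * c_phi) ^+ 2 * T.
  by rewrite -NdtT -{2}(sqr_sqrtr dt0); ring.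
rewrite sqrtrM ?sqr_ge0// sqrtr_sqr (ger0_norm cv0).
have -> : N%:R * ((k * 1)%:R * (dt * c_phi)) = (k * 1)%:R * c_phi * T by rewrite -NdtT; ring.
by rewrite le_eqVlt; apply/predU1P; left; rewrite /c_sup; ring.
Qed.

Lemma strong_error : l2 (fun w => \big[Num.max/0]_(n < N.+1)
    fnorm ((Un n)^T *m Yn n w - (U (t n))^T *m Y (t n) w))
  (c_strong d m k T rate K g B * rho).
Proof.
have l1 := l2D (l2Z (X * rho) solution_max) error_max.
have bm0 (f : nat -> R) : (forall n, 0 <= f n) -> 0 <= \big[Num.max/0]_(n < N.+1) f n.
  by move=> f0; elim/big_ind : _ => //= x y x0 y0; rewrite le_max x0.
have Xr0 : 0 <= X * rho by exact: mulr_ge0.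
apply: l2_le (l2_dom _ _ l1).
- rewrite ger0_norm// /c_strong -/X.
  by rewrite le_eqVlt; apply/predU1P; left; ring.
- apply: rmeas_bigmax => // -[n /= nN]; apply: rmeas_fnorm => //.
  apply: rvB => //; apply: rvM => //; try exact: rv_cst.
    by apply: (rv_filtration uc (t0 n)); exact: mYn.
  by case: (lY (t0T (n := n) nN)).
apply: aeW => w.
have M1 := bm0 (fun n => fnorm (Y (t n) w)) (fun n => fnorm_ge0 _).
have M2 := bm0 (fun n => fnorm (E n w)) (fun n => fnorm_ge0 _).
have M3 := bm0 (fun n => fnorm ((Un n)^T *m Yn n w - (U (t n))^T *m Y (t n) w)) (fun n => fnorm_ge0 _).
rewrite (ger0_norm M3) ger0_norm; last by rewrite addr_ge0// mulr_ge0.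
apply: bigmax_le => [|[n /= nN] _]; first by rewrite addr_ge0// mulr_ge0.
have nN' : (n <= N)%N by [].
rewrite fnormBC (le_trans (fnorm_lift _ _ _ (UUn nN')))// lerD//.
  rewrite ler_pM ?fnorm_ge0//; first by rewrite fnormBC; exact: (error_bound nN').2.
  exact: (le_bigmax _ (fun n : 'I_N.+1 => fnorm (Y (t n) w)) (Ordinal nN)).
rewrite fnormBC; exact: (le_bigmax _ (fun n : 'I_N.+1 => fnorm (E n w)) (Ordinal nN)).
Qed.

End ErrorEstimate.

Lemma bigmax_sqr (R : realDomainType) (I : Type) (s : seq I) (f : I -> R) :
  (forall i, 0 <= f i) ->
  \big[Num.max/0]_(i <- s) f i ^+ 2 = (\big[Num.max/0]_(i <- s) f i) ^+ 2.
Proof.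
move=> f0; have [] : 0 <= \big[Num.max/0]_(i <- s) f i /\
  \big[Num.max/0]_(i <- s) f i ^+ 2 = (\big[Num.max/0]_(i <- s) f i) ^+ 2 => //.
elim: s => [|i s [IH0 IH]]; first by rewrite !big_nil expr0n.
rewrite !big_cons IH; split; first by rewrite le_max f0.
by rewrite !maxEle ler_sqr ?nnegrE//; case: ifP.
Qed.

(** At [s = t_n] the index [n_s] is [n]; the bound on the inverse second moments along [s] in
    [[0, T]] thus yields one for every step, the last included. *)
Lemma last_step_index (R : realDomainType) (dt : R) (N n : nat) : 0 < dt -> (n <= N)%N ->
  (\max_(i < N.+1 | (i%:R * dt <= n%:R * dt)%R) i = n)%N.
Proof.
move=> dt0 nN; apply/eqP; rewrite eqn_leq; apply/andP; split.
  by apply/bigmax_leqP => i; rewrite ler_pM2r// ler_nat.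
have nN1 : (n < N.+1)%N by [].
by apply: (leq_bigmax_cond (F := fun i : 'I_N.+1 => i : nat) (Ordinal nN1)).
Qed.

Theorem theorem4p6 (R : realType)
  (dO : measure_display) (Omega : measurableType dO) (P : probability Omega R)
  (F : R -> set (set Omega)) (d m k : nat) (W : R -> Omega -> 'cV[R]_m)
  (a : R -> 'cV[R]_d -> 'cV[R]_d) (b : R -> 'cV[R]_d -> 'M[R]_(d, m))
  (T CLip Clgb rate gamma : R)
  (U0 : 'M[R]_(k, d)) (Y0 : Omega -> 'cV[R]_k) :
  (1 <= k <= d)%N ->
  0 < T ->
  usual_conditions P F ->
  brownian_motion P F W ->
  borel_coefficients a b ->
  lipschitz_in_space a b CLip ->
  0 < Clgb -> linear_growth a b Clgb ->
  time_regularity a b T rate ->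
  U0 *m U0^T = 1%:M ->
  rv_measurable (F 0) Y0 ->
  square_integrable P Y0 ->
  linearly_independent P Y0 ->
  0 < gamma ->
  exists C : R,
    forall (U : R -> 'M[R]_(k, d)) (Y : R -> Omega -> 'cV[R]_k)
      (N : nat) (Un : nat -> 'M[R]_(k, d)) (Yn : nat -> Omega -> 'cV[R]_k)
      (sigma : nat -> R),
    let dt := T / N%:R in
    (0 < N)%N ->
    do_solution P a b W U0 Y0 F T U Y ->
    dlr_euler_maruyama P a b W U0 Y0 dt N Un Yn ->
    (forall s : R, 0 <= s <= T ->
       let ns := (\max_(n < N.+1 | (n%:R * dt <= s)%R) n)%N in
       inv_norm_le (second_moment P (Y s)) (1 / gamma) /\
       inv_norm_le (second_moment P (Yn ns)) (1 / gamma)) ->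
    (forall n, (n < N)%N ->
       smallest_eigenvalue (second_moment P (Yn n)) (sigma n) /\
       dt <= Num.sqrt (sigma n) /
         (Num.sqrt Clgb *
          Num.sqrt (5 * (1 + fine ('E_P[fun w => (enorm (U0^T *m Y0 w) ^+ 2)%R])%E)
                    * expR (Clgb * (2 * T ^+ 2 + 8 * T))))) ->
    (sqrte ('E_P[fun w => (\big[Num.max/0]_(n < N.+1)
        enorm ((Un n)^T *m Yn n w
               - (U (n%:R * dt))^T *m Y (n%:R * dt) w) ^+ 2)%R])
     <= (C * dt `^ rate)%:E)%E.
Proof.
move=> _ T0 uc bm _ lip Clgb0 gr reg UU0 mY0 sqY0 _ gamma0.
have [rate0 rate_half [K [K0 ca cb]]] := coefficient_bounds lip Clgb0 gr reg.
have g0 : 0 <= 1 / gamma by rewrite divr_ge0// ltW.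
have [r0 lY0] := square_integrableP (rv_filtration uc (lexx 0) mY0) sqY0.
have r00 := L2_ge0 lY0.
(* The moment recursion has to start at a value not below 1. *)
have h01 : 1 <= 1 + r0 ^+ 2 by rewrite lerDl sqr_ge0.
have [B1 B10 emB] := em_moments k uc bm T0 K0 g0 ca cb h01.
have [B2 B20 doB] := do_moments k uc bm T0 K0 rate0 ca cb r00.
(* A common moment bound for the scheme and the DO solution; neither summand depends on the
   solution, on [N] or on the scheme. *)
pose B := B1 + B2.
exists (c_strong d m k T rate K (1 / gamma) B).
move=> U Y N Un Yn sigma dt N0 ds em inv _.
have dt0 : 0 < dt by rewrite divr_gt0// ltr0n.
have dt0' := ltW dt0.
have [M ito Yeq] := do_Y_equation ds.
have iY t : 0 <= t <= T -> inv_norm_le (second_moment P (Y t)) (1 / gamma).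
  by move=> /inv[].
have iYn n : (n <= N)%N -> inv_norm_le (second_moment P (Yn n)) (1 / gamma).
  move=> nN; have : 0 <= n%:R * dt <= T.
    rewrite mulr_ge0//=.
    have -> : T = N%:R * dt by rewrite /dt mulrC divfK// pnatr_eq0 -lt0n.
    by rewrite ler_wpM2r// ler_nat.
  by move=> /inv[_]; rewrite last_step_index.
have lYt t : 0 <= t <= T -> L2 P (Y t) B.
  by move=> tT; apply: L2_le (doB _ _ _ _ ds lY0 t tT); rewrite lerDr.
have lY0' : L2 P Y0 (Num.sqrt (1 + r0 ^+ 2)).
  by apply: L2_le lY0; rewrite -{1}(ger0_norm r00) -sqrtr_sqr ler_wsqrtr// lerDr.
have emN := emB N Un Yn U0 Y0 N0 em UU0 mY0 lY0' iYn.
have UUn n : (n <= N)%N -> Un n *m (Un n)^T = 1%:M by move=> /emN[].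
have mYn n : (n <= N)%N -> rv_measurable (F (n%:R * dt)) (Yn n) by move=> /emN[].
have lYn n : (n <= N)%N -> L2 P (Yn n) B.
  by move=> /emN[_ _]; apply: L2_le; rewrite lerDl.
have [mf c0 ff] := strong_error uc bm T0 K0 g0 rate0 rate_half ca cb ds ito Yeq N0 em lYt iY
  UUn mYn lYn iYn.
rewrite -[X in (_ <= X%:E)%E](ger0_norm c0) -sqrtr_sqr.
set c := c_strong _ _ _ _ _ _ _ _ * _ in ff *.
change (Num.sqrt (c ^+ 2))%:E with (sqrte (c ^+ 2)%:E).
rewrite lee_sqrt ?lee_fin ?sqr_ge0// unlock; apply: le_trans ff.
rewrite le_eqVlt; apply/predU1P; left; apply: eq_integral => w _ /=; congr (_%:E).
rewrite -bigmax_sqr; last by move=> n; exact: fnorm_ge0.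
by apply: eq_bigr => n _; rewrite enormE.
Qed.
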